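(* Let $K$ be an algebraically closed field, $G$ a finite group whose order is not divisible by the characteristic of $K$, $\Lambda$ a finite-dimensional $K$-algebra with an action of $G$ by algebra automorphisms, and $\Lambda*G$ the skew-group algebra. Then the category $\big((\mathrm{per}\,\Lambda)*G\big)_+$ is triangulated and is equivalent to $\mathrm{per}(\Lambda*G)$.
   Context: $\mathrm{per}\,\Lambda$ is the perfect derived category of $\Lambda$, on which $G$ acts strictly by twisting. The skew-group algebra $\Lambda*G$ is $\Lambda\otimes_K KG$ with multiplication $(a\otimes g)(b\otimes h)=a\,g(b)\otimes gh$. For a $K$-linear category $\mathcal C$ with a strict action of $G$, the skew-group category $\mathcal C*G$ has objects $\{X\}$ for $X\in\mathcal C$, morphisms $\mathrm{Hom}(\{X\},\{Y\})=\bigoplus_{g\in G}\mathrm{Hom}_{\mathcal C}(gX,Y)$ (elements written $a\otimes g$), and composition $(b\otimes h)(a\otimes g)=b\,h(a)\otimes hg$. The subscript $+$ denotes the split-closure (idempotent completion). *)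

(* Defs.v *)
From HB Require Import structures.
From mathcomp Require Import all_boot all_order all_fingroup all_algebra.
From mathcomp Require Import all_field.
From mathcomp Require Import boolp zify.

Set Implicit Arguments.
Unset Strict Implicit.
Unset Printing Implicit Defensive.

Import GRing.Theory.
Local Open Scope ring_scope.
Local Open Scope quotient_scope.

Definition dprod (I : Type) (V : I -> Type) := forall i, V i.

HB.instance Definition _ (I : Type) (V : I -> Type) :=
  gen_eqMixin (dprod V).
HB.instance Definition _ (I : Type) (V : I -> Type) :=
  gen_choiceMixin (dprod V).

Section DprodLmod.
Variables (K : fieldType) (I : Type) (V : I -> lmodType K).
Local Notation D := (dprod V).

Definition dprod_zero : D := fun=> 0.
Definition dprod_opp (f : D) : D := fun i => - f i.
Definition dprod_add (f g : D) : D := fun i => f i + g i.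
Definition dprod_scale (a : K) (f : D) : D := fun i => a *: f i.

Let addA : associative dprod_add.
Proof. by move=> f g h; apply: functional_extensionality_dep => i; apply: addrA. Qed.
Let addC : commutative dprod_add.
Proof. by move=> f g; apply: functional_extensionality_dep => i; apply: addrC. Qed.
Let add0 : left_id dprod_zero dprod_add.
Proof. by move=> f; apply: functional_extensionality_dep => i; apply: add0r. Qed.
Let addN : left_inverse dprod_zero dprod_opp dprod_add.
Proof. by move=> f; apply: functional_extensionality_dep => i; apply: addNr. Qed.

HB.instance Definition _ := GRing.isZmodule.Build D addA addC add0 addN.

Let scaleA a b (f : D) : dprod_scale a (dprod_scale b f) = dprod_scale (a * b) f.
Proof. by apply: functional_extensionality_dep => i; apply: scalerA. Qed.
Let scale1 : left_id 1 dprod_scale.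
Proof. by move=> f; apply: functional_extensionality_dep => i; apply: scale1r. Qed.
Let scaleDr : right_distributive dprod_scale +%R.
Proof. by move=> a f g; apply: functional_extensionality_dep => i; apply: scalerDr. Qed.
Let scaleDl f : {morph dprod_scale^~ f : a b / a + b}.
Proof. by move=> a b; apply: functional_extensionality_dep => i; apply: scalerDl. Qed.

HB.instance Definition _ :=
  GRing.Zmodule_isLmodule.Build K D scaleA scale1 scaleDr scaleDl.

End DprodLmod.

Section LmodSub.
Variables (K : fieldType) (V : lmodType K) (N : submodClosed V).

Record lsub := LSub { lsub_val :> V; lsub_valP : lsub_val \in N }.
HB.instance Definition _ := [isSub for lsub_val].
HB.instance Definition _ := [Choice of lsub by <:].
HB.instance Definition _ :=
  GRing.SubChoice_isSubLmodule.Build K V _ lsub (GRing.subsemimodClosedP N).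

End LmodSub.

Section LmodQuotient.
Variables (K : fieldType) (V : lmodType K) (N : submodClosed V).

Definition lquot_rel (x y : V) := x - y \in N.

Let submodN x : (- x \in N) = (x \in N).
Proof.
by apply/idP/idP => Nx; [rewrite -[x]opprK|]; rewrite -scaleN1r rpredZ.
Qed.

Let lquot_refl : reflexive lquot_rel.
Proof. by move=> x; rewrite /lquot_rel subrr rpred0. Qed.
Let lquot_sym : symmetric lquot_rel.
Proof. by move=> x y; rewrite /lquot_rel -submodN opprB. Qed.
Let lquot_trans : transitive lquot_rel.
Proof.
by move=> y x z xy yz; rewrite /lquot_rel -(subrK y x) -addrA; apply: rpredD.
Qed.

Canonical lquot_equiv := EquivRel lquot_rel lquot_refl lquot_sym lquot_trans.

Definition lquot := {eq_quot lquot_rel}.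
HB.instance Definition _ := Choice.on lquot.

Definition lclass (x : V) : lquot := \pi_({eq_quot lquot_rel}) x.

Lemma lclass_eq x y : (lclass x = lclass y) <-> (x - y \in N).
Proof. by rewrite -[x - y \in N]/(lquot_rel x y); split=> [/eqmodP|/eqmodP]. Qed.

Definition lrepr (q : lquot) : V := generic_quotient.repr (q : {eq_quot lquot_rel}).

Lemma lreprK q : lclass (lrepr q) = q.
Proof. exact: generic_quotient.reprK. Qed.

Lemma lreprP x : lrepr (lclass x) - x \in N.
Proof. by apply/lclass_eq; rewrite lreprK. Qed.

Definition lquot_zero : lquot := lclass 0.
Definition lquot_opp (q : lquot) := lclass (- lrepr q).
Definition lquot_add (q r : lquot) := lclass (lrepr q + lrepr r).
Definition lquot_scale (a : K) (q : lquot) := lclass (a *: lrepr q).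

Let oppE x : lquot_opp (lclass x) = lclass (- x).
Proof. by apply/lclass_eq; rewrite -opprD submodN; apply: lreprP. Qed.
Let addE x y : lquot_add (lclass x) (lclass y) = lclass (x + y).
Proof. by apply/lclass_eq; rewrite opprD addrACA rpredD ?lreprP. Qed.
Let scaleE a x : lquot_scale a (lclass x) = lclass (a *: x).
Proof. by apply/lclass_eq; rewrite -scalerBr rpredZ ?lreprP. Qed.

Let addA : associative lquot_add.
Proof.
by move=> x y z; rewrite -[x]lreprK -[y]lreprK -[z]lreprK !addE addrA.
Qed.
Let addC : commutative lquot_add.
Proof. by move=> x y; rewrite -[x]lreprK -[y]lreprK !addE addrC. Qed.
Let add0 : left_id lquot_zero lquot_add.
Proof. by move=> x; rewrite -[x]lreprK addE add0r. Qed.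
Let addN : left_inverse lquot_zero lquot_opp lquot_add.
Proof. by move=> x; rewrite -[x]lreprK oppE addE addNr. Qed.

HB.instance Definition _ := GRing.isZmodule.Build lquot addA addC add0 addN.

Let scaleA a b x : lquot_scale a (lquot_scale b x) = lquot_scale (a * b) x.
Proof. by rewrite -[x]lreprK !scaleE scalerA. Qed.
Let scale1 : left_id 1 lquot_scale.
Proof. by move=> x; rewrite -[x]lreprK scaleE scale1r. Qed.
Let scaleDr : right_distributive lquot_scale +%R.
Proof.
by move=> a x y; rewrite -[x]lreprK -[y]lreprK [_ + _]addE !scaleE scalerDr
  [RHS]addE.
Qed.
Let scaleDl x : {morph lquot_scale^~ x : a b / a + b}.
Proof. by move=> a b; rewrite -[x]lreprK !scaleE scalerDl [RHS]addE. Qed.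

HB.instance Definition _ :=
  GRing.Zmodule_isLmodule.Build K lquot scaleA scale1 scaleDr scaleDl.

Lemma lclass_linear : linear lclass.
Proof. by move=> a x y; rewrite -addE -scaleE. Qed.

End LmodQuotient.

Record lincat (K : fieldType) := LinCat {
  ob :> Type;
  hom : ob -> ob -> lmodType K;
  idm : forall X, hom X X;
  comp : forall X Y Z, hom Y Z -> hom X Y -> hom X Z;
  comp_linearl : forall X Y Z (f : hom X Y),
    linear (fun g : hom Y Z => comp g f);
  comp_linearr : forall X Y Z (g : hom Y Z),
    linear (fun f : hom X Y => comp g f);
  compA : forall X Y Z W (h : hom Z W) (g : hom Y Z) (f : hom X Y),
    comp h (comp g f) = comp (comp h g) f;
  comp1m : forall X Y (f : hom X Y), comp (idm Y) f = f;
  compm1 : forall X Y (f : hom X Y), comp f (idm X) = f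
}.

Arguments hom {K} C X Y : rename.
Arguments idm {K C} X : rename.
Arguments comp {K C X Y Z} g f : rename.

Notation "g \oc f" := (comp g f) (at level 40, left associativity).

Section CompTheory.
Variables (K : fieldType) (C : lincat K).
Implicit Types X Y Z : C.

Lemma compDl X Y Z (g h : hom C Y Z) (f : hom C X Y) :
  (g + h) \oc f = g \oc f + h \oc f.
Proof. by have := comp_linearl f 1 g h; rewrite /= !scale1r. Qed.

Lemma compDr X Y Z (g : hom C Y Z) (f h : hom C X Y) :
  g \oc (f + h) = g \oc f + g \oc h.
Proof. by have := comp_linearr g 1 f h; rewrite /= !scale1r. Qed.

Lemma comp0m X Y Z (f : hom C X Y) : (0 : hom C Y Z) \oc f = 0.
Proof. by apply: (@addrI _ (0 \oc f)); rewrite -compDl !addr0. Qed.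

Lemma compm0 X Y Z (g : hom C Y Z) : g \oc (0 : hom C X Y) = 0.
Proof. by apply: (@addrI _ (g \oc 0)); rewrite -compDr !addr0. Qed.

Lemma compZl X Y Z a (g : hom C Y Z) (f : hom C X Y) :
  (a *: g) \oc f = a *: (g \oc f).
Proof. by have := comp_linearl f a g 0; rewrite /= comp0m !addr0. Qed.

Lemma compZr X Y Z a (g : hom C Y Z) (f : hom C X Y) :
  g \oc (a *: f) = a *: (g \oc f).
Proof. by have := comp_linearr g a f 0; rewrite /= compm0 !addr0. Qed.

Lemma comp_suml X Y Z I (r : seq I) (P : pred I) (G : I -> hom C Y Z)
    (f : hom C X Y) :
  (\sum_(i <- r | P i) G i) \oc f = \sum_(i <- r | P i) G i \oc f.
Proof.
by elim/big_rec2: _ => [|i a b _ <-]; rewrite ?comp0m ?compDl.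
Qed.

Lemma comp_sumr X Y Z I (r : seq I) (P : pred I) (g : hom C Y Z)
    (F : I -> hom C X Y) :
  g \oc (\sum_(i <- r | P i) F i) = \sum_(i <- r | P i) g \oc F i.
Proof.
by elim/big_rec2: _ => [|i a b _ <-]; rewrite ?compm0 ?compDr.
Qed.

Definition is_iso X Y (f : hom C X Y) : Prop :=
  exists g : hom C Y X, g \oc f = idm X /\ f \oc g = idm Y.

Definition eq_hom X Y (e : X = Y) : hom C X Y :=
  match e in _ = Z return hom C X Z with erefl => idm X end.

Lemma eq_hom_id X (e : X = X) : eq_hom e = idm X.
Proof. by rewrite (Prop_irrelevance e erefl). Qed.

Lemma eq_hom_comp X Y Z (e : X = Y) (e' : Y = Z) :
  eq_hom e' \oc eq_hom e = eq_hom (etrans e e').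
Proof. by case: Z / e'; rewrite /= comp1m. Qed.

End CompTheory.

Record linfunctor (K : fieldType) (C D : lincat K) := LinFunctor {
  fob :> C -> D;
  fmap : forall X Y, hom C X Y -> hom D (fob X) (fob Y);
  fmap_linear : forall X Y, linear (@fmap X Y);
  fmap_id : forall X, fmap (idm X) = idm (fob X);
  fmap_comp : forall X Y Z (g : hom C Y Z) (f : hom C X Y),
    fmap (g \oc f) = fmap g \oc fmap f
}.
Arguments fmap {K C D} F {X Y} f : rename.

Definition is_equivalence (K : fieldType) (C D : lincat K)
    (F : linfunctor C D) : Prop :=
  exists (G : linfunctor D C)
         (eta : forall X : C, hom C X (G (F X)))
         (eps : forall Y : D, hom D (F (G Y)) Y),
    [/\ forall X, is_iso (eta X),
        forall X Y (f : hom C X Y),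
          eta Y \oc f = fmap G (fmap F f) \oc eta X,
        forall Y, is_iso (eps Y) &
        forall X Y (f : hom D X Y),
          eps Y \oc fmap F (fmap G f) = f \oc eps X].

Section SplitClosure.
Variables (K : fieldType) (C : lincat K).

Record split_ob := SplitOb {
  split_car : C;
  split_idem : hom C split_car split_car;
  split_idemP : split_idem \oc split_idem = split_idem
}.

Definition split_pred (X Y : split_ob) : {pred hom C (split_car X) (split_car Y)} :=
  fun f => split_idem Y \oc f \oc split_idem X == f.

Lemma split_pred_closed X Y : subsemimod_closed (@split_pred X Y).
Proof.
split; first split.
- by apply/eqP; rewrite compm0 comp0m.
- by move=> f g /eqP fP /eqP gP; apply/eqP; rewrite compDr compDl fP gP.
- by move=> a f /eqP fP; apply/eqP; rewrite compZr compZl fP.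
Qed.

HB.instance Definition _ X Y :=
  GRing.isSubSemiModClosed.Build K _ (@split_pred X Y) (@split_pred_closed X Y).

Definition split_hom (X Y : split_ob) : lmodType K := lsub (@split_pred X Y).

Lemma split_homl X Y (f : split_hom X Y) :
  split_idem Y \oc lsub_val f = lsub_val f.
Proof. by have /eqP <- := lsub_valP f; rewrite !compA split_idemP. Qed.

Lemma split_homr X Y (f : split_hom X Y) :
  lsub_val f \oc split_idem X = lsub_val f.
Proof. by have /eqP <- := lsub_valP f; rewrite -!compA split_idemP. Qed.

Lemma split_idm_subproof X : split_idem X \in @split_pred X X.
Proof. by apply/eqP; rewrite !split_idemP. Qed.

Lemma split_comp_subproof X Y Z (g : split_hom Y Z) (f : split_hom X Y) :
  lsub_val g \oc lsub_val f \in @split_pred X Z.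
Proof. by apply/eqP; rewrite compA split_homl -compA split_homr. Qed.

Definition split_idm X : split_hom X X := LSub (split_idm_subproof X).
Definition split_comp X Y Z (g : split_hom Y Z) (f : split_hom X Y) :
  split_hom X Z := LSub (split_comp_subproof g f).

Lemma split_linearl X Y Z (f : split_hom X Y) :
  linear (fun g : split_hom Y Z => split_comp g f).
Proof. by move=> a g h; apply: val_inj; apply: comp_linearl. Qed.

Lemma split_linearr X Y Z (g : split_hom Y Z) :
  linear (fun f : split_hom X Y => split_comp g f).
Proof. by move=> a f h; apply: val_inj; apply: comp_linearr. Qed.

Lemma split_compA X Y Z W (h : split_hom Z W) (g : split_hom Y Z)
    (f : split_hom X Y) :
  split_comp h (split_comp g f) = split_comp (split_comp h g) f.
Proof. by apply: val_inj; apply: compA. Qed.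

Lemma split_comp1m X Y (f : split_hom X Y) : split_comp (split_idm Y) f = f.
Proof. by apply: val_inj; apply: split_homl. Qed.

Lemma split_compm1 X Y (f : split_hom X Y) : split_comp f (split_idm X) = f.
Proof. by apply: val_inj; apply: split_homr. Qed.

Definition split_closure : lincat K :=
  LinCat split_linearl split_linearr split_compA split_comp1m split_compm1.

(* The canonical functor X |-> (X, id) *)
Definition to_split_ob (X : C) : split_closure :=
  @SplitOb X (idm X) (comp1m (idm X)).

Lemma to_split_subproof X Y (f : hom C X Y) :
  f \in @split_pred (to_split_ob X) (to_split_ob Y).
Proof. by apply/eqP; rewrite compm1 comp1m. Qed.

Definition to_split_map X Y (f : hom C X Y) :
  hom split_closure (to_split_ob X) (to_split_ob Y) :=
  LSub (to_split_subproof f).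

Lemma to_split_linear X Y : linear (@to_split_map X Y).
Proof. by move=> a f g; apply: val_inj. Qed.

Lemma to_split_id X : to_split_map (idm X) = idm (to_split_ob X).
Proof. exact: val_inj. Qed.

Lemma to_split_comp X Y Z (g : hom C Y Z) (f : hom C X Y) :
  to_split_map (g \oc f) = to_split_map g \oc to_split_map f.
Proof. exact: val_inj. Qed.

Definition to_split : linfunctor C split_closure :=
  LinFunctor to_split_linear to_split_id to_split_comp.

End SplitClosure.

Definition comp_functor (K : fieldType) (C D E : lincat K)
    (G : linfunctor D E) (F : linfunctor C D) : linfunctor C E.
Proof.
apply: (@LinFunctor K C E (fun X => G (F X)) (fun X Y f => fmap G (fmap F f))).
- by move=> X Y a f g; rewrite !fmap_linear.
- by move=> X; rewrite !fmap_id.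
- by move=> X Y Z g f; rewrite !fmap_comp.
Defined.

(* The axioms are those of a monoid morphism from gT to the strict endofunctors
   of C; eq_hom mediates the equalities between objects. *)
Record strict_action (K : fieldType) (gT : finGroupType) (C : lincat K) :=
  StrictAction {
  sact :> gT -> linfunctor C C;
  sact_ob1 : forall X : C, sact 1%g X = X;
  sact_obM : forall g h (X : C), sact (g * h)%g X = sact g (sact h X);
  sact_hom1 : forall (X Y : C) (f : hom C X Y),
    eq_hom (sact_ob1 Y) \oc fmap (sact 1%g) f = f \oc eq_hom (sact_ob1 X);
  sact_homM : forall g h (X Y : C) (f : hom C X Y),
    eq_hom (sact_obM g h Y) \oc fmap (sact (g * h)%g) f
      = fmap (sact g) (fmap (sact h) f) \oc eq_hom (sact_obM g h X)
}.

Section SkewCategory.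
Variables (K : fieldType) (gT : finGroupType) (C : lincat K).
Variable S : strict_action gT C.

Definition skew_hom (X Y : C) : lmodType K :=
  dprod (fun g : gT => hom C (S g X) Y).

(* The element a (x) g of Hom({X},{Y}) *)
Definition tens X Y (g : gT) (a : hom C (S g X) Y) : skew_hom X Y :=
  fun k => match g =P k with
           | ReflectT e => eq_rect g (fun l => hom C (S l X) Y) a k e
           | ReflectF _ => 0
           end.

Definition skew_idm X : skew_hom X X := tens (eq_hom (sact_ob1 S X)).

Definition skew_comp X Y Z (b : skew_hom Y Z) (a : skew_hom X Y) :
    skew_hom X Z :=
  \sum_h \sum_g
    tens (b h \oc fmap (S h) (a g) \oc eq_hom (sact_obM S h g X)).

Lemma tens_same X Y g (a : hom C (S g X) Y) : tens a g = a.
Proof.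
rewrite /tens; case: eqP => // e.
by rewrite (Prop_irrelevance e erefl).
Qed.

Lemma tens_other X Y g k (a : hom C (S g X) Y) : g != k -> tens a k = 0.
Proof. by rewrite /tens; case: eqP. Qed.

Lemma skew_sum X Y I (r : seq I) (P : pred I) (F : I -> skew_hom X Y) k :
  (\sum_(i <- r | P i) F i) k = \sum_(i <- r | P i) F i k.
Proof. by elim/big_rec2: _ => // i a b _ <-. Qed.

Lemma tens_sum X Y (f : skew_hom X Y) : f = \sum_g tens (f g).
Proof.
apply: functional_extensionality_dep => k.
rewrite skew_sum (bigD1 k) //= tens_same big1 ?addr0 // => g gk.
by rewrite tens_other.
Qed.

Lemma tens_linear X Y g : linear (@tens X Y g).
Proof.
move=> c a b; apply: functional_extensionality_dep => k.
rewrite -[RHS]/(c *: tens a k + tens b k) /tens.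
by case: eqP => [e|_]; [case: k / e | rewrite scaler0 addr0].
Qed.

Lemma tens0 X Y g : tens (0 : hom C (S g X) Y) = 0.
Proof.
by have := @tens_linear X Y g (-1) 0 0; rewrite scaler0 addr0 scaleN1r addNr.
Qed.

Lemma tens_cast X Y g g' (a : hom C (S g X) Y) (a' : hom C (S g' X) Y)
    (e : g = g') (e' : S g X = S g' X) :
  a = a' \oc eq_hom e' -> tens a = tens a'.
Proof. by case: g' / e a' e' => a' e' ->; rewrite eq_hom_id compm1. Qed.

Lemma fmap0 (D : lincat K) (F : linfunctor C D) X Y :
  fmap F (0 : hom C X Y) = 0.
Proof.
by have := @fmap_linear _ _ _ F X Y (-1) 0 0;
  rewrite scaler0 addr0 scaleN1r addNr.
Qed.

Lemma skew_comp_tens X Y Z h g (b : hom C (S h Y) Z) (a : hom C (S g X) Y) :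
  skew_comp (tens b) (tens a)
    = tens (b \oc fmap (S h) a \oc eq_hom (sact_obM S h g X)).
Proof.
rewrite /skew_comp (bigD1 h) //= [X in _ + X]big1 ?addr0; last first.
  move=> k kh; rewrite big1 // => l _.
  by rewrite (tens_other b) 1?eq_sym // !comp0m tens0.
rewrite (bigD1 g) //= [X in _ + X]big1 ?addr0 ?tens_same //.
move=> k kg.
by rewrite (tens_other a) 1?eq_sym // fmap0 compm0 comp0m tens0.
Qed.

Lemma skew_linearl X Y Z (f : skew_hom X Y) :
  linear (fun g : skew_hom Y Z => skew_comp g f).
Proof.
move=> c a b; rewrite /skew_comp scaler_sumr -big_split /=.
apply: eq_bigr => h _; rewrite scaler_sumr -big_split /=.
apply: eq_bigr => g _; rewrite -tens_linear.
by rewrite -[(c *: a + b) h]/(c *: a h + b h) !(compDl, compZl).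
Qed.

Lemma skew_linearr X Y Z (g : skew_hom Y Z) :
  linear (fun f : skew_hom X Y => skew_comp g f).
Proof.
move=> c a b; rewrite /skew_comp scaler_sumr -big_split /=.
apply: eq_bigr => h _; rewrite scaler_sumr -big_split /=.
apply: eq_bigr => k _; rewrite -tens_linear.
by rewrite -[(c *: a + b) k]/(c *: a k + b k) fmap_linear
  !(compDl, compZl, compDr, compZr).
Qed.

Lemma skew_suml X Y Z I (r : seq I) (P : pred I) (F : I -> skew_hom Y Z)
    (f : skew_hom X Y) :
  skew_comp (\sum_(i <- r | P i) F i) f = \sum_(i <- r | P i) skew_comp (F i) f.
Proof.
have L := @skew_linearl X Y Z f.
elim/big_rec2: _ => [|i a b _ <-].
  by have := L (-1) 0 0; rewrite scaler0 addr0 scaleN1r addNr.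
by have := L 1 (F i) b; rewrite !scale1r.
Qed.

Lemma skew_sumr X Y Z I (r : seq I) (P : pred I) (g : skew_hom Y Z)
    (F : I -> skew_hom X Y) :
  skew_comp g (\sum_(i <- r | P i) F i) = \sum_(i <- r | P i) skew_comp g (F i).
Proof.
have L := @skew_linearr X Y Z g.
elim/big_rec2: _ => [|i a b _ <-].
  by have := L (-1) 0 0; rewrite scaler0 addr0 scaleN1r addNr.
by have := L 1 (F i) b; rewrite !scale1r.
Qed.

Lemma fmap_eq_hom (D : lincat K) (F : linfunctor C D) X Y (e : X = Y) :
  fmap F (eq_hom e) = eq_hom (congr1 F e).
Proof. by case: Y / e; rewrite fmap_id. Qed.

Lemma sact_homM' g h X Y (f : hom C X Y) :
  fmap (S (g * h)%g) f
    = eq_hom (esym (sact_obM S g h Y)) \oc fmap (S g) (fmap (S h) f)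
        \oc eq_hom (sact_obM S g h X).
Proof. by rewrite -compA -sact_homM compA eq_hom_comp eq_hom_id comp1m. Qed.

Lemma skew_compA_tens X Y Z W k h g (c : hom C (S k Z) W)
    (b : hom C (S h Y) Z) (a : hom C (S g X) Y) :
  skew_comp (tens c) (skew_comp (tens b) (tens a))
    = skew_comp (skew_comp (tens c) (tens b)) (tens a).
Proof.
rewrite !skew_comp_tens.
have e' : S (k * (h * g))%g X = S (k * h * g)%g X by rewrite mulgA.
apply: (tens_cast (mulgA k h g) (e' := e')).
rewrite sact_homM' !fmap_comp fmap_eq_hom -!compA !eq_hom_comp.
rewrite (compA (eq_hom _) (eq_hom _)) eq_hom_comp eq_hom_id comp1m.
by congr (_ \oc (_ \oc (_ \oc _))); congr eq_hom; apply: Prop_irrelevance.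
Qed.

Lemma skew_compA X Y Z W (c : skew_hom Z W) (b : skew_hom Y Z)
    (a : skew_hom X Y) :
  skew_comp c (skew_comp b a) = skew_comp (skew_comp c b) a.
Proof.
rewrite [c]tens_sum !skew_suml; apply: eq_bigr => k _.
rewrite [b]tens_sum skew_suml !skew_sumr skew_suml; apply: eq_bigr => h _.
rewrite [a]tens_sum !skew_sumr; apply: eq_bigr => g _.
exact: skew_compA_tens.
Qed.

Lemma skew_comp1m X Y (f : skew_hom X Y) : skew_comp (skew_idm Y) f = f.
Proof.
rewrite {2}[f]tens_sum [f in LHS]tens_sum skew_sumr.
apply: eq_bigr => g _; rewrite skew_comp_tens sact_hom1.
have e' : S (1 * g)%g X = S g X by rewrite mul1g.
apply: (tens_cast (mul1g g) (e' := e')).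
by rewrite -compA eq_hom_comp; congr (_ \oc eq_hom _); apply: Prop_irrelevance.
Qed.

Lemma skew_compm1 X Y (f : skew_hom X Y) : skew_comp f (skew_idm X) = f.
Proof.
rewrite {2}[f]tens_sum [f in LHS]tens_sum skew_suml.
apply: eq_bigr => g _; rewrite skew_comp_tens fmap_eq_hom -compA eq_hom_comp.
have e' : S (g * 1)%g X = S g X by rewrite mulg1.
apply: (tens_cast (mulg1 g) (e' := e')).
by congr (_ \oc eq_hom _); apply: Prop_irrelevance.
Qed.

Definition skew_cat : lincat K :=
  LinCat skew_linearl skew_linearr skew_compA skew_comp1m skew_compm1.

(* The canonical functor X |-> {X}, f |-> f (x) 1 *)
Definition to_skew_map X Y (f : hom C X Y) : hom skew_cat X Y :=
  tens (f \oc eq_hom (sact_ob1 S X)).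

Lemma to_skew_linear X Y : linear (@to_skew_map X Y).
Proof. by move=> a f g; rewrite /to_skew_map compDl compZl tens_linear. Qed.

Lemma to_skew_id (X : C) : to_skew_map (idm X) = idm (X : skew_cat).
Proof. by rewrite /to_skew_map comp1m. Qed.

Lemma to_skew_comp X Y Z (g : hom C Y Z) (f : hom C X Y) :
  to_skew_map (g \oc f) = to_skew_map g \oc to_skew_map f.
Proof.
rewrite [RHS]skew_comp_tens fmap_comp fmap_eq_hom.
rewrite -!compA (compA (eq_hom (sact_ob1 S Y))) sact_hom1 -!compA.
rewrite !eq_hom_comp /to_skew_map -!compA.
have e' : S 1%g X = S (1 * 1)%g X by rewrite mulg1.
apply: (tens_cast (esym (mulg1 1%g)) (e' := e')); rewrite -!compA eq_hom_comp.
by congr (_ \oc (_ \oc eq_hom _)); apply: Prop_irrelevance.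
Qed.

Definition to_skew : linfunctor C skew_cat :=
  LinFunctor (D := skew_cat) to_skew_linear to_skew_id to_skew_comp.

End SkewCategory.

Section Triangulated.
Variables (K : fieldType) (C : lincat K).

Definition has_zero : Prop := exists Z : C, idm Z = 0.

Definition has_biproducts : Prop :=
  forall X Y : C, exists (B : C) (i1 : hom C X B) (i2 : hom C Y B)
                         (p1 : hom C B X) (p2 : hom C B Y),
    [/\ p1 \oc i1 = idm X, p2 \oc i2 = idm Y, p1 \oc i2 = 0, p2 \oc i1 = 0 &
        i1 \oc p1 + i2 \oc p2 = idm B].

Record tri_data := TriData {
  shift : linfunctor C C;
  distinguished : forall X Y Z,
    hom C X Y -> hom C Y Z -> hom C Z (shift X) -> Prop
}.

(* Verdier's axioms TR1-TR4 *)
Record is_triangulated (T : tri_data) : Prop := IsTriangulated {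
  tri_zero : has_zero;
  tri_biproducts : has_biproducts;
  tri_shift : is_equivalence (shift T);
  tri_iso : forall X Y Z X' Y' Z'
      (f : hom C X Y) (g : hom C Y Z) (h : hom C Z (shift T X))
      (f' : hom C X' Y') (g' : hom C Y' Z') (h' : hom C Z' (shift T X'))
      (a : hom C X X') (b : hom C Y Y') (c : hom C Z Z'),
    is_iso a -> is_iso b -> is_iso c ->
    b \oc f = f' \oc a -> c \oc g = g' \oc b ->
    fmap (shift T) a \oc h = h' \oc c ->
    distinguished f g h -> distinguished f' g' h';
  tri_id : forall X Z : C, idm Z = 0 ->
    distinguished (idm X) (0 : hom C X Z) (0 : hom C Z (shift T X));
  tri_cone : forall X Y (f : hom C X Y),
    exists Z (g : hom C Y Z) (h : hom C Z (shift T X)), distinguished f g h;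
  tri_rotate : forall X Y Z
      (f : hom C X Y) (g : hom C Y Z) (h : hom C Z (shift T X)),
    distinguished f g h <-> distinguished g h (- fmap (shift T) f);
  tri_morphism : forall X Y Z X' Y' Z'
      (f : hom C X Y) (g : hom C Y Z) (h : hom C Z (shift T X))
      (f' : hom C X' Y') (g' : hom C Y' Z') (h' : hom C Z' (shift T X'))
      (a : hom C X X') (b : hom C Y Y'),
    distinguished f g h -> distinguished f' g' h' ->
    b \oc f = f' \oc a ->
    exists c : hom C Z Z',
      c \oc g = g' \oc b /\ fmap (shift T) a \oc h = h' \oc c;
  tri_octahedron : forall X Y Z X' Y' Z'
      (f : hom C X Y) (f1 : hom C Y Z') (f2 : hom C Z' (shift T X))
      (g : hom C Y Z) (g1 : hom C Z X') (g2 : hom C X' (shift T Y))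
      (h1 : hom C Z Y') (h2 : hom C Y' (shift T X)),
    distinguished f f1 f2 -> distinguished g g1 g2 ->
    distinguished (g \oc f) h1 h2 ->
    exists (u : hom C Z' Y') (v : hom C Y' X'),
      [/\ distinguished u v (fmap (shift T) f1 \oc g2),
          u \oc f1 = h1 \oc g, h2 \oc u = f2,
          v \oc h1 = g1 & g2 \oc v = fmap (shift T) f \oc h2]
}.

End Triangulated.

Definition exact_functor (K : fieldType) (C D : lincat K)
    (TC : tri_data C) (TD : tri_data D) (F : linfunctor C D) : Prop :=
  exists phi : forall X : C, hom D (F (shift TC X)) (shift TD (F X)),
    [/\ forall X, is_iso (phi X),
        forall X Y (f : hom C X Y),
          phi Y \oc fmap F (fmap (shift TC) f)
            = fmap (shift TD) (fmap F f) \oc phi X &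
        forall X Y Z (f : hom C X Y) (g : hom C Y Z) (h : hom C Z (shift TC X)),
          distinguished f g h ->
          distinguished (fmap F f) (fmap F g) (phi X \oc fmap F h)].

Record alg_action (K : fieldType) (gT : finGroupType) (A : falgType K) :=
  AlgAction {
  aact :> gT -> {lrmorphism A -> A};
  aact1 : forall a, aact 1%g a = a;
  aactM : forall g h a, aact (g * h)%g a = aact g (aact h a)
}.

(* A (x) KG, identified with the functions gT -> A *)
Definition skew_alg (K : fieldType) (gT : finGroupType) (A : falgType K)
  (S : alg_action gT A) := {ffun gT -> A}.

Section SkewAlgebra.
Variables (K : fieldType) (gT : finGroupType) (A : falgType K).
Variable S : alg_action gT A.

Local Notation skew_alg := (skew_alg S).

HB.instance Definition _ := Vector.copy skew_alg {ffun gT -> A}.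

(* The element a (x) g *)
Definition stens (a : A) (g : gT) : skew_alg :=
  [ffun k => if k == g then a else 0].

Definition skew_mul (x y : skew_alg) : skew_alg :=
  \sum_g \sum_h stens (x g * S g (y h)) (g * h)%g.

Definition skew_one : skew_alg := stens 1 1%g.

Lemma stens_linear g : linear (stens^~ g).
Proof.
move=> c a b; apply/ffunP => k; rewrite !ffunE.
by case: eqP => // _; rewrite scaler0 addr0.
Qed.

Lemma stens0 g : stens 0 g = 0.
Proof. by apply/ffunP => k; rewrite !ffunE if_same. Qed.

Lemma stens_sum (x : skew_alg) : x = \sum_g stens (x g) g.
Proof.
apply/ffunP => k; rewrite sum_ffunE (bigD1 k) //= ffunE eqxx big1 ?addr0 //.
by move=> g gk; rewrite ffunE eq_sym (negbTE gk).
Qed.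

Lemma skew_mul_stens a g b h :
  skew_mul (stens a g) (stens b h) = stens (a * S g b) (g * h)%g.
Proof.
rewrite /skew_mul (bigD1 g) //= [X in _ + X]big1 ?addr0; last first.
  move=> k /negbTE kg; rewrite big1 // => l _.
  by rewrite ffunE kg mul0r stens0.
rewrite (bigD1 h) //= [X in _ + X]big1 ?addr0 ?ffunE ?eqxx //.
by move=> k /negbTE kh; rewrite ?ffunE kh linear0 mulr0 stens0.
Qed.

Lemma skew_mull y : linear (skew_mul^~ y).
Proof.
move=> c a b; rewrite /skew_mul scaler_sumr -big_split /=.
apply: eq_bigr => g _; rewrite scaler_sumr -big_split /=.
apply: eq_bigr => h _; rewrite -stens_linear !ffunE mulrDl.
by rewrite -scalerAl.
Qed.

Lemma skew_mulr x : linear (skew_mul x).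
Proof.
move=> c a b; rewrite /skew_mul scaler_sumr -big_split /=.
apply: eq_bigr => g _; rewrite scaler_sumr -big_split /=.
apply: eq_bigr => h _; rewrite -stens_linear !ffunE linearP mulrDr.
by rewrite -scalerAr.
Qed.

Lemma skew_mulDl : left_distributive skew_mul +%R.
Proof. by move=> x y z; have := skew_mull z 1 x y; rewrite /= !scale1r. Qed.

Lemma skew_mulDr : right_distributive skew_mul +%R.
Proof. by move=> z x y; have := skew_mulr z 1 x y; rewrite /= !scale1r. Qed.

Lemma skew_mul0l x : skew_mul 0 x = 0.
Proof. by apply: (@addrI _ (skew_mul 0 x)); rewrite -skew_mulDl !addr0. Qed.

Lemma skew_mul0r x : skew_mul x 0 = 0.
Proof. by apply: (@addrI _ (skew_mul x 0)); rewrite -skew_mulDr !addr0. Qed.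

Let mul_suml I (r : seq I) (F : I -> skew_alg) y :
  skew_mul (\sum_(i <- r) F i) y = \sum_(i <- r) skew_mul (F i) y.
Proof. by elim/big_rec2: _ => [|i a b _ <-]; rewrite ?skew_mul0l ?skew_mulDl. Qed.

Let mul_sumr I (r : seq I) (F : I -> skew_alg) y :
  skew_mul y (\sum_(i <- r) F i) = \sum_(i <- r) skew_mul y (F i).
Proof. by elim/big_rec2: _ => [|i a b _ <-]; rewrite ?skew_mul0r ?skew_mulDr. Qed.

Lemma skew_mulA : associative skew_mul.
Proof.
move=> x y z.
rewrite [x]stens_sum !mul_suml; apply: eq_bigr => g _.
rewrite [y]stens_sum mul_suml !mul_sumr mul_suml; apply: eq_bigr => h _.
rewrite [z]stens_sum !mul_sumr; apply: eq_bigr => k _.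
by rewrite !skew_mul_stens rmorphM aactM mulrA mulgA.
Qed.

Lemma skew_mul1l : left_id skew_one skew_mul.
Proof.
move=> x; rewrite {2}[x]stens_sum [x in LHS]stens_sum mul_sumr.
by apply: eq_bigr => g _; rewrite skew_mul_stens aact1 mul1r mul1g.
Qed.

Lemma skew_mul1r : right_id skew_one skew_mul.
Proof.
move=> x; rewrite {2}[x]stens_sum [x in LHS]stens_sum mul_suml.
by apply: eq_bigr => g _; rewrite skew_mul_stens rmorph1 mulr1 mulg1.
Qed.

Lemma skew_one_neq0 : skew_one != 0.
Proof.
by apply/eqP => /ffunP /(_ 1%g); rewrite !ffunE eqxx => /eqP; rewrite oner_eq0.
Qed.

HB.instance Definition _ := GRing.Zmodule_isNzRing.Build skew_alg
  skew_mulA skew_mul1l skew_mul1r skew_mulDl skew_mulDr skew_one_neq0.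

Lemma skew_scaleAl (c : K) (x y : skew_alg) : c *: (x * y) = (c *: x) * y.
Proof.
apply: esym; have := skew_mull y c x 0.
by rewrite /= skew_mul0l !addr0.
Qed.
HB.instance Definition _ :=
  GRing.Lmodule_isLalgebra.Build K skew_alg skew_scaleAl.

Lemma skew_scaleAr (c : K) (x y : skew_alg) : c *: (x * y) = x * (c *: y).
Proof.
apply: esym; have := skew_mulr x c y 0.
by rewrite /= skew_mul0r !addr0.
Qed.
HB.instance Definition _ :=
  GRing.Lalgebra_isAlgebra.Build K skew_alg skew_scaleAr.
HB.instance Definition _ := Algebra_isFalgebra.Build K skew_alg.

Lemma skew_algE a g b h :
  stens a g * stens b h = stens (a * S g b) (g * h)%g.
Proof. exact: skew_mul_stens. Qed.

End SkewAlgebra.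

(* Modules are right modules: ract v a is v . a *)
Record raction (K : fieldType) (A : falgType K) (V : vectType K) := RAction {
  ract :> V -> A -> V;
  ract_linearl : forall a, linear (ract^~ a);
  ract_linearr : forall v, linear (ract v);
  ract1 : forall v, ract v 1 = v;
  ractM : forall v a b, ract v (a * b) = ract (ract v a) b
}.

Record rmod (K : fieldType) (A : falgType K) := RMod {
  rmod_car :> vectType K;
  rmod_act : raction A rmod_car
}.

Section Modules.
Variables (K : fieldType) (A : falgType K).
Implicit Types M N P : rmod A.

Definition is_rhom M N (f : 'Hom(M, N)) : Prop :=
  forall v a, f (rmod_act M v a) = rmod_act N (f v) a.

(* As A is finite-dimensional, its finitely generated modules are the
   finite-dimensional ones, and the finitely generated projective modules are
   the projective objects among these. *)
Definition projective P : Prop :=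
  forall M N (p : 'Hom(M, N)) (f : 'Hom(P, N)),
    is_rhom p -> is_rhom f -> (forall y, exists x, p x = y) ->
    exists2 h : 'Hom(P, M), is_rhom h & (p \o h)%VF = f.

Lemma rhom_comp M N P (g : 'Hom(N, P)) (f : 'Hom(M, N)) :
  is_rhom g -> is_rhom f -> is_rhom (g \o f)%VF.
Proof. by move=> gP fP v a; rewrite !comp_lfunE fP gP. Qed.

Lemma rhom_id M : is_rhom (\1%VF : 'Hom(M, M)).
Proof. by move=> v a; rewrite !id_lfunE. Qed.

Lemma ractDl M v w a :
  rmod_act M (v + w) a = rmod_act M v a + rmod_act M w a.
Proof. by have := ract_linearl (rmod_act M) a 1 v w; rewrite !scale1r. Qed.

Lemma ract0l M a : rmod_act M 0 a = 0.
Proof. by apply: (@addrI _ (rmod_act M 0 a)); rewrite -ractDl !addr0. Qed.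

Lemma ractZl M c v a : rmod_act M (c *: v) a = c *: rmod_act M v a.
Proof.
by have := ract_linearl (rmod_act M) a c v 0; rewrite ract0l !addr0.
Qed.

Lemma ractNl M v a : rmod_act M (- v) a = - rmod_act M v a.
Proof. by rewrite -scaleN1r ractZl scaleN1r. Qed.

Lemma rhom0 M N : is_rhom (0 : 'Hom(M, N)).
Proof. by move=> v a; rewrite !zero_lfunE ract0l. Qed.

Lemma rhomD M N (f g : 'Hom(M, N)) : is_rhom f -> is_rhom g -> is_rhom (f + g).
Proof. by move=> fP gP v a; rewrite !add_lfunE fP gP ractDl. Qed.

Lemma rhomZ M N c (f : 'Hom(M, N)) : is_rhom f -> is_rhom (c *: f).
Proof. by move=> fP v a; rewrite !scale_lfunE fP ractZl. Qed.

Lemma rhomN M N (f : 'Hom(M, N)) : is_rhom f -> is_rhom (- f).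
Proof. by move=> fP; rewrite -scaleN1r; apply: rhomZ. Qed.

Section DirectSum.
Variables M N : rmod A.

Definition dsum_ract (v : (M * N)%type) (a : A) : (M * N)%type :=
  (rmod_act M v.1 a, rmod_act N v.2 a).

Lemma dsum_linearl a : linear (dsum_ract^~ a).
Proof. by move=> c v w; congr (_, _); apply: ract_linearl. Qed.
Lemma dsum_linearr v : linear (dsum_ract v).
Proof. by move=> c a b; congr (_, _); apply: ract_linearr. Qed.
Lemma dsum_ract1 v : dsum_ract v 1 = v.
Proof. by rewrite /dsum_ract !ract1 -surjective_pairing. Qed.
Lemma dsum_ractM v a b : dsum_ract v (a * b) = dsum_ract (dsum_ract v a) b.
Proof. by rewrite /dsum_ract !ractM. Qed.

Definition dsum : rmod A := @RMod K A (M * N)%type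
  (RAction dsum_linearl dsum_linearr dsum_ract1 dsum_ractM).

Definition dsum_inl_fun (v : M) : dsum := (v, 0).
Definition dsum_inr_fun (v : N) : dsum := (0, v).

Lemma dsum_inl_linear : linear dsum_inl_fun.
Proof. by move=> c v w; congr (_, _); rewrite /= scaler0 addr0. Qed.
Lemma dsum_inr_linear : linear dsum_inr_fun.
Proof. by move=> c v w; congr (_, _); rewrite /= scaler0 addr0. Qed.

HB.instance Definition _ :=
  GRing.isLinear.Build K M dsum _ dsum_inl_fun dsum_inl_linear.
HB.instance Definition _ :=
  GRing.isLinear.Build K N dsum _ dsum_inr_fun dsum_inr_linear.

Definition dsum_fst : 'Hom(dsum, M) := linfun (fst : dsum -> M).
Definition dsum_snd : 'Hom(dsum, N) := linfun (snd : dsum -> N).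
Definition dsum_inl : 'Hom(M, dsum) := linfun dsum_inl_fun.
Definition dsum_inr : 'Hom(N, dsum) := linfun dsum_inr_fun.

Lemma dsum_fstE v : dsum_fst v = v.1. Proof. by rewrite lfunE. Qed.
Lemma dsum_sndE v : dsum_snd v = v.2. Proof. by rewrite lfunE. Qed.
Lemma dsum_inlE v : dsum_inl v = (v, 0). Proof. by rewrite lfunE. Qed.
Lemma dsum_inrE v : dsum_inr v = (0, v). Proof. by rewrite lfunE. Qed.

Lemma dsum_fst_rhom : is_rhom dsum_fst.
Proof. by move=> v a; rewrite !dsum_fstE. Qed.
Lemma dsum_snd_rhom : is_rhom dsum_snd.
Proof. by move=> v a; rewrite !dsum_sndE. Qed.
Lemma dsum_inl_rhom : is_rhom dsum_inl.
Proof. by move=> v a; rewrite !dsum_inlE; congr (_, _); rewrite /= ract0l. Qed.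
Lemma dsum_inr_rhom : is_rhom dsum_inr.
Proof. by move=> v a; rewrite !dsum_inrE; congr (_, _); rewrite /= ract0l. Qed.

End DirectSum.

Lemma dsum_projective M N :
  projective M -> projective N -> projective (dsum M N).
Proof.
move=> projM projN P Q p f pP fP pS.
have [h hP hE] := projM _ _ p (f \o dsum_inl M N)%VF pP
  (rhom_comp fP (@dsum_inl_rhom M N)) pS.
have [k kP kE] := projN _ _ p (f \o dsum_inr M N)%VF pP
  (rhom_comp fP (@dsum_inr_rhom M N)) pS.
exists ((h \o dsum_fst M N) + (k \o dsum_snd M N))%VF.
  by apply: rhomD; apply: rhom_comp => //;
    [apply: dsum_fst_rhom | apply: dsum_snd_rhom].
apply/lfunP => v; rewrite comp_lfunE add_lfunE !comp_lfunE linearD /=.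
rewrite -!(comp_lfunE p) hE kE !comp_lfunE -linearD; congr (f _).
rewrite dsum_fstE dsum_sndE dsum_inlE dsum_inrE.
by case: v => v w; congr (_, _); rewrite /= ?addr0 ?add0r.
Qed.

End Modules.

(* Bounded cochain complexes of finitely generated projective modules *)
Record cpx (K : fieldType) (A : falgType K) := Cpx {
  cob :> int -> rmod A;
  cdiff : forall i, 'Hom(cob i, cob (i + 1));
  cdiff_rhom : forall i, is_rhom (cdiff i);
  cdiff2 : forall i, (cdiff (i + 1) \o cdiff i)%VF = 0;
  cproj : forall i, projective (cob i);
  cbound : exists n : nat, forall i, (n < `|i|)%N -> forall x : cob i, x = 0
}.

Arguments cdiff_rhom {K A} c i : rename.
Arguments cproj {K A} c i : rename.

Section Complexes.
Variables (K : fieldType) (A : falgType K).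
Implicit Types X Y Z : cpx A.

Definition is_chain X Y (f : dprod (fun i => 'Hom(X i, Y i))) : Prop :=
  (forall i, is_rhom (f i)) /\
  (forall i, (cdiff Y i \o f i = f (i + 1) \o cdiff X i)%VF).

(* The components of s are indexed so that s i lowers the degree i + 1 to i. *)
Definition is_null X Y (f : dprod (fun i => 'Hom(X i, Y i))) : Prop :=
  exists s : forall i, 'Hom(X (i + 1), Y i),
    (forall i, is_rhom (s i)) /\
    (forall i, (f (i + 1) = (cdiff Y i \o s i)
                            + (s (i + 1) \o cdiff X (i + 1)))%VF).

Definition chain_pred X Y : {pred dprod (fun i => 'Hom(X i, Y i))} :=
  fun f => `[< is_chain f >].

Lemma chain_pred_closed X Y : subsemimod_closed (@chain_pred X Y).
Proof.
split; first split.
- apply/asboolP; split=> i; first exact: rhom0.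
  by rewrite comp_lfun0r comp_lfun0l.
- move=> f g /asboolP[fP fC] /asboolP[gP gC]; apply/asboolP; split=> i.
    exact: rhomD.
  by rewrite comp_lfunDr comp_lfunDl fC gC.
- move=> a f /asboolP[fP fC]; apply/asboolP; split=> i; first exact: rhomZ.
  by rewrite -comp_lfunZr -comp_lfunZl fC.
Qed.

HB.instance Definition _ X Y :=
  GRing.isSubSemiModClosed.Build K _ (@chain_pred X Y) (@chain_pred_closed X Y).

Definition chain X Y : lmodType K := lsub (@chain_pred X Y).

Definition chain_map X Y (f : chain X Y) : forall i, 'Hom(X i, Y i) :=
  lsub_val f.

Lemma chain_rhom X Y (f : chain X Y) i : is_rhom (chain_map f i).
Proof. by have /asboolP[] := lsub_valP f. Qed.

Lemma chain_comm X Y (f : chain X Y) i :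
  (cdiff Y i \o chain_map f i = chain_map f (i + 1) \o cdiff X i)%VF.
Proof. by have /asboolP[] := lsub_valP f. Qed.

Lemma chainP X Y (f g : chain X Y) :
  (forall i, chain_map f i = chain_map g i) -> f = g.
Proof.
by move=> fg; apply: val_inj; apply: functional_extensionality_dep.
Qed.

Definition mk_chain X Y (f : forall i, 'Hom(X i, Y i)) (fP : is_chain f) :
  chain X Y := LSub (asboolT fP : (f : dprod _) \in @chain_pred X Y).

Definition null_pred X Y : {pred chain X Y} :=
  fun f => `[< is_null (lsub_val f) >].

Lemma null_pred_closed X Y : subsemimod_closed (@null_pred X Y).
Proof.
split; first split.
- apply/asboolP; exists (fun=> 0); split=> i; first exact: rhom0.
  by rewrite comp_lfun0r comp_lfun0l addr0.
- move=> f g /asboolP[s [sP sE]] /asboolP[t [tP tE]]; apply/asboolP.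
  exists (fun i => s i + t i); split=> i; first exact: rhomD.
  rewrite comp_lfunDr comp_lfunDl addrACA -sE -tE.
  by [].
- move=> a f /asboolP[s [sP sE]]; apply/asboolP.
  exists (fun i => a *: s i); split=> i; first exact: rhomZ.
  by rewrite -comp_lfunZr -comp_lfunZl -scalerDr -sE.
Qed.

HB.instance Definition _ X Y :=
  GRing.isSubSemiModClosed.Build K _ (@null_pred X Y) (@null_pred_closed X Y).

Lemma chain_id_subproof X :
  is_chain (fun i => \1%VF : 'Hom(X i, X i)).
Proof.
by split=> i; [apply: rhom_id | rewrite comp_lfun1r comp_lfun1l].
Qed.

Definition chain_id X : chain X X := mk_chain (chain_id_subproof X).

Lemma chain_comp_subproof X Y Z (g : chain Y Z) (f : chain X Y) :
  is_chain (fun i => (chain_map g i \o chain_map f i)%VF).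
Proof.
split=> i; first by apply: rhom_comp; apply: chain_rhom.
by rewrite comp_lfunA chain_comm -comp_lfunA chain_comm comp_lfunA.
Qed.

Definition chain_comp X Y Z (g : chain Y Z) (f : chain X Y) : chain X Z :=
  mk_chain (chain_comp_subproof g f).

Lemma chain_linearl X Y Z (f : chain X Y) :
  linear (fun g : chain Y Z => chain_comp g f).
Proof.
by move=> a g h; apply: chainP => i; apply: etrans (comp_lfunDl _ _ _) _;
  congr (_ + _); exact: (esym (comp_lfunZl _ _ _)).
Qed.

Lemma chain_linearr X Y Z (g : chain Y Z) :
  linear (fun f : chain X Y => chain_comp g f).
Proof.
by move=> a f h; apply: chainP => i; apply: etrans (comp_lfunDr _ _ _) _;
  congr (_ + _); exact: (esym (comp_lfunZr _ _ _)).
Qed.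

Lemma chain_compBl X Y Z (g h : chain Y Z) (f : chain X Y) :
  chain_comp (g - h) f = chain_comp g f - chain_comp h f.
Proof.
by have := chain_linearl f (-1) h g; rewrite /= !scaleN1r ![- _ + _]addrC.
Qed.

Lemma chain_compBr X Y Z (g : chain Y Z) (f h : chain X Y) :
  chain_comp g (f - h) = chain_comp g f - chain_comp g h.
Proof.
by have := chain_linearr g (-1) h f; rewrite /= !scaleN1r ![- _ + _]addrC.
Qed.

Lemma null_compl X Y Z (g : chain Y Z) (f : chain X Y) :
  g \in @null_pred Y Z -> chain_comp g f \in @null_pred X Z.
Proof.
move=> /asboolP[s [sP sE]]; apply/asboolP.
exists (fun i => s i \o chain_map f (i + 1))%VF; split=> i.
  by apply: rhom_comp => //; apply: chain_rhom.
apply: etrans (_ : (chain_map g (i + 1) \o chain_map f (i + 1))%VF = _) => //.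
by rewrite [chain_map g _]sE comp_lfunDl -!comp_lfunA chain_comm.
Qed.

Lemma null_compr X Y Z (g : chain Y Z) (f : chain X Y) :
  f \in @null_pred X Y -> chain_comp g f \in @null_pred X Z.
Proof.
move=> /asboolP[s [sP sE]]; apply/asboolP.
exists (fun i => chain_map g i \o s i)%VF; split=> i.
  by apply: rhom_comp => //; apply: chain_rhom.
apply: etrans (_ : (chain_map g (i + 1) \o chain_map f (i + 1))%VF = _) => //.
by rewrite [chain_map f _]sE comp_lfunDr !comp_lfunA chain_comm.
Qed.

Definition per_hom X Y : lmodType K := lquot (@null_pred X Y).

Definition per_class X Y (f : chain X Y) : per_hom X Y := lclass _ f.

Definition per_idm X : per_hom X X := per_class (chain_id X).

Definition per_comp X Y Z (g : per_hom Y Z) (f : per_hom X Y) : per_hom X Z :=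
  per_class (chain_comp (lrepr g) (lrepr f)).

Lemma per_compE X Y Z (g : chain Y Z) (f : chain X Y) :
  per_comp (per_class g) (per_class f) = per_class (chain_comp g f).
Proof.
set g' := lrepr (per_class g); set f' := lrepr (per_class f).
apply/lclass_eq; rewrite -/g' -/f'.
have -> : chain_comp g' f' - chain_comp g f
  = chain_comp (g' - g) f' + chain_comp g (f' - f).
  by rewrite chain_compBl chain_compBr addrA subrK.
apply: rpredD; first by apply: null_compl; apply: lreprP.
by apply: null_compr; apply: lreprP.
Qed.

Lemma per_classP X Y (f : per_hom X Y) : exists f' : chain X Y, f = per_class f'.
Proof. by exists (lrepr f); rewrite /per_class lreprK. Qed.

Lemma per_linearl X Y Z (f : per_hom X Y) :
  linear (fun g : per_hom Y Z => per_comp g f).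
Proof.
move=> a g h; have [f' ->] := per_classP f; have [g' ->] := per_classP g.
have [h' ->] := per_classP h.
rewrite -[_ + _]lclass_linear !per_compE chain_linearl; exact: lclass_linear.
Qed.

Lemma per_linearr X Y Z (g : per_hom Y Z) :
  linear (fun f : per_hom X Y => per_comp g f).
Proof.
move=> a f h; have [f' ->] := per_classP f; have [g' ->] := per_classP g.
have [h' ->] := per_classP h.
rewrite -[_ + _]lclass_linear !per_compE chain_linearr; exact: lclass_linear.
Qed.

Lemma per_compA X Y Z W (h : per_hom Z W) (g : per_hom Y Z) (f : per_hom X Y) :
  per_comp h (per_comp g f) = per_comp (per_comp h g) f.
Proof.
have [f' ->] := per_classP f; have [g' ->] := per_classP g.
have [h' ->] := per_classP h; rewrite !per_compE; congr per_class.
by apply: chainP => i; apply: comp_lfunA.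
Qed.

Lemma per_comp1m X Y (f : per_hom X Y) : per_comp (per_idm Y) f = f.
Proof.
have [f' ->] := per_classP f; rewrite per_compE; congr per_class.
by apply: chainP => i; apply: comp_lfun1l.
Qed.

Lemma per_compm1 X Y (f : per_hom X Y) : per_comp f (per_idm X) = f.
Proof.
have [f' ->] := per_classP f; rewrite per_compE; congr per_class.
by apply: chainP => i; apply: comp_lfun1r.
Qed.

End Complexes.

Arguments chain_rhom {K A X Y} f i : rename.
Arguments chain_comm {K A X Y} f i : rename.

(* The perfect derived category in its standard model K^b(proj A): chain maps
   modulo homotopy between bounded complexes of finitely generated projectives *)
Definition per (K : fieldType) (A : falgType K) : lincat K :=
  LinCat (@per_linearl K A) (@per_linearr K A) (@per_compA K A)
    (@per_comp1m K A) (@per_compm1 K A).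

(* A functor on complexes that preserves null-homotopic maps induces one on
   homotopy categories *)
Section PerFunctor.
Variables (K : fieldType) (A B : falgType K) (F : cpx A -> cpx B).
Variable Fc : forall X Y, chain X Y -> chain (F X) (F Y).
Hypothesis Fc_linear : forall X Y, linear (@Fc X Y).
Hypothesis Fc_id : forall X, Fc (chain_id X) = chain_id (F X).
Hypothesis Fc_comp : forall X Y Z (g : chain Y Z) (f : chain X Y),
  Fc (chain_comp g f) = chain_comp (Fc g) (Fc f).
Hypothesis Fc_null : forall X Y (f : chain X Y),
  f \in @null_pred K A X Y -> Fc f \in @null_pred K B (F X) (F Y).

Definition per_fmap (X Y : per A) (f : hom (per A) X Y) :
  hom (per B) (F X) (F Y) := per_class (Fc (lrepr f)).

Lemma per_fmapE X Y (f : chain X Y) : per_fmap (per_class f) = per_class (Fc f).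
Proof.
apply/lclass_eq; set f' := lrepr _.
have -> : Fc f' - Fc f = Fc (f' - f).
  by have := Fc_linear (-1) f f'; rewrite !scaleN1r ![- _ + _]addrC.
by apply: Fc_null; apply: lreprP.
Qed.

Lemma per_fmap_linear X Y : linear (@per_fmap X Y).
Proof.
move=> a f g; have [f' ->] := per_classP f; have [g' ->] := per_classP g.
by rewrite -[_ + _]lclass_linear !per_fmapE Fc_linear; apply: lclass_linear.
Qed.

Lemma per_fmap_id X : per_fmap (idm X) = idm (F X : per B).
Proof. by rewrite [LHS]per_fmapE Fc_id. Qed.

Lemma per_fmap_comp X Y Z (g : hom (per A) Y Z) (f : hom (per A) X Y) :
  per_fmap (g \oc f) = per_fmap g \oc per_fmap f.
Proof.
have [f' ->] := per_classP f; have [g' ->] := per_classP g.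
by rewrite [_ \oc _]per_compE !per_fmapE [RHS]per_compE Fc_comp.
Qed.

Definition per_functor : linfunctor (per A) (per B) :=
  LinFunctor (C := per A) (D := per B) per_fmap_linear per_fmap_id
    per_fmap_comp.

End PerFunctor.

Section PerTriangles.
Variables (K : fieldType) (A : falgType K).
Implicit Types X Y Z : cpx A.

Lemma shift_bound_subproof X : exists n : nat, forall i : int,
  (n < `|i|)%N -> forall x : X (i + 1), x = 0.
Proof.
by have [n nP] := cbound X; exists n.+1 => i ni; apply: nP; lia.
Qed.

Lemma shift_rhom_subproof X i : is_rhom (- cdiff X (i + 1)).
Proof. by apply: rhomN; apply: cdiff_rhom. Qed.

Arguments shift_rhom_subproof X i : clear implicits.

Lemma shift_diff2_subproof X i :
  (- cdiff X (i + 1 + 1) \o - cdiff X (i + 1))%VF = 0.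
Proof. by rewrite comp_lfunNl comp_lfunNr opprK cdiff2. Qed.

Definition shift_cpx X : cpx A :=
  @Cpx K A (fun i => X (i + 1)) (fun i => - cdiff X (i + 1))
    (shift_rhom_subproof X) (shift_diff2_subproof X)
    (fun i => cproj X (i + 1)) (shift_bound_subproof X).

Lemma shift_chain_subproof X Y (f : chain X Y) :
  @is_chain K A (shift_cpx X) (shift_cpx Y) (fun i => chain_map f (i + 1)).
Proof.
split=> i; first exact: (chain_rhom f (i + 1)).
by rewrite /= comp_lfunNl comp_lfunNr chain_comm.
Qed.

Definition shift_chain X Y (f : chain X Y) :
  chain (shift_cpx X) (shift_cpx Y) := mk_chain (shift_chain_subproof f).

Lemma shift_chain_linear X Y : linear (@shift_chain X Y).
Proof. by move=> a f g; apply: chainP. Qed.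

Lemma shift_chain_id X : shift_chain (chain_id X) = chain_id (shift_cpx X).
Proof. exact: chainP. Qed.

Lemma shift_chain_comp X Y Z (g : chain Y Z) (f : chain X Y) :
  shift_chain (chain_comp g f) = chain_comp (shift_chain g) (shift_chain f).
Proof. exact: chainP. Qed.

Lemma shift_chain_null X Y (f : chain X Y) :
  f \in @null_pred K A X Y ->
  shift_chain f \in @null_pred K A (shift_cpx X) (shift_cpx Y).
Proof.
move=> /asboolP[s [sP sE]]; apply/asboolP.
exists (fun i => - s (i + 1)); split=> i.
  by apply: rhomN; apply: (sP (i + 1)).
by rewrite /= !(comp_lfunNl, comp_lfunNr) !opprK; apply: sE.
Qed.

Definition per_shift : linfunctor (per A) (per A) :=
  per_functor shift_chain_linear shift_chain_id shift_chain_comp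
    shift_chain_null.

Lemma per_shiftE X Y (f : chain X Y) :
  fmap per_shift (per_class f : hom (per A) X Y) = per_class (shift_chain f).
Proof. exact: per_fmapE shift_chain_linear shift_chain_null _ _ f. Qed.

Section Cone.
Variables (X Y : cpx A) (u : chain X Y).

Definition cone_ob i : rmod A := dsum (X (i + 1)) (Y i).

(* (x, y) |-> (- d x, u x + d y) *)
Definition cone_diff i : 'Hom(cone_ob i, cone_ob (i + 1)) :=
  ((dsum_inl (X (i + 1 + 1)) (Y (i + 1))
     \o (- cdiff X (i + 1) \o dsum_fst (X (i + 1)) (Y i)))
   + (dsum_inr (X (i + 1 + 1)) (Y (i + 1))
     \o ((chain_map u (i + 1) \o dsum_fst (X (i + 1)) (Y i))
         + (cdiff Y i \o dsum_snd (X (i + 1)) (Y i)))))%VF.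

Lemma cone_diffE i v :
  cone_diff i v
    = (- cdiff X (i + 1) v.1, chain_map u (i + 1) v.1 + cdiff Y i v.2).
Proof.
rewrite !(add_lfunE, comp_lfunE, opp_lfunE) dsum_inlE dsum_inrE dsum_fstE.
by rewrite dsum_sndE; congr (_, _); rewrite /= ?addr0 ?add0r.
Qed.

Lemma cone_diff_rhom i : is_rhom (cone_diff i).
Proof.
apply: rhomD; apply: rhom_comp.
- exact: dsum_inl_rhom.
- by apply: rhom_comp (@dsum_fst_rhom _ _ _ _); apply: shift_rhom_subproof.
- exact: dsum_inr_rhom.
apply: rhomD; apply: rhom_comp.
- exact: chain_rhom.
- exact: dsum_fst_rhom.
- exact: cdiff_rhom.
exact: dsum_snd_rhom.
Qed.

Lemma cone_diff2 i : (cone_diff (i + 1) \o cone_diff i)%VF = 0.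
Proof.
apply/lfunP => v; rewrite comp_lfunE zero_lfunE !cone_diffE /=.
have dX w : cdiff X (i + 1 + 1) (cdiff X (i + 1) w) = 0.
  by rewrite -comp_lfunE cdiff2 zero_lfunE.
have dY w : cdiff Y (i + 1) (cdiff Y i w) = 0.
  by rewrite -comp_lfunE cdiff2 zero_lfunE.
have uC w : cdiff Y (i + 1) (chain_map u (i + 1) w)
    = chain_map u (i + 1 + 1) (cdiff X (i + 1) w).
  by rewrite -comp_lfunE chain_comm comp_lfunE.
congr (_, _); first by rewrite linearN /= dX !oppr0.
by rewrite linearN linearD /= uC dY addr0 addNr.
Qed.

Lemma cone_projective i : projective (cone_ob i).
Proof. by apply: dsum_projective; apply: cproj. Qed.

Lemma cone_bound : exists n : nat, forall i : int,
  (n < `|i|)%N -> forall v : cone_ob i, v = 0.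
Proof.
have [n nP] := cbound X; have [m mP] := cbound Y.
exists (n + m).+1 => i ni [x y]; congr (_, _); [apply: nP | apply: mP]; lia.
Qed.

Definition cone : cpx A :=
  @Cpx K A cone_ob cone_diff cone_diff_rhom cone_diff2 cone_projective cone_bound.

Lemma cone_in_subproof :
  @is_chain K A Y cone (fun i => dsum_inr (X (i + 1)) (Y i)).
Proof.
split=> i; first exact: dsum_inr_rhom.
apply/lfunP => v; rewrite !comp_lfunE /= cone_diffE !dsum_inrE /=.
by congr (_, _); rewrite linear0 ?oppr0 ?add0r.
Qed.

Definition cone_in : chain Y cone := mk_chain cone_in_subproof.

Lemma cone_out_subproof :
  @is_chain K A cone (shift_cpx X) (fun i => dsum_fst (X (i + 1)) (Y i)).
Proof.
split=> i; first exact: dsum_fst_rhom.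
by apply/lfunP => v; rewrite !comp_lfunE /= cone_diffE !dsum_fstE opp_lfunE.
Qed.

Definition cone_out : chain cone (shift_cpx X) := mk_chain cone_out_subproof.

End Cone.

(* The triangles isomorphic to X' --u--> Y' --> cone u --> shift X' *)
Definition per_distinguished (X Y Z : per A) (f : hom (per A) X Y)
    (g : hom (per A) Y Z) (h : hom (per A) Z (per_shift X)) : Prop :=
  exists (X' Y' : cpx A) (u : chain X' Y')
         (a : hom (per A) X X') (b : hom (per A) Y Y')
         (c : hom (per A) Z (cone u)),
    [/\ [/\ is_iso a, is_iso b & is_iso c],
        b \oc f = (per_class u : hom (per A) X' Y') \oc a,
        c \oc g = (per_class (cone_in u) : hom (per A) Y' (cone u)) \oc b &
        fmap per_shift a \oc h
          = (per_class (cone_out u) : hom (per A) (cone u) (per_shift X'))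
              \oc c].

Definition per_tri : tri_data (per A) := TriData per_distinguished.

End PerTriangles.

Section Twist.
Variables (K : fieldType) (gT : finGroupType) (A : falgType K).
Variable S : alg_action gT A.

Section TwistAction.
Variables (g : gT) (V : vectType K) (r : raction A V).

Definition twist_fun (v : V) (a : A) : V := r v (S g^-1%g a).

Lemma twist_linearl a : linear (twist_fun^~ a).
Proof. by move=> c v w; apply: ract_linearl. Qed.
Lemma twist_linearr v : linear (twist_fun v).
Proof. by move=> c a b; rewrite /twist_fun linearP ract_linearr. Qed.
Lemma twist1 v : twist_fun v 1 = v.
Proof. by rewrite /twist_fun rmorph1 ract1. Qed.
Lemma twistM v a b : twist_fun v (a * b) = twist_fun (twist_fun v a) b.
Proof. by rewrite /twist_fun rmorphM ractM. Qed.

Definition twist_ract : raction A V :=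
  RAction twist_linearl twist_linearr twist1 twistM.

End TwistAction.

Lemma raction_eq (V : vectType K) (r r' : raction A V) :
  (forall v a, r v a = r' v a) -> r = r'.
Proof.
case: r r' => [f f1 f2 f3 f4] [f' g1 g2 g3 g4] /= ff'.
have e : f = f'.
  by apply: functional_extensionality_dep => v;
     apply: functional_extensionality_dep => a.
by case: f' / e g1 g2 g3 g4 {ff'} => g1 g2 g3 g4; congr RAction;
  apply: Prop_irrelevance.
Qed.

Lemma twist_ract1 (V : vectType K) (r : raction A V) : twist_ract 1%g r = r.
Proof. by apply: raction_eq => v a; rewrite /= /twist_fun invg1 aact1. Qed.

Lemma twist_ractM g h (V : vectType K) (r : raction A V) :
  twist_ract (g * h)%g r = twist_ract g (twist_ract h r).
Proof. by apply: raction_eq => v a; rewrite /= /twist_fun invMg aactM. Qed.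

(* g M is M with m . a := m (g^-1 a) *)
Definition twist_mod g (M : rmod A) : rmod A :=
  RMod (twist_ract g (rmod_act M)).

Lemma twist_rhom g (M N : rmod A) (f : 'Hom(M, N)) :
  is_rhom f -> @is_rhom K A (twist_mod g M) (twist_mod g N) f.
Proof. by move=> fP v a; apply: fP. Qed.

Lemma untwist_rhom g (M N : rmod A) (f : 'Hom(M, N)) :
  @is_rhom K A (twist_mod g M) N f -> @is_rhom K A M (twist_mod g^-1%g N) f.
Proof.
move=> fP v a; rewrite /= /twist_fun invgK -fP /= /twist_fun.
by rewrite -aactM mulVg aact1.
Qed.

Lemma twist_projective g P : projective P -> projective (twist_mod g P).
Proof.
move=> projP M N p f pP fP pS.
have [h hP hE] := projP (twist_mod g^-1%g M) (twist_mod g^-1%g N) p f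
  (@twist_rhom g^-1%g M N p pP) (untwist_rhom fP) pS.
exists h => // v a; rewrite [LHS]hP /= /twist_fun invgK.
by rewrite -aactM mulgV aact1.
Qed.

Definition twist_cpx g (X : cpx A) : cpx A :=
  @Cpx K A (fun i => twist_mod g (X i)) (cdiff X)
    (fun i => @twist_rhom g _ _ _ (cdiff_rhom X i)) (cdiff2 X)
    (fun i => @twist_projective g _ (cproj X i)) (cbound X).

Lemma twist_chain_subproof g (X Y : cpx A) (f : chain X Y) :
  @is_chain K A (twist_cpx g X) (twist_cpx g Y) (chain_map f).
Proof.
by split=> i; [apply: twist_rhom (chain_rhom f i) | apply: (chain_comm f i)].
Qed.

Definition twist_chain g (X Y : cpx A) (f : chain X Y) :
  chain (twist_cpx g X) (twist_cpx g Y) := mk_chain (twist_chain_subproof g f).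

Lemma twist_chain_linear g (X Y : cpx A) : linear (@twist_chain g X Y).
Proof. by move=> a f h; apply: chainP. Qed.

Lemma twist_chain_id g (X : cpx A) :
  twist_chain g (chain_id X) = chain_id (twist_cpx g X).
Proof. exact: chainP. Qed.

Lemma twist_chain_comp g (X Y Z : cpx A) (h : chain Y Z) (f : chain X Y) :
  twist_chain g (chain_comp h f)
    = chain_comp (twist_chain g h) (twist_chain g f).
Proof. exact: chainP. Qed.

Lemma twist_chain_null g (X Y : cpx A) (f : chain X Y) :
  f \in @null_pred K A X Y ->
  twist_chain g f \in @null_pred K A (twist_cpx g X) (twist_cpx g Y).
Proof.
move=> /asboolP[s [sP sE]]; apply/asboolP; exists s; split=> i; last exact: sE.
by apply: twist_rhom.
Qed.

Definition twist g : linfunctor (per A) (per A) :=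
  per_functor (@twist_chain_linear g) (@twist_chain_id g)
    (@twist_chain_comp g) (@twist_chain_null g).

Lemma twistE g (X Y : cpx A) (f : chain X Y) :
  fmap (twist g) (per_class f : hom (per A) X Y) = per_class (twist_chain g f).
Proof. exact: per_fmapE (@twist_chain_linear g) (@twist_chain_null g) _ _ f. Qed.

Lemma cpx_case (P : cpx A -> Prop) :
  (forall (V : int -> vectType K) (r : forall i, raction A (V i)) d p1 p2 p3 p4,
     P (@Cpx K A (fun i => RMod (r i)) d p1 p2 p3 p4)) ->
  forall X, P X.
Proof.
move=> IH [ob d p1 p2 p3 p4].
have E : ob = fun i => RMod (rmod_act (ob i)).
  by apply: functional_extensionality_dep => i; case: (ob i).
pose V i := rmod_car (ob i); pose r i : raction A (V i) := rmod_act (ob i).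
rewrite -/(r _) in E.
have {}E : ob = fun i => RMod (r i) by exact: E.
clearbody r; clearbody V; subst ob; exact: IH.
Qed.

(* Equal complexes on the same underlying graded space *)
Lemma cpx_eq (V : int -> vectType K) (r r' : forall i, raction A (V i))
    (d : forall i, 'Hom(V i, V (i + 1))) p1 p2 p3 p4 p1' p2' p3' p4' :
  (forall i, r i = r' i) ->
  @Cpx K A (fun i => RMod (r i)) d p1 p2 p3 p4
    = @Cpx K A (fun i => RMod (r' i)) d p1' p2' p3' p4'.
Proof.
move=> rr'; have {rr'}e : r = r' by apply: functional_extensionality_dep.
case: r' / e p1' p2' p3' p4' => p1' p2' p3' p4'.
by congr Cpx; apply: Prop_irrelevance.
Qed.

Lemma eq_hom_cpx (V : int -> vectType K) (r r' : forall i, raction A (V i))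
    (d : forall i, 'Hom(V i, V (i + 1))) p1 p2 p3 p4 p1' p2' p3' p4'
    (X := @Cpx K A (fun i => RMod (r i)) d p1 p2 p3 p4 : per A)
    (Y := @Cpx K A (fun i => RMod (r' i)) d p1' p2' p3' p4' : per A)
    (e : X = Y) :
  (forall i, r i = r' i) ->
  exists2 f : chain X Y, eq_hom e = per_class f &
    forall i, chain_map f i = \1%VF :> 'Hom(V i, V i).
Proof.
move=> rr'; have {rr'}E : r = r' by apply: functional_extensionality_dep.
case: r' / E p1' p2' p3' p4' @Y e => p1' p2' p3' p4' Y e.
have e1 := Prop_irrelevance p1 p1'; have e2 := Prop_irrelevance p2 p2'.
have e3 := Prop_irrelevance p3 p3'; have e4 := Prop_irrelevance p4 p4'.
subst p1' p2' p3' p4'.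
by exists (chain_id X) => //; apply: eq_hom_id.
Qed.

Lemma twist_ob1 (X : per A) : twist 1%g X = X.
Proof.
move: X; apply: cpx_case => V r d p1 p2 p3 p4.
by apply: cpx_eq => i; apply: twist_ract1.
Qed.

Lemma twist_obM g h (X : per A) : twist (g * h)%g X = twist g (twist h X).
Proof. by apply: cpx_eq => i; apply: twist_ractM. Qed.

Lemma twist_hom1 (X Y : per A) (f : hom (per A) X Y) :
  eq_hom (twist_ob1 Y) \oc fmap (twist 1%g) f = f \oc eq_hom (twist_ob1 X).
Proof.
move: X Y f (twist_ob1 X) (twist_ob1 Y).
apply: cpx_case => V r d p1 p2 p3 p4; apply: cpx_case => W s c q1 q2 q3 q4.
move=> f eX eY; have [f' ->] := per_classP f.
have [i ei iE] := eq_hom_cpx eX (fun i => twist_ract1 (r i)).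
have [j ej jE] := eq_hom_cpx eY (fun i => twist_ract1 (s i)).
rewrite [eq_hom eX]ei [eq_hom eY]ej [fmap _ _]twistE.
rewrite [LHS]per_compE [RHS]per_compE; congr per_class; apply: chainP => n.
change (chain_map j n \o chain_map f' n = chain_map f' n \o chain_map i n)%VF.
by rewrite [chain_map j n]jE [chain_map i n]iE comp_lfun1l comp_lfun1r.
Qed.

Lemma twist_homM g h (X Y : per A) (f : hom (per A) X Y) :
  eq_hom (twist_obM g h Y) \oc fmap (twist (g * h)%g) f
    = fmap (twist g) (fmap (twist h) f) \oc eq_hom (twist_obM g h X).
Proof.
have [f' ->] := per_classP f.
have [i ei iE] := eq_hom_cpx (twist_obM g h X)
  (fun i => twist_ractM g h (rmod_act (X i))).
have [j ej jE] := eq_hom_cpx (twist_obM g h Y)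
  (fun i => twist_ractM g h (rmod_act (Y i))).
rewrite [eq_hom _ in LHS]ej [eq_hom _ in RHS]ei.
rewrite !twistE.
rewrite [LHS]per_compE [RHS]per_compE; congr per_class; apply: chainP => n.
change (chain_map j n \o chain_map f' n = chain_map f' n \o chain_map i n)%VF.
by rewrite [chain_map j n]jE [chain_map i n]iE comp_lfun1l comp_lfun1r.
Qed.

Definition per_action : strict_action gT (per A) :=
  StrictAction twist_hom1 twist_homM.

End Twist.

Definition canonical_functor (K : fieldType) (gT : finGroupType)
    (C : lincat K) (S : strict_action gT C) :
    linfunctor C (split_closure (skew_cat S)) :=
  comp_functor (to_split (skew_cat S)) (to_skew S).

(* Main.v *)
Require Import Defs.
From HB Require Import structures.
From mathcomp Require Import all_boot all_order all_fingroup all_algebra.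
From mathcomp Require Import all_field.
From mathcomp Require Import boolp zify.
(* From here on, hom is the space of morphisms of a category, not that of
   linear maps between vector spaces. *)
Import Defs.

Set Implicit Arguments.
Unset Strict Implicit.
Unset Printing Implicit Defensive.

Import GRing.Theory.
Local Open Scope ring_scope.

(** Write L for Lambda and B for the skew-group algebra of L and G. In the model
    by bounded complexes of projectives, the equivalence is given by induction,
    that is, by the tensor product with B over L.

    Since B is free over L on the elements 1 (x) g, a B-linear map from ind M to
    ind N is determined by its restriction to M (x) 1, and this restriction is a
    family of L-linear maps gM -> N indexed by g in G. So Hom(ind M, ind N) is
    the sum over g of Hom(gM, N), which is how morphisms in a skew-group category
    are defined. The identification is compatible with differentials and with
    homotopies, hence induction is a full and faithful functor from the
    skew-group category of per L to per B ([skew_ind_faithful],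
    [skew_ind_full]).

    It extends to an equivalence from the split-closure ([split_extension]) for
    two reasons. First, per B has split idempotents
    ([per_idempotents_split]): if f represents an idempotent class, then a high
    power of f represents it too and, by the Fitting lemma, splits strictly.
    Second, every complex Y over B is a direct summand of the complex induced
    from its restriction to L ([skew_ind_retract]): as |G| is invertible, the
    map from ind (res Y) to Y has a section, obtained by averaging over G.

    Verdier's axioms hold in per B by explicit contractions of mapping cones
    ([per_triangulated]), and the triangulated structure of the split-closure
    is transported from per B along the equivalence F
    ([transport_triangulated]), so that F is exact by construction. The
    canonical functor followed by F is isomorphic to induction from per L to
    per B, which preserves shifts and mapping cones ([ind_exact]); since F
    detects triangles, the canonical functor is exact
    ([transport_exact_lift]). *)

(** * Linear categories, isomorphisms and equivalences *)

Section Isomorphisms.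
Variables (K : fieldType) (C : lincat K).
Implicit Types X Y Z : C.

(** The inverse of an isomorphism as a total function, with junk value 0, so
    that inverses can appear in formulas and be rewritten away. *)
Definition inv_hom X Y (f : hom C X Y) : hom C Y X :=
  if pselect (is_iso f) is left p then sval (cid p) else 0.

Lemma inv_homl X Y (f : hom C X Y) : is_iso f -> inv_hom f \oc f = idm X.
Proof. by rewrite /inv_hom; case: pselect => // p _; case: cid => g []. Qed.

Lemma inv_homr X Y (f : hom C X Y) : is_iso f -> f \oc inv_hom f = idm Y.
Proof. by rewrite /inv_hom; case: pselect => // p _; case: cid => g []. Qed.

Lemma inv_homK X Y Z (f : hom C X Y) (g : hom C Z X) :
  is_iso f -> inv_hom f \oc (f \oc g) = g.
Proof. by move=> fP; rewrite compA inv_homl // comp1m. Qed.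

Lemma inv_homVK X Y Z (f : hom C X Y) (g : hom C Z Y) :
  is_iso f -> f \oc (inv_hom f \oc g) = g.
Proof. by move=> fP; rewrite compA inv_homr // comp1m. Qed.

Lemma is_iso_id X : is_iso (idm X).
Proof. by exists (idm X); rewrite comp1m. Qed.

Lemma is_iso_comp X Y Z (g : hom C Y Z) (f : hom C X Y) :
  is_iso g -> is_iso f -> is_iso (g \oc f).
Proof.
move=> [g' [g1 g2]] [f' [f1 f2]]; exists (f' \oc g'); split.
  by rewrite -compA (compA g') g1 comp1m.
by rewrite -compA (compA f) f2 comp1m.
Qed.

Lemma is_iso_inv X Y (f : hom C X Y) : is_iso f -> is_iso (inv_hom f).
Proof. by move=> fP; exists f; rewrite inv_homl // inv_homr. Qed.

Lemma iso_injl X Y Z (f : hom C Y Z) (g h : hom C X Y) :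
  is_iso f -> f \oc g = f \oc h -> g = h.
Proof. by move=> fP e; rewrite -(inv_homK g fP) e inv_homK. Qed.

Lemma iso_injr X Y Z (f : hom C X Y) (g h : hom C Y Z) :
  is_iso f -> g \oc f = h \oc f -> g = h.
Proof.
by move=> fP e; rewrite -[g]compm1 -(inv_homr fP) compA e -compA inv_homr // compm1.
Qed.

Lemma compNl X Y Z (g : hom C Y Z) (f : hom C X Y) : (- g) \oc f = - (g \oc f).
Proof. by rewrite -scaleN1r compZl scaleN1r. Qed.

Lemma compNr X Y Z (g : hom C Y Z) (f : hom C X Y) : g \oc (- f) = - (g \oc f).
Proof. by rewrite -scaleN1r compZr scaleN1r. Qed.

Lemma is_iso_zero X Y : idm X = 0 -> idm Y = 0 -> is_iso (0 : hom C X Y).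
Proof. by move=> x0 y0; exists 0; rewrite !compm0 x0 y0. Qed.

Lemma hom_to_zero X Y (f : hom C X Y) : idm Y = 0 -> f = 0.
Proof. by move=> y0; rewrite -[f]comp1m y0 comp0m. Qed.

End Isomorphisms.

Section Functors.
Variables (K : fieldType) (C D : lincat K) (F : linfunctor C D).

Lemma fmapD X Y (f g : hom C X Y) : fmap F (f + g) = fmap F f + fmap F g.
Proof. by have := fmap_linear F 1 f g; rewrite !scale1r. Qed.

Lemma fmapN X Y (f : hom C X Y) : fmap F (- f) = - fmap F f.
Proof.
by have := fmap_linear F (-1) f 0; rewrite fmap0 !addr0 !scaleN1r.
Qed.

Lemma is_iso_fmap X Y (f : hom C X Y) : is_iso f -> is_iso (fmap F f).
Proof.
by move=> [g [g1 g2]]; exists (fmap F g); rewrite -!fmap_comp g1 g2 !fmap_id.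
Qed.

Definition faithful : Prop := forall X Y, injective (@fmap _ _ _ F X Y).

Definition full : Prop :=
  forall X Y (g : hom D (F X) (F Y)), exists f, fmap F f = g.

Definition ess_surj : Prop :=
  forall Y : D, exists X (i : hom D (F X) Y), is_iso i.

Definition fmap_pre X Y (g : hom D (F X) (F Y)) : hom C X Y :=
  if pselect (exists f, fmap F f = g) is left p then sval (cid p) else 0.

Lemma fmap_preK X Y (g : hom D (F X) (F Y)) :
  full -> fmap F (fmap_pre g) = g.
Proof. by rewrite /fmap_pre => /(_ X Y g); case: pselect => // p _; case: cid. Qed.

Lemma is_iso_reflect X Y (f : hom C X Y) :
  faithful -> full -> is_iso (fmap F f) -> is_iso f.
Proof.
move=> faF fuF [g [g1 g2]]; exists (fmap_pre g).
by split; apply: faF; rewrite fmap_comp fmap_id fmap_preK.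
Qed.

(** Let G be a quasi-inverse. A morphism g between images is the image of the
    conjugate of G g by the unit: the two agree after applying G, which is
    faithful by naturality of the counit. *)
Lemma equivalence_ff : is_equivalence F -> [/\ faithful, full & ess_surj].
Proof.
move=> [G [eta [eps [etaP etaN epsP epsN]]]].
have faF : faithful.
  by move=> X Y f g e; apply: (iso_injl (etaP Y)); rewrite !etaN e.
split=> // [X Y g|Y]; last by exists (G Y), (eps Y).
exists (inv_hom (eta Y) \oc fmap G g \oc eta X).
apply: (iso_injr (epsP _)); rewrite -!epsN; congr (_ \oc fmap F _).
apply: (iso_injr (etaP X)); rewrite -etaN -compA inv_homVK //.
Qed.

(** The quasi-inverse is built by choosing, for each object, a preimage up to
    isomorphism, and for each morphism the preimage of its conjugate. *)
Lemma ff_equivalence : faithful -> full -> ess_surj -> is_equivalence F.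
Proof.
move=> faF fuF esF.
pose Gob Y : C := sval (cid (esF Y)).
pose eps Y : hom D (F (Gob Y)) Y := sval (cid (svalP (cid (esF Y)))).
have epsP Y : is_iso (eps Y) by exact: svalP (cid (svalP (cid (esF Y)))).
pose Gmap X Y (f : hom D X Y) : hom C (Gob X) (Gob Y) :=
  fmap_pre (inv_hom (eps Y) \oc (f \oc eps X)).
have GE X Y (f : hom D X Y) : fmap F (Gmap X Y f) = inv_hom (eps Y) \oc (f \oc eps X).
  exact: fmap_preK.
have Glin X Y : linear (Gmap X Y).
  move=> a f g; apply: faF; rewrite fmap_linear !GE.
  by rewrite compDl compZl compDr compZr.
have Gid X : Gmap X X (idm X) = idm (Gob X).
  by apply: faF; rewrite GE comp1m inv_homl // fmap_id.
have Gcomp X Y Z (g : hom D Y Z) (f : hom D X Y) :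
    Gmap X Z (g \oc f) = Gmap Y Z g \oc Gmap X Y f.
  by apply: faF; rewrite fmap_comp !GE -!compA inv_homVK.
pose G := LinFunctor Glin Gid Gcomp.
exists G, (fun X => fmap_pre (inv_hom (eps (F X)))), eps; split=> //.
- move=> X; apply: is_iso_reflect => //; rewrite fmap_preK //; exact: is_iso_inv.
- move=> X Y f; apply: faF; rewrite !fmap_comp !fmap_preK //.
  by rewrite -!compA inv_homr // compm1.
by move=> X Y f; rewrite [fmap F (fmap G _)]GE inv_homVK.
Qed.

End Functors.

Section FunctorComposition.
Variables (K : fieldType) (C D E : lincat K).
Variables (G : linfunctor D E) (F : linfunctor C D).

Lemma equivalence_comp :
  is_equivalence G -> is_equivalence F -> is_equivalence (comp_functor G F).
Proof.
move=> /equivalence_ff[faG fuG esG] /equivalence_ff[faF fuF esF].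
apply: ff_equivalence.
- by move=> X Y f g /faG/faF.
- by move=> X Y h; have [g <-] := fuG _ _ h; have [f <-] := fuF _ _ g; exists f.
move=> Z; have [Y [j jP]] := esG Z; have [X [i iP]] := esF Y.
by exists X, (j \oc fmap G i); apply: is_iso_comp => //; apply: is_iso_fmap.
Qed.

End FunctorComposition.

(** * Extending a functor to the split-closure *)

Section SplitExtension.
Variables (K : fieldType) (C D : lincat K) (P : linfunctor C D).

Definition idempotents_split (B : lincat K) : Prop :=
  forall (X : B) (e : hom B X X), e \oc e = e ->
    exists (Y : B) (i : hom B Y X) (p : hom B X Y), p \oc i = idm Y /\ i \oc p = e.

Definition retract_of_image : Prop :=
  forall Y : D, exists (X : C) (i : hom D Y (P X)) (p : hom D (P X) Y),
    p \oc i = idm Y.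

(** An object (X, e) is sent to a splitting of P e, and f : (X, e) -> (X', e')
    to the composite of P f with the section and the retraction of these
    splittings. Since f = e' f e, this is again full and faithful. If Y is a
    retract of P X, the corresponding idempotent of P X is the image of an
    idempotent e of X, and Y is then isomorphic to the image of (X, e). *)
Lemma split_extension :
  faithful P -> full P -> idempotents_split D -> retract_of_image ->
  exists F : linfunctor (split_closure C) D, is_equivalence F /\
    exists theta : forall X, hom D (F (to_split C X)) (P X),
      (forall X, is_iso (theta X)) /\
      (forall X Y (f : hom C X Y),
        theta Y \oc fmap F (fmap (to_split C) f) = fmap P f \oc theta X).
Proof.
move=> faP fuP spD reP.
have spl (X : split_ob C) : exists t : {Y : D & (hom D Y (P (split_car X))
      * hom D (P (split_car X)) Y)%type},
    (projT2 t).2 \oc (projT2 t).1 = idm _ /\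
    (projT2 t).1 \oc (projT2 t).2 = fmap P (split_idem X).
  have [|Y [i [p ipP]]] := spD _ (fmap P (split_idem X)).
    by rewrite -fmap_comp split_idemP.
  by exists (existT _ Y (i, p)).
pose t X := sval (cid (spl X)).
pose Fo X : D := projT1 (t X).
pose i X : hom D (Fo X) (P (split_car X)) := (projT2 (t X)).1.
pose p X : hom D (P (split_car X)) (Fo X) := (projT2 (t X)).2.
have pi X : p X \oc i X = idm (Fo X).
  exact: (svalP (cid (spl X))).1.
have ip X : i X \oc p X = fmap P (split_idem X).
  exact: (svalP (cid (spl X))).2.
have iip X Y (f : split_hom X Y) : i Y \oc (p Y \oc (fmap P (lsub_val f) \oc i X))
    = fmap P (lsub_val f) \oc i X.
  by rewrite compA ip compA -fmap_comp split_homl.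
pose Fm X Y (f : hom (split_closure C) X Y) : hom D (Fo X) (Fo Y) :=
  p Y \oc (fmap P (lsub_val f) \oc i X).
have Flin X Y : linear (Fm X Y).
  by move=> a f g; rewrite /Fm fmap_linear compDl compZl compDr compZr.
have Fid X : Fm X X (idm (X : split_closure C)) = idm (Fo X).
  by rewrite /Fm /= -ip compA compA pi comp1m pi.
have Fcomp X Y Z (g : hom (split_closure C) Y Z) (f : hom (split_closure C) X Y) :
    Fm X Z (g \oc f) = Fm Y Z g \oc Fm X Y f.
  by rewrite /Fm fmap_comp -!compA iip.
pose F : linfunctor (split_closure C) D := LinFunctor Flin Fid Fcomp.
have FE X Y f : fmap F f = Fm X Y f by [].
exists F; split; last first.
  exists (fun X => i (to_split_ob X)); split=> [X|X Y f].
    exists (p (to_split_ob X)); split; first exact: pi.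
    exact: etrans (ip (to_split_ob X)) (fmap_id P X).
  exact: iip (fmap (to_split C) f).
apply: ff_equivalence.
- have FK X Y (f : split_hom X Y) : fmap P (lsub_val f) = i Y \oc (Fm X Y f \oc p X).
    by rewrite -[in LHS](split_homr f) fmap_comp -ip [RHS]compA iip compA.
  by move=> X Y f g e; apply: val_inj; apply: faP; rewrite !FK -!FE e.
- move=> X Y g.
  have [f fE] := fuP _ _ (i Y \oc (g \oc p X)).
  have fP : f \in @split_pred K C X Y.
    apply/eqP; apply: faP; rewrite !fmap_comp fE -!ip -!compA.
    by rewrite (compA (p X)) pi comp1m (compA (p Y)) pi comp1m.
  exists (LSub fP); rewrite FE /Fm /= fE -!compA pi compm1 compA pi.
  exact: comp1m.
move=> Y; have [X [j [q qj]]] := reP Y.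
have [e eE] := fuP _ _ (j \oc q).
have eP : e \oc e = e.
  by apply: faP; rewrite fmap_comp eE -compA (compA q) qj comp1m.
pose XE := SplitOb eP.
have ipX : i XE \oc p XE = j \oc q by rewrite -eE; apply: (ip XE).
exists XE, (q \oc i XE), (p XE \oc j); split.
  by rewrite -compA (compA j) -ipX -compA pi compm1 pi.
by rewrite -compA (compA (i _)) ipX -compA qj compm1 qj.
Qed.

End SplitExtension.

(** * Triangulated categories: reduction of the axioms *)

Section TriangulatedCriterion.
Variables (K : fieldType) (C : lincat K) (T : tri_data C).

Local Notation dist f g h := (@distinguished K C T _ _ _ f g h).
Local Notation S := (shift T).

Hypothesis shiftE : is_equivalence S.
Hypothesis isoE : forall X Y Z X' Y' Z'
      (f : hom C X Y) (g : hom C Y Z) (h : hom C Z (S X))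
      (f' : hom C X' Y') (g' : hom C Y' Z') (h' : hom C Z' (S X'))
      (a : hom C X X') (b : hom C Y Y') (c : hom C Z Z'),
    is_iso a -> is_iso b -> is_iso c ->
    b \oc f = f' \oc a -> c \oc g = g' \oc b ->
    fmap S a \oc h = h' \oc c ->
    dist f g h -> dist f' g' h'.
Hypothesis zeroE : has_zero C.
Hypothesis idE : forall X Z : C, idm Z = 0 ->
    dist (idm X) (0 : hom C X Z) (0 : hom C Z (S X)).
Hypothesis coneE : forall X Y (f : hom C X Y),
    exists Z (g : hom C Y Z) (h : hom C Z (S X)), dist f g h.
Hypothesis rotE : forall X Y Z
      (f : hom C X Y) (g : hom C Y Z) (h : hom C Z (S X)),
    dist f g h -> dist g h (- fmap S f).
Hypothesis morE : forall X Y Z X' Y' Z'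
      (f : hom C X Y) (g : hom C Y Z) (h : hom C Z (S X))
      (f' : hom C X' Y') (g' : hom C Y' Z') (h' : hom C Z' (S X'))
      (a : hom C X X') (b : hom C Y Y'),
    dist f g h -> dist f' g' h' -> b \oc f = f' \oc a ->
    exists c : hom C Z Z', c \oc g = g' \oc b /\ fmap S a \oc h = h' \oc c.

Lemma dist_comp0 X Y Z (f : hom C X Y) (g : hom C Y Z) (h : hom C Z (S X)) :
  dist f g h -> g \oc f = 0.
Proof.
move=> fgh; have [O O0] := zeroE.
have [c [<- _]] := morE (idE X O0) fgh (erefl : f \oc idm X = f \oc idm X).
exact: compm0.
Qed.

(** The functor Hom(W, -) is exact at the middle term of a triangle: a
    morphism y with g y = 0 gives a morphism from the rotated triangle
    W -> 0 -> Sigma W to the rotated triangle Y -> Z -> Sigma X, whose third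
    component desuspends to the factorization because the shift is an
    equivalence. *)
Lemma dist_exact X Y Z (f : hom C X Y) (g : hom C Y Z) (h : hom C Z (S X))
    W (y : hom C W Y) :
  dist f g h -> g \oc y = 0 -> exists x : hom C W X, y = f \oc x.
Proof.
move=> fgh gy; have [O O0] := zeroE; have [faS fuS _] := equivalence_ff shiftE.
have [|c [_]] := morE (a := y) (b := 0) (rotE (idE W O0)) (rotE fgh).
  by rewrite gy compm0.
rewrite compNr fmap_id compm1 compNl => /oppr_inj yc.
have [x xE] := fuS _ _ c; exists x; apply: faS.
by rewrite fmap_comp xE.
Qed.

(** The five lemma for the exact sequences obtained by applying Hom(W, -),
    carried out on elements for every W. Injectivity and surjectivity of
    composition with c produce its inverse. Only forward rotations of the
    triangles are available, because the backward ones are deduced from this. *)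
Lemma dist_five X Y Z X' Y' Z'
    (f : hom C X Y) (g : hom C Y Z) (h : hom C Z (S X))
    (f' : hom C X' Y') (g' : hom C Y' Z') (h' : hom C Z' (S X'))
    (a : hom C X X') (b : hom C Y Y') (c : hom C Z Z') :
  dist f g h -> dist f' g' h' -> is_iso a -> is_iso b ->
  b \oc f = f' \oc a -> c \oc g = g' \oc b -> fmap S a \oc h = h' \oc c ->
  is_iso c.
Proof.
move=> D D' aP bP fE gE hE.
have SaP : is_iso (fmap S a) by apply: is_iso_fmap.
have inj W (w : hom C W Z) : c \oc w = 0 -> w = 0.
  move=> cw; have hw : h \oc w = 0.
    by apply: (iso_injl SaP); rewrite compA hE -compA cw !compm0.
  have [y yE] := dist_exact (rotE D) hw.
  have gby : g' \oc (b \oc y) = 0 by rewrite compA -gE -compA -yE.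
  have [x xE] := dist_exact D' gby.
  rewrite yE (_ : y = f \oc (inv_hom a \oc x)) ?compA ?(dist_comp0 D) ?comp0m //.
  by apply: (iso_injl bP); rewrite xE !compA fE -(compA f') inv_homr // compm1.
have surj W (w : hom C W Z') : exists z, c \oc z = w.
  (* Lift the image of w in Sigma X' to Z, then correct by an element of Y. *)
  pose x := inv_hom (fmap S a) \oc (h' \oc w).
  have fx : (- fmap S f) \oc x = 0.
    apply: (iso_injl (is_iso_fmap S bP)).
    rewrite compNl compNr compA -fmap_comp fE fmap_comp -compA inv_homVK //.
    have := dist_comp0 (rotE (rotE D')); rewrite compNl => /eqP.
    by rewrite oppr_eq0 compA => /eqP ->; rewrite comp0m oppr0 compm0.
  have [z zE] := dist_exact (rotE (rotE D)) fx.
  have hz : h' \oc (w - c \oc z) = 0.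
    by rewrite compDr compNr compA -hE -compA -zE inv_homVK // subrr.
  have [y yE] := dist_exact (rotE D') hz.
  exists (z + g \oc (inv_hom b \oc y)).
  by rewrite compDr compA gE -compA inv_homVK // -yE addrC subrK.
have [d cd] := surj _ (idm Z'); exists d; split=> //.
apply/eqP; rewrite -subr_eq0; apply/eqP/inj.
by rewrite compDr compNr compA cd comp1m compm1 subrr.
Qed.

Lemma dist_unique X Y Z Z' (f : hom C X Y) (g : hom C Y Z) (h : hom C Z (S X))
    (g' : hom C Y Z') (h' : hom C Z' (S X)) :
  dist f g h -> dist f g' h' ->
  exists c : hom C Z Z', [/\ is_iso c, c \oc g = g' & h' \oc c = h].
Proof.
move=> D D'.
have fE : idm Y \oc f = f \oc idm X by rewrite comp1m compm1.
have [c [cg hc]] := morE D D' fE.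
exists c; split.
- exact: dist_five D D' (is_iso_id X) (is_iso_id Y) fE cg hc.
- by rewrite cg compm1.
by rewrite -hc fmap_id comp1m.
Qed.

(** Complete f to a triangle (f, g', h'). Rotating it three times, and the
    hypothesis twice, gives two triangles that start with - Sigma f; they are
    isomorphic, and the isomorphism of their third terms desuspends. *)
Lemma dist_unrotate X Y Z (f : hom C X Y) (g : hom C Y Z) (h : hom C Z (S X)) :
  dist g h (- fmap S f) -> dist f g h.
Proof.
move=> D; have [faS fuS _] := equivalence_ff shiftE.
have [Z' [g' [h' D']]] := coneE f.
have [c [cP cg hc]] := dist_unique (rotE (rotE D)) (rotE (rotE (rotE D'))).
have [k kE] := fuS _ _ c; rewrite -kE in cP cg hc.
have kP : is_iso k by apply: is_iso_reflect cP.
have kg : k \oc g = g'.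
  by apply: faS; apply: oppr_inj; rewrite fmap_comp -compNr.
have hk : h' \oc k = h.
  by apply: faS; apply: oppr_inj; rewrite fmap_comp -compNl.
apply: (isoE (is_iso_id X) (is_iso_id Y) (is_iso_inv kP) _ _ _ D').
- by rewrite comp1m compm1.
- by rewrite -kg inv_homK // compm1.
by rewrite fmap_id comp1m -hk -compA inv_homr // compm1.
Qed.

Hypothesis biprodE : has_biproducts C.
Hypothesis octE : forall X Y Z (f : hom C X Y) (g : hom C Y Z),
  exists (Z' Y' X' : C) (f1 : hom C Y Z') (f2 : hom C Z' (S X))
    (g1 : hom C Z X') (g2 : hom C X' (S Y))
    (h1 : hom C Z Y') (h2 : hom C Y' (S X))
    (u : hom C Z' Y') (v : hom C Y' X'),
  [/\ dist f f1 f2, dist g g1 g2, dist (g \oc f) h1 h2,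
      dist u v (fmap S f1 \oc g2) &
      [/\ u \oc f1 = h1 \oc g, h2 \oc u = f2,
          v \oc h1 = g1 & g2 \oc v = fmap S f \oc h2]].

(** Cones being unique up to isomorphism, it is enough to have the octahedral
    axiom for one choice of the three cones of f, g and g f. The backward
    rotation follows from the forward one. *)
Lemma triangulated_criterion : is_triangulated T.
Proof.
split=> //; first by move=> X Y Z f g h; split; [apply: rotE | apply: dist_unrotate].
move=> X Y Z X' Y' Z' f f1 f2 g g1 g2 h1 h2 Df Dg Dh.
have [A [B [D [F1 [F2 [G1 [G2 [H1 [H2 [u [v]]]]]]]]]]] := octE f g.
move=> [DF DG DH Duv [uE Eu vE Ev]].
have [a [aP af fa]] := dist_unique Df DF.
have [b [bP bh hb]] := dist_unique Dh DH.
have [c [cP cg gc]] := dist_unique Dg DG.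
exists (inv_hom b \oc u \oc a), (inv_hom c \oc v \oc b); split.
- apply: (isoE (is_iso_inv aP) (is_iso_inv bP) (is_iso_inv cP) _ _ _ Duv).
  + by rewrite -compA inv_homr // compm1.
  + by rewrite -[RHS]compA inv_homr // compm1.
  rewrite -gc -compA -compA inv_homr // compm1 compA -fmap_comp.
  by rewrite -af inv_homK.
- by rewrite -!compA af uE -bh -compA inv_homK.
- by rewrite -hb -!compA inv_homVK // compA Eu fa.
- by rewrite -!compA bh vE -cg inv_homK.
by rewrite -gc -!compA inv_homVK // compA Ev -compA hb.
Qed.

End TriangulatedCriterion.

(** * Transport of triangulated structures along an equivalence *)

Section Transport.
Variables (K : fieldType) (C D : lincat K) (F : linfunctor C D).
Hypothesis equivF : is_equivalence F.
Variable TD : tri_data D.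
Hypothesis triD : is_triangulated TD.

Let faF : faithful F. Proof. by have [] := equivalence_ff equivF. Qed.
Let fuF : full F. Proof. by have [] := equivalence_ff equivF. Qed.

Local Notation S := (shift TD).

Variables (G : linfunctor D C) (eps : forall Y, hom D (F (G Y)) Y).
Hypothesis epsP : forall Y, is_iso (eps Y).
Hypothesis epsN : forall X Y (f : hom D X Y),
  eps Y \oc fmap F (fmap G f) = f \oc eps X.
Hypothesis equivG : is_equivalence G.

Definition transport_shift : linfunctor C C := comp_functor G (comp_functor S F).

Local Notation R := transport_shift.

Let phi (X : C) : hom D (F (R X)) (S (F X)) := eps (S (F X)).

Let phiP X : is_iso (phi X). Proof. exact: epsP. Qed.

Let phiN X Y (f : hom C X Y) :
  phi Y \oc fmap F (fmap R f) = fmap S (fmap F f) \oc phi X.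
Proof. exact: epsN. Qed.

(** The triangles of C are those that F sends to triangles of D, the shift
    having been conjugated by the equivalence; phi, an instance of the counit,
    compares F Sigma with Sigma F. *)
Definition transport_tri : tri_data C :=
  @TriData K C R (fun X Y Z f g h =>
    @distinguished K D TD _ _ _ (fmap F f) (fmap F g) (phi X \oc fmap F h)).

Lemma transport_exact : exact_functor transport_tri TD F.
Proof. by exists phi. Qed.

(** The cone of F f in D need not be in the image of F, but an isomorphic copy is. *)
Lemma transport_lift X Y (Z : D) (f : hom C X Y) (g : hom D (F Y) Z)
    (h : hom D Z (S (F X))) :
  @distinguished K D TD _ _ _ (fmap F f) g h ->
  exists (Z' : C) (g' : hom C Y Z') (h' : hom C Z' (R X)),
    @distinguished K C transport_tri _ _ _ f g' h'.
Proof.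
move=> Dfgh.
have [g' gE] := fuF (inv_hom (eps Z) \oc g).
have [h' hE] := fuF (inv_hom (phi X) \oc (h \oc eps Z)).
exists (G Z), g', h'; rewrite /= gE hE inv_homVK //.
apply: (tri_iso triD (is_iso_id _) (is_iso_id _) (is_iso_inv (epsP Z)) _ _ _ Dfgh).
- by rewrite comp1m compm1.
- by rewrite compm1.
by rewrite fmap_id comp1m -compA inv_homr // compm1.
Qed.

Lemma transport_triangulated : is_triangulated transport_tri.
Proof.
split.
- have [O O0] := tri_zero triD.
  by exists (G O); rewrite -fmap_id O0 fmap0.
- move=> X Y; have [B [i [j [p [q [pi qj pj qi ij]]]]]] :=
    tri_biproducts triD (F X) (F Y).
  have [i' iE] := fuF (inv_hom (eps B) \oc i).
  have [j' jE] := fuF (inv_hom (eps B) \oc j).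
  have [p' pE] := fuF (p \oc eps B); have [q' qE] := fuF (q \oc eps B).
  exists (G B), i', j', p', q'; split; apply: faF;
    rewrite ?fmapD !fmap_comp ?fmap0 ?fmap_id ?iE ?jE ?pE ?qE.
  + by rewrite -compA inv_homVK.
  + by rewrite -compA inv_homVK.
  + by rewrite -compA inv_homVK.
  + by rewrite -compA inv_homVK.
  rewrite -!compA (compA i) (compA j) -compDr -compDl ij comp1m.
  exact: inv_homl.
- exact: equivalence_comp equivG (equivalence_comp (tri_shift triD) equivF).
- move=> X Y Z X' Y' Z' f g h f' g' h' a b c aP bP cP fE gE hE.
  apply: (tri_iso triD (is_iso_fmap F aP) (is_iso_fmap F bP) (is_iso_fmap F cP)).
  + by rewrite -!fmap_comp fE.
  + by rewrite -!fmap_comp gE.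
  by rewrite compA -phiN -!compA -!fmap_comp hE.
- move=> X Z Z0; rewrite /= fmap_id !fmap0 compm0.
  by apply: (tri_id triD); rewrite -fmap_id Z0 fmap0.
- move=> X Y f; have [Z [g [h Dfgh]]] := tri_cone triD (fmap F f).
  exact: transport_lift Dfgh.
- move=> X Y Z f g h; rewrite /=.
  rewrite [X in X <-> _](tri_rotate triD); split.
    apply: (tri_iso triD (is_iso_id _) (is_iso_id _) (is_iso_inv (phiP X))).
    + by rewrite comp1m compm1.
    + by rewrite compm1 inv_homK.
    rewrite fmap_id comp1m fmapN compNr phiN compNl -compA inv_homr //.
    by rewrite compm1.
  apply: (tri_iso triD (is_iso_id _) (is_iso_id _) (phiP X)).
  + by rewrite comp1m compm1.
  + by rewrite compm1.
  by rewrite fmap_id comp1m fmapN compNr phiN compNl.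
- move=> X Y Z X' Y' Z' f g h f' g' h' a b Df Df' E.
  have FE : fmap F b \oc fmap F f = fmap F f' \oc fmap F a by rewrite -!fmap_comp E.
  have [c [cg hc]] := tri_morphism triD Df Df' FE.
  have [c' cE] := fuF c; exists c'; split; apply: faF; rewrite !fmap_comp cE //.
  apply: (iso_injl (phiP X')); rewrite compA phiN -compA hc compA.
  by [].
move=> X Y Z X' Y' Z' f f1 f2 g g1 g2 h1 h2 Df Dg Dh.
rewrite /= fmap_comp in Dh.
have [u [v [Duv uE Eu vE Ev]]] := tri_octahedron triD Df Dg Dh.
have [u' u'E] := fuF u; have [v' v'E] := fuF v.
exists u', v'; split; last 4 first.
- by apply: faF; rewrite !fmap_comp u'E.
- by apply: faF; apply: (iso_injl (phiP X)); rewrite !fmap_comp u'E compA.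
- by apply: faF; rewrite !fmap_comp v'E.
- apply: faF; apply: (iso_injl (phiP Y)); rewrite !fmap_comp v'E compA Ev.
  by rewrite compA -phiN -compA.
by rewrite /= u'E v'E fmap_comp compA phiN -compA.
Qed.

Section ExactLift.
Variables (B : lincat K) (TB : tri_data B).
Variables (H : linfunctor B C) (I : linfunctor B D).
Variable theta : forall X, hom D (F (H X)) (I X).
Hypothesis thetaP : forall X, is_iso (theta X).
Hypothesis thetaN : forall X Y (f : hom B X Y),
  theta Y \oc fmap F (fmap H f) = fmap I f \oc theta X.

(** A functor H into C is exact as soon as F H is isomorphic to an exact
    functor I, because F detects triangles: the comparison of H Sigma with
    Sigma H is the preimage under F of the one that I provides. *)
Lemma transport_exact_lift :
  exact_functor TB TD I -> exact_functor TB transport_tri H.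
Proof.
move=> [psi [psiP psiN psiD]].
pose SB := shift TB.
have SthP X : is_iso (fmap S (theta X)) by apply: is_iso_fmap.
have thetaV X Y (f : hom B X Y) :
    fmap F (fmap H f) \oc inv_hom (theta X) = inv_hom (theta Y) \oc fmap I f.
  apply: (iso_injl (thetaP Y)).
  by rewrite compA thetaN -compA inv_homr // compm1 inv_homVK.
have [phiH phiHE] : exists phiH : forall X, hom C (H (SB X)) (R (H X)),
    forall X, fmap F (phiH X) = inv_hom (phi (H X)) \oc
      (inv_hom (fmap S (theta X)) \oc (psi X \oc theta (SB X))).
  exists (fun X => fmap_pre (inv_hom (phi (H X)) \oc
      (inv_hom (fmap S (theta X)) \oc (psi X \oc theta (SB X))))) => X.
  exact: fmap_preK.
exists phiH; split.
- move=> X; apply: is_iso_reflect => //; rewrite phiHE.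
  apply: is_iso_comp; first exact: is_iso_inv.
  apply: is_iso_comp; first exact: is_iso_inv.
  exact: is_iso_comp.
- move=> X Y f; apply: faF; apply: (iso_injl (phiP (H Y))).
  rewrite !fmap_comp !phiHE -!compA inv_homVK // thetaN.
  rewrite (compA (phi _)) [X in _ = X \oc _]phiN -[RHS]compA inv_homVK //.
  rewrite (compA (psi Y)) psiN.
  apply: (iso_injl (SthP Y)); rewrite -compA inv_homVK //.
  by rewrite [RHS]compA -fmap_comp thetaN fmap_comp -[RHS]compA inv_homVK.
move=> X Y Z f g h /psiD; rewrite /= fmap_comp phiHE -!compA inv_homVK //.
apply: (tri_iso triD (is_iso_inv (thetaP X)) (is_iso_inv (thetaP Y))
  (is_iso_inv (thetaP Z))).
- by rewrite thetaV.
- by rewrite thetaV.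
apply: (iso_injl (SthP X)); rewrite compA -fmap_comp inv_homr // fmap_id comp1m.
by rewrite -!compA inv_homVK // thetaV inv_homVK.
Qed.

End ExactLift.

End Transport.

(** The form in which an equivalence is used for transport: the quasi-inverse
    conjugates the shift, so it has to be known to be an equivalence, and the
    counit compares the two shifts. *)
Lemma equivalence_inverse (K : fieldType) (C D : lincat K) (F : linfunctor C D) :
  is_equivalence F ->
  exists (G : linfunctor D C) (eps : forall Y, hom D (F (G Y)) Y),
    [/\ forall Y, is_iso (eps Y),
        forall X Y (f : hom D X Y),
          eps Y \oc fmap F (fmap G f) = f \oc eps X &
        is_equivalence G].
Proof.
move=> equivF; have [faF fuF _] := equivalence_ff equivF.
have [G [eta [eps [etaP etaN epsP epsN]]]] := equivF.
exists G, eps; split=> //; apply: ff_equivalence.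
- by move=> X Y f g e; apply: (iso_injr (epsP X)); rewrite -!epsN e.
- move=> X Y h; exists (eps Y \oc fmap F h \oc inv_hom (eps X)).
  apply: faF; apply: (iso_injl (epsP Y)).
  by rewrite epsN -compA inv_homl // compm1.
by move=> X; exists (F X), (inv_hom (eta X)); apply: is_iso_inv.
Qed.

(** * Modules and complexes *)

Section ModuleTools.
Variables (K : fieldType) (A : falgType K).
Implicit Types M N P : rmod A.

Definition dsum_pair P M N (f : 'Hom(P, M)) (g : 'Hom(P, N)) : 'Hom(P, dsum M N) :=
  ((dsum_inl M N \o f) + (dsum_inr M N \o g))%VF.

Lemma dsum_pairE P M N (f : 'Hom(P, M)) (g : 'Hom(P, N)) v :
  dsum_pair f g v = (f v, g v).
Proof.
rewrite add_lfunE !comp_lfunE dsum_inlE dsum_inrE.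
by congr (_, _); rewrite /= ?addr0 ?add0r.
Qed.

Lemma dsum_pair_rhom P M N (f : 'Hom(P, M)) (g : 'Hom(P, N)) :
  is_rhom f -> is_rhom g -> is_rhom (dsum_pair f g).
Proof. by move=> fP gP v a; rewrite !dsum_pairE fP gP. Qed.

Lemma projective_retract M P (i : 'Hom(M, P)) (p : 'Hom(P, M)) :
  is_rhom i -> is_rhom p -> (p \o i = \1)%VF -> projective P -> projective M.
Proof.
move=> iP pP pi projP N Q q f qP fP qS.
have [h hP hE] := projP N Q q (f \o p)%VF qP (rhom_comp fP pP) qS.
exists (h \o i)%VF; first exact: rhom_comp.
by rewrite comp_lfunA hE -comp_lfunA pi comp_lfun1r.
Qed.

End ModuleTools.

(* Linearity over the algebra of maps assembled from projections, injections,
   differentials and chain maps. *)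
Ltac rhom := repeat first
  [ exact: chain_rhom | exact: cdiff_rhom | exact: rhom_id | exact: rhom0
  | exact: dsum_fst_rhom | exact: dsum_snd_rhom
  | exact: dsum_inl_rhom | exact: dsum_inr_rhom
  | apply: dsum_pair_rhom | apply: rhom_comp | apply: rhomN | apply: rhomD ].

Definition lfun_evalE := (add_lfunE, comp_lfunE, opp_lfunE, zero_lfunE, id_lfunE).

Section ChainTools.
Variables (K : fieldType) (A : falgType K).
Implicit Types X Y Z : cpx A.

Lemma cdiff2E X i v : cdiff X (i + 1) (cdiff X i v) = 0.
Proof. by rewrite -comp_lfunE cdiff2 zero_lfunE. Qed.

Lemma chain_commE X Y (f : chain X Y) i v :
  cdiff Y i (chain_map f i v) = chain_map f (i + 1) (cdiff X i v).
Proof. by rewrite -!comp_lfunE chain_comm. Qed.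

Lemma is_chainP X Y (F : forall i, 'Hom(X i, Y i)) :
  (forall i, is_rhom (F i)) ->
  (forall i v, cdiff Y i (F i v) = F (i + 1) (cdiff X i v)) -> is_chain F.
Proof. by move=> FP FC; split=> // i; apply/lfunP => v; rewrite !comp_lfunE. Qed.

Lemma per_compM X Y Z (g : chain Y Z) (f : chain X Y) :
  (per_class g : hom (per A) Y Z) \oc (per_class f : hom (per A) X Y)
    = per_class (chain_comp g f).
Proof. exact: per_compE. Qed.

Lemma per_class_linear X Y : linear (@per_class K A X Y).
Proof. exact: lclass_linear. Qed.

Lemma per_classD X Y (f g : chain X Y) :
  per_class (f + g) = per_class f + per_class g.
Proof. by have := per_class_linear 1 f g; rewrite !scale1r. Qed.

Lemma per_class0 X Y : per_class (0 : chain X Y) = 0.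
Proof. by []. Qed.

Lemma per_classN X Y (f : chain X Y) : per_class (- f) = - per_class f.
Proof.
by have := per_class_linear (-1) f 0; rewrite per_class0 !addr0 !scaleN1r.
Qed.

Lemma chain_compE X Y Z (g : chain Y Z) (f : chain X Y) i v :
  chain_map (chain_comp g f) i v = chain_map g i (chain_map f i v).
Proof. exact: comp_lfunE. Qed.

Lemma chain_mapD X Y (f g : chain X Y) i v :
  chain_map (f + g) i v = chain_map f i v + chain_map g i v.
Proof. exact: add_lfunE. Qed.

Lemma chain_mapZ X Y c (f : chain X Y) i v :
  chain_map (c *: f) i v = c *: chain_map f i v.
Proof. exact: scale_lfunE. Qed.

Lemma chain_map_sum X Y I (r : seq I) (F : I -> chain X Y) i v :
  chain_map (\sum_(j <- r) F j) i v = \sum_(j <- r) chain_map (F j) i v.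
Proof.
elim/big_rec2: _ => [|j w f _ <-]; last exact: chain_mapD.
exact: zero_lfunE.
Qed.

Lemma per_class_sum X Y I (r : seq I) (F : I -> chain X Y) :
  per_class (\sum_(j <- r) F j) = \sum_(j <- r) per_class (F j).
Proof. by elim/big_rec2: _ => [|j w f _ <-] //; apply: per_classD. Qed.

Lemma chain_mapN X Y (f : chain X Y) i v : chain_map (- f) i v = - chain_map f i v.
Proof. exact: opp_lfunE. Qed.

Lemma chain_eq X Y (f g : chain X Y) :
  (forall i v, chain_map f i v = chain_map g i v) -> f = g.
Proof. by move=> fg; apply: chainP => i; apply/lfunP => v. Qed.

(** Homotopic chain maps have the same class, pointwise form. A homotopy s is
    indexed so that s i lowers the degree from i + 1 to i, which makes the
    condition in degree i + 1 free of transports along i - 1 + 1 = i. *)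
Lemma per_class_eq X Y (f g : chain X Y) (s : forall i, 'Hom(X (i + 1), Y i)) :
  (forall i, is_rhom (s i)) ->
  (forall i v, chain_map f (i + 1) v - chain_map g (i + 1) v
     = cdiff Y i (s i v) + s (i + 1) (cdiff X (i + 1) v)) ->
  per_class f = per_class g.
Proof.
move=> sP sE; apply/lclass_eq/asboolP; exists s; split=> // i.
apply/lfunP => v; rewrite -[LHS]/((chain_map f (i + 1) - chain_map g (i + 1)) v).
by rewrite !lfun_evalE sE.
Qed.

Lemma per_class_homotopy X Y (f g : chain X Y) :
  per_class f = per_class g ->
  exists s : forall i, 'Hom(X (i + 1), Y i), (forall i, is_rhom (s i)) /\
  (forall i v, chain_map f (i + 1) v - chain_map g (i + 1) v
     = cdiff Y i (s i v) + s (i + 1) (cdiff X (i + 1) v)).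
Proof.
move=> /lclass_eq/asboolP[s [sP sE]]; exists s; split=> // i v.
have := congr1 (fun h : 'Hom(_, _) => h v) (sE i).
by rewrite /= -[X in X = _]/((chain_map f (i + 1) - chain_map g (i + 1)) v) !lfun_evalE.
Qed.

Lemma chain_map0 X Y i v : chain_map (0 : chain X Y) i v = 0.
Proof. exact: zero_lfunE. Qed.

Lemma per_class_eq0 X Y (f : chain X Y) (s : forall i, 'Hom(X (i + 1), Y i)) :
  (forall i, is_rhom (s i)) ->
  (forall i v, chain_map f (i + 1) v
     = cdiff Y i (s i v) + s (i + 1) (cdiff X (i + 1) v)) ->
  per_class f = 0.
Proof.
move=> sP sE; rewrite -per_class0; apply: (per_class_eq sP) => i v.
by rewrite chain_map0 subr0 sE.
Qed.

Lemma per_class_homotopy0 X Y (f : chain X Y) :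
  per_class f = 0 ->
  exists s : forall i, 'Hom(X (i + 1), Y i), (forall i, is_rhom (s i)) /\
  (forall i v, chain_map f (i + 1) v
     = cdiff Y i (s i v) + s (i + 1) (cdiff X (i + 1) v)).
Proof.
rewrite -per_class0 => /per_class_homotopy[s [sP sE]]; exists s; split=> // i v.
by rewrite -sE chain_map0 subr0.
Qed.

(** A degreewise inverse is automatically linear over the algebra and commutes
    with the differentials. *)
Lemma chain_iso X Y (f : chain X Y) (g : forall i, 'Hom(Y i, X i)) :
  (forall i v, g i (chain_map f i v) = v) ->
  (forall i v, chain_map f i (g i v) = v) ->
  is_iso (per_class f : hom (per A) X Y).
Proof.
move=> fK gK.
have gP : is_chain g.
  apply: is_chainP => [i v a|i v].
    by rewrite -[in LHS](gK i v) -(chain_rhom f) fK.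
  by rewrite -[in RHS](gK i v) chain_commE fK.
exists (per_class (mk_chain gP)); rewrite !per_compM; split; congr per_class;
  by apply: chain_eq => i v; rewrite chain_compE ?id_lfunE.
Qed.

End ChainTools.

(** * Contractions of mapping cones *)

Section Cones.
Variables (K : fieldType) (A : falgType K).
Implicit Types X Y Z : cpx A.

Lemma cdiff_coneE X Y (u : chain X Y) i (v : cone u i) :
  cdiff (cone u) i v
    = (- cdiff X (i + 1) v.1, chain_map u (i + 1) v.1 + cdiff Y i v.2).
Proof. exact: cone_diffE. Qed.

Lemma cone_inE X Y (u : chain X Y) i v : chain_map (cone_in u) i v = (0, v).
Proof. exact: dsum_inrE. Qed.

Lemma cone_outE X Y (u : chain X Y) i (v : cone u i) :
  chain_map (cone_out u) i v = v.1.
Proof. exact: dsum_fstE. Qed.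

Lemma cdiff_shiftE X i v : cdiff (shift_cpx X) i v = - cdiff X (i + 1) v.
Proof. by rewrite /= opp_lfunE. Qed.

Lemma shift_chainE X Y (u : chain X Y) i v :
  chain_map (shift_chain u) i v = chain_map u (i + 1) v.
Proof. by []. Qed.

Definition dsumE := (dsum_pairE, dsum_fstE, dsum_sndE, dsum_inlE, dsum_inrE).

(** The contraction is (x, y) |-> (y, 0). *)
Lemma cone_id_contractible X : idm (cone (chain_id X) : per A) = 0.
Proof.
pose s i : 'Hom(cone (chain_id X) (i + 1), cone (chain_id X) i) :=
  (dsum_inl _ _ \o dsum_snd _ _)%VF.
apply: (per_class_eq (s := s)) => [i|i v]; first by rewrite /s; rhom.
rewrite /s !cdiff_coneE !lfun_evalE !dsumE /=.
case: v => x y /=; congr (_, _) => /=.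
  by rewrite subr0 [RHS]addrC addrK.
by rewrite subr0 linear0 !addr0.
Qed.

(** For u : X -> Y, v : Y -> Z and w = v u, the maps oct_fst : cone u -> cone w
    and oct_snd : cone w -> cone v make every square of the octahedron commute
    strictly. What remains is that cone v is a deformation retract of the cone
    of oct_fst. *)
Section Octahedron.
Variables (X Y Z : cpx A) (u : chain X Y) (v : chain Y Z).
Let w := chain_comp v u.

Definition oct_fst_map i : 'Hom(cone u i, cone w i) :=
  dsum_pair (dsum_fst _ _) (chain_map v i \o dsum_snd _ _)%VF.
Definition oct_snd_map i : 'Hom(cone w i, cone v i) :=
  dsum_pair (chain_map u (i + 1) \o dsum_fst _ _)%VF (dsum_snd _ _).

Lemma oct_fstE i x : oct_fst_map i x = (x.1, chain_map v i x.2).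
Proof. by rewrite /oct_fst_map dsum_pairE lfun_evalE !dsumE. Qed.
Lemma oct_sndE i x : oct_snd_map i x = (chain_map u (i + 1) x.1, x.2).
Proof. by rewrite /oct_snd_map dsum_pairE lfun_evalE !dsumE. Qed.

Lemma oct_fst_subproof : @is_chain K A (cone u) (cone w) oct_fst_map.
Proof.
apply: is_chainP => [i|i x]; first by rewrite /oct_fst_map; rhom.
rewrite !oct_fstE !cdiff_coneE /= chain_compE linearD /=.
by rewrite chain_commE.
Qed.
Definition oct_fst : chain (cone u) (cone w) := mk_chain oct_fst_subproof.

Lemma oct_snd_subproof : @is_chain K A (cone w) (cone v) oct_snd_map.
Proof.
apply: is_chainP => [i|i x]; first by rewrite /oct_snd_map; rhom.
rewrite !oct_sndE !cdiff_coneE /= chain_compE linearN /=.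
by rewrite chain_commE.
Qed.
Definition oct_snd : chain (cone w) (cone v) := mk_chain oct_snd_subproof.

Definition oct_in_map i : 'Hom(cone v i, cone oct_fst i) :=
  dsum_pair (dsum_inr _ _ \o dsum_fst _ _)%VF (dsum_inr _ _ \o dsum_snd _ _)%VF.
Definition oct_out_map i : 'Hom(cone oct_fst i, cone v i) :=
  dsum_pair ((dsum_snd _ _ \o dsum_fst _ _)
      + (chain_map u (i + 1) \o (dsum_fst _ _ \o dsum_snd _ _)))%VF
    (dsum_snd _ _ \o dsum_snd _ _)%VF.

Lemma oct_inE i x : oct_in_map i x = ((0, x.1), (0, x.2)).
Proof. by rewrite /oct_in_map dsum_pairE !lfun_evalE !dsumE. Qed.
Lemma oct_outE i x :
  oct_out_map i x = (x.1.2 + chain_map u (i + 1) x.2.1, x.2.2).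
Proof. by rewrite /oct_out_map dsum_pairE !lfun_evalE !dsumE. Qed.

Lemma oct_in_subproof : @is_chain K A (cone v) (cone oct_fst) oct_in_map.
Proof.
apply: is_chainP => [i|i x]; first by rewrite /oct_in_map; rhom.
rewrite oct_inE cdiff_coneE [X in _ = X]oct_inE.
rewrite oct_fstE !cdiff_coneE /= !linear0.
by apply: injective_projections; apply: injective_projections; rewrite /= ?add0r ?oppr0.
Qed.
Definition oct_in : chain (cone v) (cone oct_fst) := mk_chain oct_in_subproof.

Lemma oct_out_subproof : @is_chain K A (cone oct_fst) (cone v) oct_out_map.
Proof.
apply: is_chainP => [i|i x]; first by rewrite /oct_out_map; rhom.
rewrite oct_outE cdiff_coneE [X in _ = X]oct_outE.
rewrite cdiff_coneE oct_fstE !cdiff_coneE /= !lfun_evalE !linearD !linearN /= chain_commE.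
by rewrite addrACA addNr add0r addrA.
Qed.
Definition oct_out : chain (cone oct_fst) (cone v) := mk_chain oct_out_subproof.

Lemma oct_outK i x : oct_out_map i (oct_in_map i x) = x.
Proof. by rewrite oct_outE oct_inE /= linear0 addr0 -surjective_pairing. Qed.

Local Notation cls f := (per_class f : hom (per A) _ _).

(** An element of the cone of oct_fst is ((x, y), (x', z)); the homotopy from
    oct_in oct_out to the identity is ((x', 0), (0, 0)). *)
Lemma oct_inK : cls oct_out \oc cls oct_in = idm (cone v : per A) /\
  cls oct_in \oc cls oct_out = idm (cone oct_fst : per A).
Proof.
rewrite !per_compM; split.
  by congr per_class; apply: chain_eq => i x; rewrite chain_compE oct_outK id_lfunE.
apply: esym; pose s i : 'Hom(cone oct_fst (i + 1), cone oct_fst i) :=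
  (dsum_inl _ _ \o (dsum_inl _ _ \o (dsum_fst _ _ \o dsum_snd _ _)))%VF.
have sE i x : s i x = ((x.2.1, 0), (0, 0)).
  by rewrite /s !lfun_evalE !dsumE.
apply: (per_class_eq (s := s)) => [i|i x]; first by rewrite /s; rhom.
rewrite !sE chain_compE [chain_map _ _ x]id_lfunE.
rewrite [chain_map _ _ x]oct_outE [chain_map _ _ _]oct_inE.
rewrite [cdiff _ i _]cdiff_coneE [cdiff _ _ x]cdiff_coneE /=.
rewrite oct_fstE [cdiff (cone u) (i + 1) _]cdiff_coneE.
rewrite [cdiff (cone w) (i + 1) _]cdiff_coneE [cdiff (cone w) i _]cdiff_coneE /=.
case: x => [[a b] [c d]] /=; rewrite !oct_fstE /= !linear0 !addr0.
apply: injective_projections; apply: injective_projections => /=.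
- by rewrite subr0 opprK [RHS]addrC subrK.
- by rewrite opprD addNKr addr0.
- by rewrite subr0 [RHS]addr0.
by rewrite subrr !addr0.
Qed.

End Octahedron.

(** The cone of the inclusion Y -> cone u consists of triples (y, (x, y')); it
    retracts by deformation onto its component x, which is the shift of X. *)
Section Rotation.
Variables (X Y : cpx A) (u : chain X Y).

Definition rot_in_map i : 'Hom(shift_cpx X i, cone (cone_in u) i) :=
  dsum_pair (- chain_map u (i + 1)) (dsum_inl _ _).
Definition rot_out_map i : 'Hom(cone (cone_in u) i, shift_cpx X i) :=
  (dsum_fst _ _ \o dsum_snd _ _)%VF.

Lemma rot_inE i x : rot_in_map i x = (- chain_map u (i + 1) x, (x, 0)).
Proof. by rewrite /rot_in_map dsum_pairE opp_lfunE dsum_inlE. Qed.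
Lemma rot_outE i x : rot_out_map i x = x.2.1.
Proof. by rewrite /rot_out_map comp_lfunE !dsumE. Qed.

Lemma rot_in_subproof : @is_chain K A (shift_cpx X) (cone (cone_in u)) rot_in_map.
Proof.
apply: is_chainP => [i|i x]; first apply: dsum_pair_rhom; rhom.
  exact: (chain_rhom u (i + 1)).
rewrite rot_inE [cdiff (cone _) i _]cdiff_coneE [RHS]rot_inE /= (cone_inE u).
rewrite cone_diffE /= !lfun_evalE !linear0 !linearN /= chain_commE.
apply: injective_projections; [|apply: injective_projections] => /=.
- by [].
- by rewrite add0r.
by rewrite addr0 addNr.
Qed.
Definition rot_in : chain (shift_cpx X) (cone (cone_in u)) :=
  mk_chain rot_in_subproof.

Lemma rot_out_subproof : @is_chain K A (cone (cone_in u)) (shift_cpx X) rot_out_map.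
Proof.
apply: is_chainP => [i|i x]; first by rewrite /rot_out_map; rhom.
rewrite rot_outE [RHS]rot_outE [cdiff (cone _) i _]cdiff_coneE /= (cone_inE u).
by rewrite [cdiff (cone u) i _]cdiff_coneE /= add0r opp_lfunE.
Qed.
Definition rot_out : chain (cone (cone_in u)) (shift_cpx X) :=
  mk_chain rot_out_subproof.

Local Notation cls f := (per_class f : hom (per A) _ _).

(** The homotopy from rot_in rot_out to the identity sends (y, (x, y')) to
    (y', (0, 0)). *)
Lemma rot_inK : cls rot_out \oc cls rot_in = idm (shift_cpx X : per A) /\
  cls rot_in \oc cls rot_out = idm (cone (cone_in u) : per A).
Proof.
rewrite !per_compM; split.
  congr per_class; apply: chain_eq => i x.
  by rewrite chain_compE [LHS]rot_outE [chain_map _ _ x]rot_inE id_lfunE.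
apply: esym; pose s i : 'Hom(cone (cone_in u) (i + 1), cone (cone_in u) i) :=
  (dsum_inl _ _ \o (dsum_snd _ _ \o dsum_snd _ _))%VF.
have sE i x : s i x = (x.2.2, (0, 0)).
  by rewrite /s !lfun_evalE !dsumE.
apply: (per_class_eq (s := s)) => [i|i x]; first by rewrite /s; rhom.
rewrite !sE chain_compE [chain_map _ _ x]id_lfunE.
rewrite [chain_map _ _ x]rot_outE [chain_map _ _ _]rot_inE.
rewrite [cdiff _ i _]cdiff_coneE [cdiff _ _ x]cdiff_coneE /= !(cone_inE u).
rewrite [cdiff (cone u) (i + 1) _]cdiff_coneE [cdiff (cone u) i _]cdiff_coneE /=.
case: x => [a [b c]] /=; rewrite !linear0 !addr0.
apply: injective_projections; [|apply: injective_projections] => /=.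
- by rewrite opprK [RHS]addrC addrA addrK.
- by rewrite subrr addr0.
by rewrite subr0 [RHS]addr0.
Qed.

End Rotation.

End Cones.

(** * The shift is an equivalence *)

Section IntegerSuccessor.

(** A family over the successors i + 1 is a family over all integers. The
    shift sees only the degrees i + 1, so this is what recovers a chain map or
    a homotopy from its shift. *)
Definition succ_family (P : int -> Type) (f : forall i, P (i + 1)) (j : int) : P j :=
  eq_rect (j - 1 + 1) P (f (j - 1)) j (subrK 1 j).

Lemma succ_familyE (P : int -> Type) (f : forall i, P (i + 1)) i :
  succ_family f (i + 1) = f i.
Proof.
rewrite /succ_family; move: (subrK 1 (i + 1)); rewrite (addrK 1 i) => e.
by rewrite (Prop_irrelevance e erefl).
Qed.

Lemma int_succ_ind (P : int -> Prop) : (forall i, P (i + 1)) -> forall j, P j.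
Proof. by move=> H j; rewrite -(subrK 1 j); apply: H. Qed.

End IntegerSuccessor.

Section ShiftEquivalence.
Variables (K : fieldType) (A : falgType K).
Implicit Types X Y Z : cpx A.

Lemma shift_faithful : faithful (per_shift A).
Proof.
move=> X Y f g; have [f' ->] := per_classP f; have [g' ->] := per_classP g.
rewrite !per_shiftE => /per_class_homotopy[s [sP sE]].
pose t := succ_family (P := fun j => 'Hom(X (j + 1), Y j)) (fun i => - s i).
have tE i : t (i + 1) = - s i by exact: succ_familyE.
apply: (per_class_eq (s := t)).
  apply: int_succ_ind => i; rewrite tE; apply: rhomN; exact: (sP i).
apply: int_succ_ind => i v; rewrite !tE !opp_lfunE linearN.
have := sE i v; rewrite !cdiff_shiftE => e.
apply: etrans e _; congr (_ + _).
by rewrite linearN.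
Qed.

Lemma shift_full : full (per_shift A).
Proof.
move=> X Y g; have [g' ->] := per_classP g.
pose f := succ_family (P := fun j => 'Hom(X j, Y j)) (chain_map g').
have fE i : f (i + 1) = chain_map g' i by exact: succ_familyE.
have fP : is_chain f.
  apply: is_chainP; apply: int_succ_ind => i.
    by rewrite fE; exact: (chain_rhom g' i).
  move=> v; rewrite !fE; have := @chain_commE K A (shift_cpx X) (shift_cpx Y) g' i v.
  by rewrite !cdiff_shiftE linearN => /oppr_inj.
exists (per_class (mk_chain fP)); rewrite per_shiftE; congr per_class.
by apply: chainP => i; apply: fE.
Qed.

(** The degrees i + 1 - 1 and i are equal but not convertible, so the inverse
    shift needs these transport maps in its differential. *)
Definition cast_hom (X : int -> rmod A) i j (e : i = j) : 'Hom(X i, X j) :=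
  match e in _ = k return 'Hom(X i, X k) with erefl => \1%VF end.

Lemma cast_homE (X : int -> rmod A) i (e : i = i) : cast_hom X e = \1%VF.
Proof. by rewrite (Prop_irrelevance e erefl). Qed.

Lemma cast_hom_rhom (X : int -> rmod A) i j (e : i = j) : is_rhom (cast_hom X e).
Proof. by case: j / e; apply: rhom_id. Qed.

Lemma cast_homK (X : int -> rmod A) i j (e : i = j) (e' : j = i) v :
  cast_hom X e' (cast_hom X e v) = v.
Proof. by case: j / e e' => e'; rewrite !cast_homE !id_lfunE. Qed.

Lemma cast_hom_comp (X : int -> rmod A) i j k (e : i = j) (e' : j = k)
    (e'' : i = k) v :
  cast_hom X e' (cast_hom X e v) = cast_hom X e'' v.
Proof. by case: k / e' e'' => e''; rewrite (Prop_irrelevance e'' e) cast_homE id_lfunE. Qed.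

Lemma cdiff_cast X i j (e : i = j) (e' : i + 1 = j + 1) v :
  cdiff X j (cast_hom X e v) = cast_hom X e' (cdiff X i v).
Proof. by case: j / e e' => e'; rewrite !cast_homE !id_lfunE. Qed.

Section Unshift.
Variable X : cpx A.

Let pred_succ (i : int) : i - 1 + 1 = i + 1 - 1.
Proof. by rewrite subrK addrK. Qed.

Definition unshift_diff i : 'Hom(X (i - 1), X (i + 1 - 1)) :=
  (- (cast_hom X (pred_succ i) \o cdiff X (i - 1)))%VF.

Lemma unshift_diffE i v :
  unshift_diff i v = - cast_hom X (pred_succ i) (cdiff X (i - 1) v).
Proof. by rewrite opp_lfunE comp_lfunE. Qed.

Lemma unshift_diff_rhom i : is_rhom (unshift_diff i).
Proof. by apply: rhomN; exact: (rhom_comp (cast_hom_rhom (X := X) _) (cdiff_rhom X _)). Qed.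

Lemma unshift_diff2 i : (unshift_diff (i + 1) \o unshift_diff i = 0)%VF.
Proof.
apply/lfunP => v; rewrite comp_lfunE zero_lfunE !unshift_diffE !linearN /= opprK.
have e : i - 1 + 1 + 1 = i + 1 - 1 + 1 by rewrite pred_succ.
by rewrite (cdiff_cast (pred_succ i) e) cdiff2E !linear0.
Qed.

Lemma unshift_bound : exists n : nat, forall i : int,
  (n < `|i|)%N -> forall x : X (i - 1), x = 0.
Proof. by have [n nP] := cbound X; exists n.+1 => i ni; apply: nP; lia. Qed.

Definition unshift_cpx : cpx A :=
  @Cpx K A (fun i => X (i - 1)) unshift_diff unshift_diff_rhom unshift_diff2
    (fun i => cproj X (i - 1)) unshift_bound.

Lemma unshift_chain_subproof :
  @is_chain K A (shift_cpx unshift_cpx) X (fun i => cast_hom X (addrK 1 i)).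
Proof.
apply: is_chainP => [i|i v]; first exact: (cast_hom_rhom (X := X) (addrK 1 i)).
rewrite (@cdiff_shiftE _ _ unshift_cpx i v) [cdiff unshift_cpx _ _]unshift_diffE opprK.
have e : i + 1 - 1 + 1 = i + 1 by rewrite addrK.
by rewrite (cdiff_cast (addrK 1 i) e) -(cast_hom_comp (pred_succ (i + 1)) (addrK 1 (i + 1)) e).
Qed.

Lemma unshiftK : exists i : hom (per A) (per_shift A unshift_cpx) X, is_iso i.
Proof.
exists (per_class (mk_chain unshift_chain_subproof)).
apply: (@chain_iso K A (shift_cpx unshift_cpx) X _
  (fun i => cast_hom X (esym (addrK 1 i)))) => i v.
  exact: (cast_homK (X := X) (addrK 1 i)).
exact: (cast_homK (X := X) (esym (addrK 1 i))).
Qed.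

End Unshift.

Lemma shift_equivalence : is_equivalence (per_shift A).
Proof.
apply: ff_equivalence shift_faithful shift_full _ => X.
by exists (unshift_cpx X); apply: unshiftK.
Qed.

End ShiftEquivalence.

(** * Zero object and direct sums of complexes *)

Section Additive.
Variables (K : fieldType) (A : falgType K).

Lemma zero_space_eq (v w : 'rV[K]_0) : v = w.
Proof. by rewrite [v]thinmx0 [w]thinmx0. Qed.

Definition zero_ract : raction A 'rV[K]_0 :=
  @RAction K A 'rV[K]_0 (fun v _ => v) (fun _ _ _ _ => erefl _)
    (fun v _ _ _ => zero_space_eq _ _) (fun _ => erefl _) (fun _ _ _ => erefl _).

Definition zero_mod : rmod A := RMod zero_ract.

Lemma zero_mod_projective : projective zero_mod.
Proof.
move=> M N p f pP fP pS; exists 0; first exact: rhom0.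
by apply/lfunP => v; rewrite (zero_space_eq v 0) !linear0.
Qed.

Lemma zero_diff2 i : ((0 : 'Hom(zero_mod, zero_mod)) \o
  ((fun _ : int => 0) i : 'Hom(zero_mod, zero_mod)) = 0)%VF.
Proof. exact: comp_lfun0l. Qed.

Definition zero_cpx : cpx A :=
  @Cpx K A (fun=> zero_mod) (fun=> 0) (fun=> @rhom0 K A _ _) zero_diff2
    (fun=> zero_mod_projective)
    (ex_intro _ 0%N (fun i _ x => zero_space_eq x 0)).

Lemma per_has_zero : has_zero (per A).
Proof.
exists zero_cpx; rewrite /= /per_idm (_ : chain_id zero_cpx = 0); first by [].
by apply: chain_eq => i v; apply: zero_space_eq.
Qed.

Section Biproduct.
Variables X Y : cpx A.

Definition sum_diff i : 'Hom(dsum (X i) (Y i), dsum (X (i + 1)) (Y (i + 1))) :=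
  dsum_pair (cdiff X i \o dsum_fst _ _)%VF (cdiff Y i \o dsum_snd _ _)%VF.

Lemma sum_diffE i v : sum_diff i v = (cdiff X i v.1, cdiff Y i v.2).
Proof. by rewrite /sum_diff dsum_pairE !comp_lfunE dsum_fstE dsum_sndE. Qed.

Lemma sum_diff_rhom i : is_rhom (sum_diff i).
Proof. by rewrite /sum_diff; rhom. Qed.

Lemma sum_diff2 i : (sum_diff (i + 1) \o sum_diff i = 0)%VF.
Proof.
by apply/lfunP => v; rewrite comp_lfunE zero_lfunE !sum_diffE /= !cdiff2E.
Qed.

Lemma sum_bound : exists n : nat, forall i : int,
  (n < `|i|)%N -> forall v : dsum (X i) (Y i), v = 0.
Proof.
have [n nP] := cbound X; have [m mP] := cbound Y.
by exists (n + m)%N => i ni [x y]; congr (_, _); [apply: nP | apply: mP]; lia.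
Qed.

Definition sum_cpx : cpx A :=
  @Cpx K A (fun i => dsum (X i) (Y i)) sum_diff sum_diff_rhom sum_diff2
    (fun i => dsum_projective (cproj X i) (cproj Y i)) sum_bound.

Lemma cdiff_sumE i v : cdiff sum_cpx i v = (cdiff X i v.1, cdiff Y i v.2).
Proof. exact: sum_diffE. Qed.

Lemma sum_inl_subproof : @is_chain K A X sum_cpx (fun i => dsum_inl (X i) (Y i)).
Proof.
apply: is_chainP => [i|i v]; first exact: dsum_inl_rhom.
by rewrite cdiff_sumE !dsum_inlE /= linear0.
Qed.
Lemma sum_inr_subproof : @is_chain K A Y sum_cpx (fun i => dsum_inr (X i) (Y i)).
Proof.
apply: is_chainP => [i|i v]; first exact: dsum_inr_rhom.
by rewrite cdiff_sumE !dsum_inrE /= linear0.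
Qed.
Lemma sum_fst_subproof : @is_chain K A sum_cpx X (fun i => dsum_fst (X i) (Y i)).
Proof.
apply: is_chainP => [i|i v]; first exact: dsum_fst_rhom.
by rewrite cdiff_sumE !dsum_fstE.
Qed.
Lemma sum_snd_subproof : @is_chain K A sum_cpx Y (fun i => dsum_snd (X i) (Y i)).
Proof.
apply: is_chainP => [i|i v]; first exact: dsum_snd_rhom.
by rewrite cdiff_sumE !dsum_sndE.
Qed.

End Biproduct.

Lemma per_has_biproducts : has_biproducts (per A).
Proof.
move=> X Y; exists (sum_cpx X Y), (per_class (mk_chain (sum_inl_subproof X Y))),
  (per_class (mk_chain (sum_inr_subproof X Y))),
  (per_class (mk_chain (sum_fst_subproof X Y))),
  (per_class (mk_chain (sum_snd_subproof X Y))).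
rewrite !per_compM; split.
- congr per_class; apply: chain_eq => i v.
  by rewrite chain_compE id_lfunE /= dsum_inlE dsum_fstE.
- congr per_class; apply: chain_eq => i v.
  by rewrite chain_compE id_lfunE /= dsum_inrE dsum_sndE.
- rewrite (_ : chain_comp _ _ = 0) //; apply: chain_eq => i v.
  by rewrite chain_compE zero_lfunE /= dsum_inrE dsum_fstE.
- rewrite (_ : chain_comp _ _ = 0) //; apply: chain_eq => i v.
  by rewrite chain_compE zero_lfunE /= dsum_inlE dsum_sndE.
rewrite -per_classD; congr per_class; apply: chain_eq => i v.
rewrite chain_mapD !chain_compE /= !dsumE id_lfunE.
by case: v => x y; congr (_, _); rewrite /= ?addr0 ?add0r.
Qed.

End Additive.

(** * The homotopy category of projective complexes is triangulated *)

Section PerTriangulated.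
Variables (K : fieldType) (A : falgType K).
Implicit Types X Y Z : cpx A.

Local Notation dist f g h := (@distinguished K (per A) (per_tri A) _ _ _ f g h).
Local Notation "[ f ]" := (per_class f : hom (per A) _ _).

Lemma per_standard X Y (u : chain X Y) :
  dist [u] [cone_in u] [cone_out u].
Proof.
exists X, Y, u, (idm (X : per A)), (idm (Y : per A)), (idm (cone u : per A)).
split; last 3 first.
- by rewrite comp1m compm1.
- by rewrite comp1m compm1.
- by rewrite fmap_id comp1m compm1.
by split; apply: is_iso_id.
Qed.

Lemma per_tri_iso X Y Z X' Y' Z'
    (f : hom (per A) X Y) (g : hom (per A) Y Z) (h : hom (per A) Z (per_shift A X))
    (f' : hom (per A) X' Y') (g' : hom (per A) Y' Z')
    (h' : hom (per A) Z' (per_shift A X'))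
    (a : hom (per A) X X') (b : hom (per A) Y Y') (c : hom (per A) Z Z') :
  is_iso a -> is_iso b -> is_iso c ->
  b \oc f = f' \oc a -> c \oc g = g' \oc b ->
  fmap (per_shift A) a \oc h = h' \oc c ->
  dist f g h -> dist f' g' h'.
Proof.
move=> aP bP cP fE gE hE [X0 [Y0 [u [a0 [b0 [c0 [[a0P b0P c0P] uE iE oE]]]]]]].
exists X0, Y0, u, (a0 \oc inv_hom a), (b0 \oc inv_hom b), (c0 \oc inv_hom c).
split; first by split; apply: is_iso_comp => //; apply: is_iso_inv.
- apply: (iso_injr aP).
  by rewrite -!compA -fE inv_homK // inv_homl // compm1 uE.
- apply: (iso_injr bP).
  by rewrite -!compA -gE inv_homK // inv_homl // compm1 iE.
apply: (iso_injr cP).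
rewrite -!compA -hE inv_homl // compm1 compA -fmap_comp -compA inv_homl //.
by rewrite compm1 oE.
Qed.

(** The isomorphism from the rotated standard triangle to the standard triangle
    of cone_in u is given by rot_in. Its compatibility with cone_out is checked
    on the inverse rot_out, where it holds strictly. *)
Lemma per_tri_rotate X Y Z
    (f : hom (per A) X Y) (g : hom (per A) Y Z) (h : hom (per A) Z (per_shift A X)) :
  dist f g h -> dist g h (- fmap (per_shift A) f).
Proof.
move=> [X0 [Y0 [u [a [b [c [[aP bP cP] uE iE oE]]]]]]].
have D : dist [cone_in u] [cone_out u] (- fmap (per_shift A) [u]).
  exists Y0, (cone u), (cone_in u), (idm (Y0 : per A)), (idm (cone u : per A)),
    [rot_in u].
  have [rK Kr] := rot_inK u; split; last 3 first.
  - by rewrite comp1m compm1.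
  - have -> : [cone_out u] = [rot_out u] \oc [cone_in (cone_in u)].
      rewrite per_compM; congr per_class; apply: chain_eq => i x.
      by rewrite chain_compE cone_outE cone_inE [RHS]rot_outE.
    by rewrite compA Kr comp1m compm1.
  - rewrite fmap_id comp1m per_shiftE -per_classN per_compM; congr per_class.
    apply: chain_eq => i x.
    by rewrite chain_mapN shift_chainE chain_compE cone_outE [chain_map _ _ x]rot_inE.
  by split; [exact: is_iso_id|exact: is_iso_id|exists [rot_out u]].
have SaP := is_iso_fmap (per_shift A) aP.
apply: (per_tri_iso (is_iso_inv bP) (is_iso_inv cP) (is_iso_inv SaP) _ _ _ D).
- by apply: (iso_injl cP); rewrite inv_homVK // compA iE -compA inv_homr // compm1.
- by apply: (iso_injl SaP); rewrite inv_homVK // compA oE -compA inv_homr // compm1.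
rewrite compNl compNr; congr (- _).
apply: (iso_injr SaP); rewrite -[RHS]compA inv_homl // compm1.
apply: (iso_injl (is_iso_fmap (per_shift A) bP)).
by rewrite -!fmap_comp uE !compA inv_homr // comp1m.
Qed.

(** Equality of the second components in cone_map_subproof, for p = b u x,
    q = u' a x, d = d s x, s = s d x and t = b d y. *)
Lemma cone_map_arith (V : zmodType) (p q d s t : V) :
  p - q = d + s -> q + (d + t) = - s + (p + t).
Proof.
move=> /eqP; rewrite subr_eq => /eqP ->; rewrite !addrA; congr (_ + t).
by rewrite [- s + d]addrC subrK addrC.
Qed.

(** A square that commutes up to the homotopy s induces a map of cones
    (x, y) |-> (a x, s x + b y). *)
Section ConeMap.
Variables (X Y X' Y' : cpx A) (u : chain X Y) (u' : chain X' Y').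
Variables (a : chain X X') (b : chain Y Y').
Variable s : forall i, 'Hom(X (i + 1), Y' i).
Hypothesis sP : forall i, is_rhom (s i).
Hypothesis sE : forall i v,
  chain_map b (i + 1) (chain_map u (i + 1) v)
    - chain_map u' (i + 1) (chain_map a (i + 1) v)
  = cdiff Y' i (s i v) + s (i + 1) (cdiff X (i + 1) v).

Definition cone_map_fun i : 'Hom(cone u i, cone u' i) :=
  dsum_pair (chain_map a (i + 1) \o dsum_fst _ _)%VF
    ((s i \o dsum_fst _ _) + (chain_map b i \o dsum_snd _ _))%VF.

Lemma cone_map_funE i v :
  cone_map_fun i v = (chain_map a (i + 1) v.1, s i v.1 + chain_map b i v.2).
Proof. by rewrite /cone_map_fun dsum_pairE !lfun_evalE !dsumE. Qed.

Lemma cone_map_subproof : @is_chain K A (cone u) (cone u') cone_map_fun.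
Proof.
apply: is_chainP => [i|i v].
  rewrite /cone_map_fun; rhom; exact: sP.
rewrite cone_map_funE [cdiff _ i _]cdiff_coneE [RHS]cone_map_funE.
rewrite [cdiff _ i v]cdiff_coneE /=.
case: v => x y /=.
have e := fun t => cone_map_arith t (sE x); congr (_, _); first by rewrite linearN chain_commE.
by rewrite linearD linearN linearD /= chain_commE e.
Qed.

Definition cone_map : chain (cone u) (cone u') := mk_chain cone_map_subproof.

Lemma cone_map_in : chain_comp cone_map (cone_in u) = chain_comp (cone_in u') b.
Proof.
apply: chain_eq => i v; rewrite !chain_compE !cone_inE [LHS]cone_map_funE /=.
by rewrite !linear0 add0r.
Qed.

Lemma cone_map_out :
  chain_comp (shift_chain a) (cone_out u) = chain_comp (cone_out u') cone_map.
Proof.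
apply: chain_eq => i v; rewrite !chain_compE !cone_outE shift_chainE.
by rewrite [chain_map cone_map _ _]cone_map_funE.
Qed.

End ConeMap.

Lemma per_tri_standard_morphism X Y X' Y' (u : chain X Y) (u' : chain X' Y')
    (a : hom (per A) X X') (b : hom (per A) Y Y') :
  b \oc [u] = [u'] \oc a ->
  exists c : hom (per A) (cone u) (cone u'),
    c \oc [cone_in u] = [cone_in u'] \oc b /\
    fmap (per_shift A) a \oc [cone_out u] = [cone_out u'] \oc c.
Proof.
have [a' ->] := per_classP a; have [b' ->] := per_classP b.
move=> E; have /per_class_homotopy[s [sP sE]] :
    per_class (chain_comp b' u) = per_class (chain_comp u' a').
  by rewrite -!per_compM.
have sE' i v : chain_map b' (i + 1) (chain_map u (i + 1) v)
    - chain_map u' (i + 1) (chain_map a' (i + 1) v)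
  = cdiff Y' i (s i v) + s (i + 1) (cdiff X (i + 1) v).
  by rewrite -sE !chain_compE.
exists [cone_map sP sE']; rewrite per_shiftE !per_compM; split; congr per_class.
  exact: cone_map_in.
exact: cone_map_out.
Qed.

Lemma per_tri_morphism X Y Z X' Y' Z'
    (f : hom (per A) X Y) (g : hom (per A) Y Z) (h : hom (per A) Z (per_shift A X))
    (f' : hom (per A) X' Y') (g' : hom (per A) Y' Z')
    (h' : hom (per A) Z' (per_shift A X'))
    (a : hom (per A) X X') (b : hom (per A) Y Y') :
  dist f g h -> dist f' g' h' -> b \oc f = f' \oc a ->
  exists c : hom (per A) Z Z',
    c \oc g = g' \oc b /\ fmap (per_shift A) a \oc h = h' \oc c.
Proof.
move=> [X0 [Y0 [u0 [a0 [b0 [c0 [[a0P b0P c0P] uE0 iE0 oE0]]]]]]].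
move=> [X1 [Y1 [u1 [a1 [b1 [c1 [[a1P b1P c1P] uE1 iE1 oE1]]]]]]] E.
have [|c [ci co]] := @per_tri_standard_morphism _ _ _ _ u0 u1
  (a1 \oc a \oc inv_hom a0) (b1 \oc b \oc inv_hom b0).
  apply: (iso_injr a0P); rewrite -!compA -uE0 inv_homK // inv_homl // compm1.
  by rewrite E !compA uE1.
exists (inv_hom c1 \oc c \oc c0); split.
  apply: (iso_injl c1P); rewrite -!compA inv_homVK // iE0 compA ci.
  by rewrite -!compA inv_homl // compm1 !compA iE1.
apply: (iso_injl (is_iso_fmap (per_shift A) a1P)).
rewrite !compA oE1 -!compA inv_homVK // (compA _ c) -co -!compA -oE0.
by rewrite !compA -!fmap_comp -!compA inv_homl // compm1.
Qed.

(** With the mapping cones of representatives u, v and v u, everything commutes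
    strictly except the square that identifies cone v with the cone of
    oct_fst; that square is checked on the inverse oct_out of oct_in. *)
Lemma per_tri_octahedron (X Y Z : per A) (f : hom (per A) X Y) (g : hom (per A) Y Z) :
  exists (Z' Y' X' : per A) (f1 : hom (per A) Y Z') (f2 : hom (per A) Z' (per_shift A X))
    (g1 : hom (per A) Z X') (g2 : hom (per A) X' (per_shift A Y))
    (h1 : hom (per A) Z Y') (h2 : hom (per A) Y' (per_shift A X))
    (u : hom (per A) Z' Y') (v : hom (per A) Y' X'),
  [/\ dist f f1 f2, dist g g1 g2, dist (g \oc f) h1 h2,
      dist u v (fmap (per_shift A) f1 \oc g2) &
      [/\ u \oc f1 = h1 \oc g, h2 \oc u = f2,
          v \oc h1 = g1 & g2 \oc v = fmap (per_shift A) f \oc h2]].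
Proof.
have [u ->] := per_classP f; have [v ->] := per_classP g.
rewrite per_compM; pose w := chain_comp v u.
exists (cone u), (cone w), (cone v), [cone_in u], [cone_out u],
  [cone_in v], [cone_out v], [cone_in w], [cone_out w], [oct_fst u v], [oct_snd u v].
split; [exact: per_standard|exact: per_standard|exact: per_standard| |].
  exists (cone u), (cone w), (oct_fst u v), (idm (cone u : per A)),
    (idm (cone w : per A)), [oct_in u v].
  have [rK Kr] := oct_inK u v; split; last 3 first.
  - by rewrite comp1m compm1.
  - have -> : [oct_snd u v] = [oct_out u v] \oc [cone_in (oct_fst u v)].
      rewrite per_compM; congr per_class; apply: chain_eq => i x.
      rewrite chain_compE cone_inE [RHS]oct_outE [LHS]oct_sndE /=.
      by rewrite add0r.
    by rewrite compA Kr comp1m compm1.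
  - rewrite fmap_id comp1m per_shiftE !per_compM; congr per_class.
    apply: chain_eq => i x; rewrite !chain_compE !cone_outE [chain_map _ _ x]oct_inE.
    by rewrite shift_chainE cone_inE.
  by split; [exact: is_iso_id|exact: is_iso_id|exists [oct_out u v]].
rewrite per_shiftE !per_compM; split; congr per_class; apply: chain_eq => i x.
- rewrite !chain_compE !cone_inE [LHS]oct_fstE /=; by [].
- by rewrite !chain_compE !cone_outE [chain_map _ _ x]oct_fstE.
- by rewrite !chain_compE !cone_inE [LHS]oct_sndE /= linear0.
by rewrite !chain_compE !cone_outE [chain_map _ _ x]oct_sndE.
Qed.

Lemma per_triangulated : is_triangulated (per_tri A).
Proof.
apply: triangulated_criterion.
- exact: shift_equivalence.
- exact: per_tri_iso.
- exact: per_has_zero.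
- move=> X Z Z0; exists X, X, (chain_id X), (idm X), (idm X), 0.
  split; last 3 first.
  + by rewrite comp1m.
  + by rewrite comp0m compm1 (hom_to_zero [cone_in _] (cone_id_contractible X)).
  + by rewrite !compm0.
  split; [exact: is_iso_id|exact: is_iso_id|].
  by apply: is_iso_zero => //; apply: cone_id_contractible.
- move=> X Y f; have [u ->] := per_classP f.
  by exists (cone u), [cone_in u], [cone_out u]; apply: per_standard.
- exact: per_tri_rotate.
- exact: per_tri_morphism.
- exact: per_has_biproducts.
exact: per_tri_octahedron.
Qed.

End PerTriangulated.

(** * Idempotents split up to homotopy *)

Section Fitting.
Variables (K : fieldType) (V : vectType K) (g : 'End(V)).

Let U k : {vspace V} := iter k (fun W => (g @: W)%VS) fullv.

Let U_sub k : (U k.+1 <= U k)%VS.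
Proof. by elim: k => [|k IH]; [apply: subvf | apply: limgS]. Qed.

Let U_stable k : (\dim {:V} <= k)%N -> U k.+1 = U k.
Proof.
have H j : U j.+1 = U j \/ (\dim (U j.+1) + j < \dim {:V})%N.
  have dU m : U m.+1 = U m \/ (\dim (U m.+1) < \dim (U m))%N.
    have [/eqP e|ne] := boolP (\dim (U m.+1) == \dim (U m)); [left|right].
      by apply/eqP; rewrite eqEdim U_sub e leqnn.
    by rewrite ltn_neqAle ne dimvS.
  elim: j => [|j [IH|IH]]; first by case: (dU 0%N) => ?; [left|right; rewrite addn0].
    by left; apply: (congr1 (fun W => (g @: W)%VS) IH).
  by case: (dU j.+1) => ?; [left|right; lia].
by move=> Vk; case: (H k) => // ?; lia.
Qed.

(** Half of the Fitting lemma: for k at least the dimension, the kernel and the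
    image of the k-th iterate meet trivially. The images of the iterates
    decrease, and they are constant from the first time that two consecutive
    ones agree, which happens before their dimension is exhausted. *)
Lemma fitting_iter k v : (\dim {:V} <= k)%N ->
  iter k g (iter k g v) = 0 -> iter k g v = 0.
Proof.
move=> Vk; have inU m : iter m g v \in U m.
  by elim: m => [|m IH] /=; [apply: memvf | apply: memv_img].
have Uk := U_stable Vk.
have injU : (U k :&: lker g = 0)%VS.
  apply/eqP; rewrite -dimv_eq0; have := limg_ker_dim g (U k).
  by rewrite -[(g @: U k)%VS]/(U k.+1) Uk; lia.
have inj : forall m w, w \in U k -> iter m g w = 0 -> w = 0; last exact: inj (inU k).
elim=> // m IH w wU.
rewrite iterSr => /IH gw0.
have /gw0 gw : g w \in U k by rewrite -Uk memv_img.
by apply/eqP; rewrite -memv0 -injU memv_cap wU memv_ker gw eqxx.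
Qed.

End Fitting.

Section Submodule.
Variables (K : fieldType) (A : falgType K) (M : rmod A) (U : {vspace M}).
Hypothesis stabU : forall v a, v \in U -> rmod_act M v a \in U.

Definition sub_act (v : subvs_of U) (a : A) : subvs_of U :=
  Subvs (stabU a (subvsP v)).

Lemma sub_linearl a : linear (sub_act^~ a).
Proof. by move=> c v w; apply: val_inj; apply: ract_linearl. Qed.
Lemma sub_linearr v : linear (sub_act v).
Proof. by move=> c a b; apply: val_inj; apply: ract_linearr. Qed.
Lemma sub_ract1 v : sub_act v 1 = v.
Proof. by apply: val_inj; apply: ract1. Qed.
Lemma sub_ractM v a b : sub_act v (a * b) = sub_act (sub_act v a) b.
Proof. by apply: val_inj; apply: ractM. Qed.

Definition submod : rmod A :=
  @RMod K A (subvs_of U) (RAction sub_linearl sub_linearr sub_ract1 sub_ractM).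

Definition sub_incl : 'Hom(submod, M) := linfun (vsval : submod -> M).

Lemma sub_inclE v : sub_incl v = vsval v. Proof. exact: lfunE. Qed.

Lemma sub_incl_rhom : is_rhom sub_incl.
Proof. by move=> v a; rewrite !sub_inclE. Qed.

Definition sub_corestr (N : rmod A) (f : 'Hom(N, M)) : 'Hom(N, submod) :=
  (linfun (vsproj U : M -> submod) \o f)%VF.

Lemma sub_corestrE (N : rmod A) (f : 'Hom(N, M)) v :
  f v \in U -> vsval (sub_corestr f v) = f v.
Proof. by move=> fv; rewrite comp_lfunE lfunE /= vsprojK. Qed.

Lemma sub_corestr_rhom (N : rmod A) (f : 'Hom(N, M)) :
  (forall v, f v \in U) -> is_rhom f -> is_rhom (sub_corestr f).
Proof. by move=> fU fP v a; apply: val_inj; rewrite /= !sub_corestrE. Qed.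

End Submodule.

Section PerIdempotents.
Variables (K : fieldType) (A : falgType K).
Implicit Types X Y : cpx A.

Lemma cpx_dim_bound X : exists n, forall i, (\dim {:X i} <= n)%N.
Proof.
have [N NP] := cbound X.
have H m : exists n, forall i : int, (`|i| <= m)%N -> (\dim {:X i} <= n)%N.
  elim: m => [|m [n IH]].
    by exists (\dim {:X 0}) => i; rewrite leqn0 absz_eq0 => /eqP ->.
  exists (n + \dim {:X m.+1%:Z} + \dim {:X (- m.+1%:Z)})%N => i im.
  have [im'|im'] := leqP `|i| m; first by have := IH i im'; lia.
  have [->|->] : i = m.+1%:Z \/ i = - m.+1%:Z by lia.
    by lia.
  by lia.
have [n nP] := H N; exists n => i; have [/nP //|/NP X0] := leqP `|i| N.
by rewrite (_ : {:X i}%VS = 0%VS) ?dimv0 //; apply/eqP; rewrite -subv0;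
  apply/subvP => v _; rewrite (X0 v) mem0v.
Qed.

Definition chain_pow X (f : chain X X) n : chain X X :=
  iter n (chain_comp f) (chain_id X).

Lemma chain_powE X (f : chain X X) n i v :
  chain_map (chain_pow f n) i v = iter n (chain_map f i) v.
Proof. by elim: n => [|n IH] /=; rewrite ?id_lfunE // chain_compE IH. Qed.

Lemma per_class_pow X (f : chain X X) n :
  let e : hom (per A) X X := per_class f in
  e \oc e = e -> per_class (chain_pow f n.+1) = e.
Proof.
move=> e ee; elim: n => [|n IH].
  by congr per_class; apply: chainP => i; apply: comp_lfun1r.
by rewrite -[chain_pow f _]/(chain_comp f (chain_pow f n.+1)) -per_compM IH.
Qed.

(** The image of an endomorphism p of a complex whose square has the same
    kernel. On the image, p is bijective, so the image is degreewise a direct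
    summand, hence again a complex of projectives. *)
Section Image.
Variables (X : cpx A) (p : chain X X).
Hypothesis pI : forall i v, chain_map p i (chain_map p i v) = 0 -> chain_map p i v = 0.

Let U i : {vspace X i} := limg (chain_map p i).

Let pU i v : chain_map p i v \in U i. Proof. by apply: memv_img; apply: memvf. Qed.

Lemma image_stable i v a : v \in U i -> rmod_act (X i) v a \in U i.
Proof. by move=> /memv_imgP[w _ ->]; rewrite -(chain_rhom p i); apply: pU. Qed.

Definition im_mod i : rmod A := submod (@image_stable i).

Definition im_incl i : 'Hom(im_mod i, X i) := sub_incl (@image_stable i).
Definition im_proj i : 'Hom(X i, im_mod i) :=
  sub_corestr (@image_stable i) (chain_map p i).

Lemma im_inclK i v : im_incl i (im_proj i v) = chain_map p i v.
Proof. by rewrite sub_inclE sub_corestrE. Qed.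

Lemma im_incl_inj i : injective (im_incl i).
Proof. by move=> v w; rewrite !sub_inclE; apply: val_inj. Qed.

(** The restriction of p to its image. *)
Definition im_endo i : 'End(im_mod i) := (im_proj i \o im_incl i)%VF.

Lemma im_endoE i v : im_incl i (im_endo i v) = chain_map p i (im_incl i v).
Proof. by rewrite comp_lfunE im_inclK. Qed.

Lemma im_endo_ker i : lker (im_endo i) == 0%VS.
Proof.
apply/lker0P => v w /eqP; rewrite -subr_eq0 -linearB /= => /eqP vw.
apply/eqP; rewrite -subr_eq0; apply/eqP; apply: (@im_incl_inj i).
have := im_endoE (v - w); rewrite vw linear0.
have /memv_imgP[x _] : im_incl i (v - w) \in U i by rewrite sub_inclE subvsP.
by move=> -> /esym/pI.
Qed.

Let endoK i v : (im_endo i)^-1%VF (im_endo i v) = v.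
Proof. exact: (lker0_lfunK (im_endo_ker i)). Qed.
Let endoVK i v : im_endo i ((im_endo i)^-1%VF v) = v.
Proof. exact: (lker0_lfunVK (im_endo_ker i)). Qed.

Lemma im_incl_rhom i : is_rhom (im_incl i). Proof. exact: sub_incl_rhom. Qed.
Lemma im_proj_rhom i : is_rhom (im_proj i).
Proof. by apply: sub_corestr_rhom => //; apply: chain_rhom. Qed.

Lemma im_inv_rhom i : is_rhom ((im_endo i)^-1)%VF.
Proof.
have endoP : is_rhom (im_endo i) := rhom_comp (@im_proj_rhom i) (@im_incl_rhom i).
by move=> v a; rewrite -[in LHS](endoVK v) -endoP endoK.
Qed.

Lemma im_projective i : projective (im_mod i).
Proof.
apply: (projective_retract (i := im_incl i) (p := ((im_endo i)^-1 \o im_proj i)%VF)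
  _ _ _ (cproj X i)).
- exact: im_incl_rhom.
- exact: rhom_comp (@im_inv_rhom i) (@im_proj_rhom i).
by apply/lfunP => v; rewrite -comp_lfunA comp_lfunE id_lfunE; apply: endoK.
Qed.

Definition im_diff i : 'Hom(im_mod i, im_mod (i + 1)) :=
  sub_corestr (@image_stable (i + 1)) (cdiff X i \o im_incl i)%VF.

Lemma im_diff_in i v : (cdiff X i \o im_incl i)%VF v \in U (i + 1).
Proof.
rewrite comp_lfunE; have /memv_imgP[x _ ->] : im_incl i v \in U i.
  by rewrite sub_inclE subvsP.
by rewrite chain_commE.
Qed.

Lemma im_diffE i v : im_incl (i + 1) (im_diff i v) = cdiff X i (im_incl i v).
Proof. by rewrite sub_inclE sub_corestrE ?im_diff_in // comp_lfunE. Qed.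

Lemma im_diff_rhom i : is_rhom (im_diff i).
Proof.
apply: sub_corestr_rhom; first exact: im_diff_in.
exact: rhom_comp (cdiff_rhom X i) (@im_incl_rhom i).
Qed.

Lemma im_diff2 i : (im_diff (i + 1) \o im_diff i = 0)%VF.
Proof.
apply/lfunP => v; rewrite comp_lfunE zero_lfunE; apply: (@im_incl_inj (i + 1 + 1)).
by rewrite !im_diffE cdiff2E linear0.
Qed.

Lemma im_bound : exists n : nat, forall i : int,
  (n < `|i|)%N -> forall v : im_mod i, v = 0.
Proof.
have [n nP] := cbound X; exists n => i ni v; apply: (@im_incl_inj i).
by rewrite linear0 (nP i ni (im_incl i v)).
Qed.

Definition im_cpx : cpx A :=
  Cpx im_diff_rhom im_diff2 im_projective im_bound.

Lemma im_incl_subproof : @is_chain K A im_cpx X im_incl.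
Proof.
by apply: is_chainP => [i|i v]; [apply: im_incl_rhom | rewrite [RHS]im_diffE].
Qed.

Lemma im_proj_subproof : @is_chain K A X im_cpx im_proj.
Proof.
apply: is_chainP => [i|i v]; first exact: im_proj_rhom.
apply: (@im_incl_inj (i + 1)); rewrite [LHS]im_diffE !im_inclK.
by rewrite chain_commE.
Qed.

Lemma im_iso :
  is_iso (per_class (chain_comp (mk_chain im_proj_subproof)
                       (mk_chain im_incl_subproof)) : hom (per A) im_cpx im_cpx).
Proof.
apply: (@chain_iso K A im_cpx im_cpx _ (fun i => (im_endo i)^-1)%VF) => i v.
  exact: endoK.
exact: endoVK.
Qed.

End Image.

(** Let f represent an idempotent class e. A high power p of f also represents
    e, and by Fitting it is bijective on its image. This gives morphisms P and
    I through the image with I P = e and P I invertible; then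
    P I P I P I = P e e I = P e I = P I P I forces P I = 1. *)
Lemma per_idempotents_split : idempotents_split (per A).
Proof.
move=> X e; have [f fE] := per_classP e => ee.
have [n nP] := cpx_dim_bound X.
pose p := chain_pow f n.+1.
have pI i v : chain_map p i (chain_map p i v) = 0 -> chain_map p i v = 0.
  by rewrite !chain_powE; apply: fitting_iter; apply: leqW (nP i).
pose P : hom (per A) X (im_cpx pI) := per_class (mk_chain (im_proj_subproof pI)).
pose I : hom (per A) (im_cpx pI) X := per_class (mk_chain (im_incl_subproof pI)).
have IP : I \oc P = e.
  rewrite fE in ee *; rewrite per_compM -(per_class_pow n ee); congr per_class.
  by apply: chain_eq => i v; rewrite chain_compE [LHS]im_inclK.
exists (im_cpx pI), I, P; split=> //.
have PIP : is_iso (P \oc I) by rewrite per_compM; apply: im_iso.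
apply: (iso_injl PIP); apply: (iso_injl PIP).
by rewrite compm1 -!compA !(compA I P) IP (compA e) ee.
Qed.

End PerIdempotents.

(** * Induction and restriction of modules *)

Lemma linfunE (K : fieldType) (V W : vectType K) (f : V -> W) :
  linear f -> forall v, linfun f v = f v.
Proof.
move=> fL v; pose L := GRing.isLinear.Build K V W _ f fL.
pose g : {linear V -> W} := HB.pack f L; exact: (lfunE g v).
Qed.

Section ActionSums.
Variables (K : fieldType) (A : falgType K) (M : rmod A).

Lemma ractDr (v : M) a b :
  rmod_act M v (a + b) = rmod_act M v a + rmod_act M v b.
Proof. by have := ract_linearr (rmod_act M) v 1 a b; rewrite !scale1r. Qed.

Lemma ract0r (v : M) : rmod_act M v 0 = 0.
Proof. by apply: (@addrI _ (rmod_act M v 0)); rewrite -ractDr !addr0. Qed.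

Lemma ract_suml I (r : seq I) (F : I -> M) a :
  rmod_act M (\sum_(i <- r) F i) a = \sum_(i <- r) rmod_act M (F i) a.
Proof. by elim/big_rec2: _ => [|i x y _ <-]; rewrite ?ract0l ?ractDl. Qed.

Lemma ract_sumr I (r : seq I) (v : M) (F : I -> A) :
  rmod_act M v (\sum_(i <- r) F i) = \sum_(i <- r) rmod_act M v (F i).
Proof. by elim/big_rec2: _ => [|i x y _ <-]; rewrite ?ract0r ?ractDr. Qed.

End ActionSums.

Section SkewModules.
Variables (K : fieldType) (gT : finGroupType) (A : falgType K).
Variable S : alg_action gT A.

Local Notation B := (skew_alg S).

(** The elements a (x) 1 and 1 (x) g, which generate the skew-group algebra. *)
Definition skew_inj (a : A) : B := stens S a 1%g.
Definition skew_grp (g : gT) : B := stens S 1 g.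

Local Notation iota := skew_inj.
Local Notation sigma := skew_grp.

Lemma skew_injM a b : iota (a * b) = iota a * iota b.
Proof. by rewrite /iota skew_algE aact1 mulg1. Qed.

Lemma skew_inj_linear : linear iota.
Proof. exact: stens_linear. Qed.

Lemma skew_grpM g h : sigma (g * h)%g = sigma g * sigma h.
Proof. by rewrite /sigma skew_algE rmorph1 mulr1. Qed.

Lemma skew_grp1 : sigma 1%g = 1. Proof. by []. Qed.

Lemma skew_grp_inj g a : sigma g * iota a = iota (S g a) * sigma g.
Proof. by rewrite /iota /sigma !skew_algE mul1r mulg1 mul1g aact1 mulr1. Qed.

Lemma skew_sum (b : B) : b = \sum_g iota (b g) * sigma g.
Proof.
rewrite [LHS]stens_sum; apply: eq_bigr => g _.
by rewrite /iota /sigma skew_algE rmorph1 mulr1 mul1g.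
Qed.

Lemma skew_mulE (b c : B) k :
  (b * c) k = \sum_h b h * S h (c (h^-1 * k)%g).
Proof.
rewrite -[b * c]/(skew_mul b c) /skew_mul sum_ffunE; apply: eq_bigr => h _.
rewrite sum_ffunE (bigD1 (h^-1 * k)%g) //= ffunE mulKVg eqxx big1 ?addr0 //.
move=> l lk; rewrite ffunE; case: eqP => // e; case/eqP: lk.
by rewrite e mulKg.
Qed.

Lemma rhom_skew (M N : rmod B) (f : 'Hom(M, N)) :
  (forall v a, f (rmod_act M v (iota a)) = rmod_act N (f v) (iota a)) ->
  (forall v g, f (rmod_act M v (sigma g)) = rmod_act N (f v) (sigma g)) ->
  is_rhom f.
Proof.
move=> fi fs v b; rewrite [b]skew_sum !ract_sumr linear_sum.
by apply: eq_bigr => g _; rewrite /= !ractM fs fi.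
Qed.

Section Restriction.
Variable N : rmod B.

Definition res_act (v : N) (a : A) : N := rmod_act N v (iota a).

Lemma res_linearl a : linear (res_act^~ a).
Proof. by move=> c v w; apply: ract_linearl. Qed.
Lemma res_linearr v : linear (res_act v).
Proof. by move=> c a b; rewrite /res_act skew_inj_linear ract_linearr. Qed.
Lemma res_act1 v : res_act v 1 = v.
Proof. exact: ract1. Qed.
Lemma res_actM v a b : res_act v (a * b) = res_act (res_act v a) b.
Proof. by rewrite /res_act skew_injM ractM. Qed.

Definition res_mod : rmod A :=
  RMod (RAction res_linearl res_linearr res_act1 res_actM).

End Restriction.

Lemma res_rhom (M N : rmod B) (f : 'Hom(M, N)) :
  is_rhom f -> @is_rhom K A (res_mod M) (res_mod N) f.
Proof. by move=> fP v a; apply: fP. Qed.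

Section Induction.
Variable M : rmod A.

(** The induced module of M is its tensor product with the skew-group algebra
    over A. As the latter is free over A on the elements 1 (x) g, the sum of
    the m_g (x) g is encoded as the function g |-> m_g; the formula is forced by
    (m (x) g)(a (x) h) = m g(a) (x) g h. *)
Definition ind_act (x : {ffun gT -> M}) (b : B) : {ffun gT -> M} :=
  [ffun k => \sum_g rmod_act M (x g) (S g (b (g^-1 * k)%g))].

Lemma ind_linearl b : linear (ind_act^~ b).
Proof.
move=> c x y; apply/ffunP => k; rewrite !ffunE scaler_sumr -big_split /=.
by apply: eq_bigr => g _; rewrite !ffunE ract_linearl.
Qed.

Lemma ind_linearr x : linear (ind_act x).
Proof.
move=> c a b; apply/ffunP => k; rewrite !ffunE scaler_sumr -big_split /=.
by apply: eq_bigr => g _; rewrite !ffunE linearP ract_linearr.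
Qed.

Lemma ind_act_inj x a k : ind_act x (iota a) k = rmod_act M (x k) (S k a).
Proof.
rewrite ffunE (bigD1 k) //= ffunE mulVg eqxx big1 ?addr0 // => g gk.
rewrite ffunE; case: eqP => e; last by rewrite linear0 ract0r.
by case/eqP: gk; rewrite -[k](mulKVg g) e mulg1.
Qed.

Lemma ind_act_grp x h k : ind_act x (sigma h) k = x (k * h^-1)%g.
Proof.
rewrite ffunE (bigD1 (k * h^-1)%g) //= ffunE invMg invgK mulgKV eqxx.
rewrite rmorph1 ract1 big1 ?addr0 // => g gk.
rewrite ffunE; case: eqP => e; last by rewrite linear0 ract0r.
by case/eqP: gk; rewrite -e invMg invgK mulKVg.
Qed.

Lemma ind_act1 x : ind_act x 1 = x.
Proof. by apply/ffunP => k; rewrite -skew_grp1 ind_act_grp invg1 mulg1. Qed.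

Lemma ind_actM x b c : ind_act x (b * c) = ind_act (ind_act x b) c.
Proof.
apply/ffunP => k; rewrite !ffunE.
under [RHS]eq_bigr => h _ do rewrite ffunE ract_suml.
rewrite exchange_big /=; apply: eq_bigr => g _.
rewrite skew_mulE linear_sum ract_sumr (reindex_inj (mulgI g^-1%g)) /=.
apply: eq_bigr => h _; rewrite /= rmorphM ractM /= -aactM.
by rewrite mulKVg invMg invgK -mulgA mulKVg.
Qed.

Definition ind_mod : rmod B := @RMod K B {ffun gT -> M}
  (RAction ind_linearl ind_linearr ind_act1 ind_actM).

Definition ind_coef (g : gT) : 'Hom(ind_mod, M) :=
  linfun (fun x : ind_mod => x g : M).
(** The map m |-> m (x) 1. *)
Definition ind_unit : 'Hom(M, ind_mod) :=
  linfun (fun m : M => [ffun k => if k == 1%g then m else 0] : ind_mod).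

Lemma ind_coefE g x : ind_coef g x = x g.
Proof. by apply: linfunE => c y z; rewrite !ffunE. Qed.

Lemma ind_unitE m k : ind_unit m k = if k == 1%g then m else 0.
Proof.
rewrite linfunE ?ffunE // => c y z; apply/ffunP => l; rewrite !ffunE.
by case: eqP => // _; rewrite scaler0 addr0.
Qed.

Lemma ind_unit_rhom : @is_rhom K A M (res_mod ind_mod) ind_unit.
Proof.
move=> m a; apply/ffunP => k; rewrite [RHS]ind_act_inj !ind_unitE.
by case: eqP => [->|]; rewrite ?aact1 ?ract0l.
Qed.

Lemma ind_gen (x : ind_mod) :
  x = \sum_g rmod_act ind_mod (ind_unit (x g)) (sigma g).
Proof.
apply/ffunP => k; rewrite sum_ffunE (bigD1 k) //= ind_act_grp mulgV ind_unitE eqxx.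
rewrite big1 ?addr0 // => g gk; rewrite ind_act_grp ind_unitE.
case: eqP => // e; case/eqP: gk.
by rewrite -[g]mul1g -e mulgKV.
Qed.

End Induction.

(** The bijection between Hom(ind M, ind N) and the sum over g of Hom(gM, N): a
    morphism f : gM -> N corresponds to m (x) k |-> f m (x) g k, and conversely a
    morphism u has the component m |-> u(m (x) 1)_g at g. *)
Section Tensor.
Variables (M N : rmod A) (g : gT).

Definition ind_hom (f : 'Hom(M, N)) : 'Hom(ind_mod M, ind_mod N) :=
  linfun (fun x : ind_mod M => [ffun k => f (x (g^-1 * k)%g)] : ind_mod N).

Lemma ind_homE f x k : ind_hom f x k = f (x (g^-1 * k)%g).
Proof.
rewrite linfunE ?ffunE // => c y z; apply/ffunP => l; rewrite !ffunE.
by rewrite linearP.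
Qed.

Lemma ind_hom_rhom (f : 'Hom(M, N)) :
  @is_rhom K A (twist_mod S g M) N f -> is_rhom (ind_hom f).
Proof.
move=> fP; apply: rhom_skew => [x a|x h]; apply/ffunP => k.
  rewrite ind_homE !ind_act_inj ind_homE.
  by rewrite -fP /= /twist_fun aactM.
rewrite ind_homE !ind_act_grp ind_homE.
by rewrite mulgA.
Qed.

Definition ind_comp (u : 'Hom(ind_mod M, ind_mod N)) : 'Hom(M, N) :=
  (ind_coef N g \o (u \o ind_unit M))%VF.

Lemma ind_compE u m : ind_comp u m = u (ind_unit M m) g.
Proof. by rewrite !comp_lfunE ind_coefE. Qed.

Lemma ind_comp_rhom u :
  is_rhom u -> @is_rhom K A (twist_mod S g M) N (ind_comp u).
Proof.
move=> uP m a; rewrite !ind_compE ind_unit_rhom uP.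
by rewrite [LHS]ind_act_inj -aactM mulgV aact1.
Qed.

End Tensor.

(** A morphism u is determined by its values on the generators m (x) 1. *)
Lemma ind_comp_sum (M N : rmod A) (u : 'Hom(ind_mod M, ind_mod N)) x :
  is_rhom u -> u x = \sum_g ind_hom g (ind_comp g u) x.
Proof.
move=> uP; apply/ffunP => k; rewrite sum_ffunE.
rewrite {1}[x]ind_gen linear_sum sum_ffunE.
rewrite (reindex_inj (mulIg k)) (reindex_inj invg_inj) /=.
apply: eq_bigr => g _; rewrite ind_homE ind_compE uP ind_act_grp.
by rewrite invMg invgK mulKVg.
Qed.

(** Induction is adjoint to restriction on both sides, because the group is
    finite; each adjunction carries projectivity in one direction. *)
Section Adjunctions.
Variables (M : rmod A) (N : rmod B).

Definition ind_transpose (f : 'Hom(M, N)) : 'Hom(ind_mod M, N) :=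
  linfun (fun x : ind_mod M => \sum_g rmod_act N (f (x g)) (sigma g)).

Lemma ind_transposeE f x :
  ind_transpose f x = \sum_g rmod_act N (f (x g)) (sigma g).
Proof.
rewrite linfunE // => c y z; rewrite scaler_sumr -big_split /=.
by apply: eq_bigr => g _; rewrite !ffunE linearP ract_linearl.
Qed.

Lemma ind_transpose_rhom (f : 'Hom(M, N)) :
  @is_rhom K A M (res_mod N) f -> is_rhom (ind_transpose f).
Proof.
move=> fP; apply: rhom_skew => [x a|x h]; rewrite !ind_transposeE ract_suml.
  apply: eq_bigr => g _; rewrite ind_act_inj fP /= /res_act.
  by rewrite -!ractM skew_grp_inj.
rewrite (reindex_inj (mulIg h)) /=; apply: eq_bigr => g _.
by rewrite ind_act_grp mulgK skew_grpM ractM.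
Qed.

Definition coind_transpose (f : 'Hom(N, M)) : 'Hom(N, ind_mod M) :=
  linfun (fun v : N => [ffun k => f (rmod_act N v (sigma k^-1%g))] : ind_mod M).

Lemma coind_transposeE f v k :
  coind_transpose f v k = f (rmod_act N v (sigma k^-1%g)).
Proof.
rewrite linfunE ?ffunE // => c y z; apply/ffunP => l; rewrite !ffunE.
by rewrite ract_linearl linearP.
Qed.

Lemma coind_transpose_rhom (f : 'Hom(N, M)) :
  @is_rhom K A (res_mod N) M f -> is_rhom (coind_transpose f).
Proof.
move=> fP; apply: rhom_skew => [v a|v h]; apply/ffunP => k.
  rewrite ind_act_inj !coind_transposeE -fP /= /res_act -!ractM.
  by rewrite skew_grp_inj -aactM mulVg aact1.
by rewrite ind_act_grp !coind_transposeE -ractM -skew_grpM invMg invgK.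
Qed.

End Adjunctions.

(** Lift on the generators m (x) 1, then extend by the left adjunction. *)
Lemma ind_projective (P : rmod A) : projective P -> projective (ind_mod P).
Proof.
move=> projP M N p f pP fP pS.
have [h hP hE] := projP (res_mod M) (res_mod N) p (f \o ind_unit P)%VF
  (res_rhom pP) (rhom_comp (res_rhom fP) (@ind_unit_rhom P)) pS.
exists (ind_transpose h); first exact: ind_transpose_rhom.
apply/lfunP => x; rewrite comp_lfunE ind_transposeE linear_sum [in RHS](ind_gen x).
rewrite linear_sum; apply: eq_bigr => g _; rewrite /= pP fP.
by rewrite -(comp_lfunE p) hE comp_lfunE.
Qed.

(** A lifting problem for the restriction of P is, by the right adjunction, a
    lifting problem for P itself against the induced surjection. *)
Lemma res_projective (P : rmod B) : projective P -> projective (res_mod P).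
Proof.
move=> projP M N p f pP fP pS.
have p1P : @is_rhom K A (twist_mod S 1%g M) N p.
  by move=> v a; rewrite -pP /= /twist_fun invg1 aact1.
have [|H HP HE] := projP _ _ (ind_hom 1%g p) (coind_transpose f)
  (ind_hom_rhom p1P) (coind_transpose_rhom fP).
  move=> y; have [x xE] := choice (fun k => pS (y k)).
  exists [ffun k => x k : M]; apply/ffunP => k.
  by rewrite ind_homE ffunE invg1 mul1g xE.
exists (ind_coef M 1%g \o H)%VF.
  move=> v a; rewrite !comp_lfunE !ind_coefE HP.
  by rewrite ind_act_inj aact1.
apply/lfunP => v; rewrite !comp_lfunE ind_coefE.
have := congr1 (fun h : 'Hom(_, _) => (h v : {ffun gT -> N}) 1%g) HE.
rewrite /= comp_lfunE ind_homE coind_transposeE invg1 mul1g => ->.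
by rewrite ract1.
Qed.

End SkewModules.

(** * Induction as a functor on the skew-group category *)

Section SkewComplexes.
Variables (K : fieldType) (gT : finGroupType) (A : falgType K).
Variable S : alg_action gT A.

Local Notation B := (skew_alg S).
Local Notation ind := (ind_mod S).
Local Notation "[ f ]" := (per_class f : hom (per B) _ _).

Lemma twist1_rhom (M N : rmod A) (f : 'Hom(M, N)) :
  is_rhom f -> @is_rhom K A (twist_mod S 1%g M) N f.
Proof. by move=> fP v a; rewrite -fP /= /twist_fun invg1 aact1. Qed.

Section InducedComplex.
Variable X : cpx A.

Definition ind_diff i : 'Hom(ind (X i), ind (X (i + 1))) :=
  ind_hom S 1%g (cdiff X i).

Lemma ind_diffE i x k : ind_diff i x k = cdiff X i (x k).
Proof. by rewrite ind_homE invg1 mul1g. Qed.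

Lemma ind_diff_rhom i : is_rhom (ind_diff i).
Proof. by apply: ind_hom_rhom; apply: twist1_rhom; apply: cdiff_rhom. Qed.

Lemma ind_diff2 i : (ind_diff (i + 1) \o ind_diff i = 0)%VF.
Proof.
apply/lfunP => x; rewrite comp_lfunE zero_lfunE; apply/ffunP => k.
by rewrite !ind_diffE cdiff2E ffunE.
Qed.

Lemma ind_bound : exists n : nat, forall i : int,
  (n < `|i|)%N -> forall x : ind (X i), x = 0.
Proof.
have [n nP] := cbound X; exists n => i ni x; apply/ffunP => k.
by rewrite [LHS](nP i ni) ffunE.
Qed.

Definition ind_cpx : cpx B :=
  Cpx ind_diff_rhom ind_diff2 (fun i => @ind_projective _ _ _ S _ (cproj X i))
    ind_bound.

Lemma cdiff_indE i (x : ind (X i)) k : cdiff ind_cpx i x k = cdiff X i (x k).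
Proof. exact: ind_diffE. Qed.

Lemma ind_diff_unit i m :
  cdiff ind_cpx i (ind_unit S (X i) m) = ind_unit S (X (i + 1)) (cdiff X i m).
Proof.
apply/ffunP => k; rewrite cdiff_indE !ind_unitE.
by case: eqP => // _; rewrite linear0.
Qed.

End InducedComplex.

Section InducedChain.
Variables (g : gT) (X Y : cpx A).

Lemma ind_chain_subproof (f : chain (twist_cpx S g X) Y) :
  @is_chain K B (ind_cpx X) (ind_cpx Y)
    (fun i => @ind_hom K gT A S (X i) (Y i) g (chain_map f i)).
Proof.
apply: is_chainP => [i|i x]; first by apply: ind_hom_rhom; apply: (chain_rhom f i).
apply/ffunP => k; rewrite [LHS]cdiff_indE !ind_homE (chain_commE f).
by rewrite invg1 mul1g.
Qed.

(** The twist does not change underlying spaces, so a chain map gX -> Y acts by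
    the same formula as in each degree. *)
Definition ind_chain (f : chain (twist_cpx S g X) Y) :
  chain (ind_cpx X) (ind_cpx Y) := mk_chain (ind_chain_subproof f).

Lemma ind_chainE f i (x : ind (X i)) k :
  chain_map (ind_chain f) i x k = chain_map f i (x (g^-1 * k)%g).
Proof. exact: ind_homE. Qed.

Lemma ind_chain_linear : linear ind_chain.
Proof.
move=> c f h; apply: chain_eq => i x; apply/ffunP => k.
by rewrite chain_mapD chain_mapZ !ffunE !ind_chainE chain_mapD chain_mapZ.
Qed.

Lemma ind_chainB f h : ind_chain (f - h) = ind_chain f - ind_chain h.
Proof. by have := ind_chain_linear (-1) h f; rewrite !scaleN1r ![- _ + _]addrC. Qed.

Lemma ind_chain_eq0 f :
  per_class f = 0 -> per_class (ind_chain f) = 0.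
Proof.
move=> /per_class_homotopy0[s [sP sE]].
apply: (@per_class_eq0 K B (ind_cpx X) (ind_cpx Y) _
  (fun i => @ind_hom K gT A S (X (i + 1)) (Y i) g (s i))).
  by move=> i; apply: ind_hom_rhom; apply: (sP i).
move=> i x; apply/ffunP => k.
rewrite [LHS]ind_chainE [LHS]sE ffunE [in RHS]cdiff_indE !ind_homE.
by rewrite invg1 mul1g.
Qed.

Definition ind_map (a : hom (per A) (twist S g X) Y) :
  hom (per B) (ind_cpx X) (ind_cpx Y) := per_class (ind_chain (lrepr a)).

Lemma ind_mapE (f : chain (twist_cpx S g X) Y) :
  ind_map (per_class f) = per_class (ind_chain f).
Proof.
apply/eqP; rewrite -subr_eq0 -per_classN -per_classD -ind_chainB; apply/eqP.
apply: ind_chain_eq0; rewrite per_classD per_classN /per_class lreprK.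
exact: subrr.
Qed.

Lemma ind_map_linear : linear ind_map.
Proof.
move=> c f h; have [f' ->] := per_classP f; have [h' ->] := per_classP h.
rewrite -[X in ind_map X]per_class_linear !ind_mapE ind_chain_linear.
exact: per_class_linear.
Qed.

Lemma ind_map0 : ind_map 0 = 0.
Proof. by have := ind_map_linear (-1) 0 0; rewrite scaler0 addr0 scaleN1r addNr. Qed.

End InducedChain.

(** The equalities of objects in the strict action are identities on the
    underlying spaces. *)
Lemma eq_hom_twist1 (X : per A) (e : twist S 1%g X = X) :
  exists2 f : chain (twist_cpx S 1%g X) X,
    eq_hom e = per_class f & forall i v, chain_map f i v = v.
Proof.
move: X e; apply: cpx_case => V r d p1 p2 p3 p4 e.
have [f ef fE] := eq_hom_cpx e (fun i => twist_ract1 S (r i)).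
by exists f => // i v; rewrite [chain_map f i]fE id_lfunE.
Qed.

Lemma eq_hom_twistM g h (X : per A)
    (e : twist S (g * h)%g X = twist S g (twist S h X)) :
  exists2 f : chain (twist_cpx S (g * h)%g X) (twist_cpx S g (twist_cpx S h X)),
    eq_hom e = per_class f & forall i v, chain_map f i v = v.
Proof.
have [f ef fE] := eq_hom_cpx e (fun i => twist_ractM S g h (rmod_act (X i))).
by exists f => // i v; rewrite [chain_map f i]fE id_lfunE.
Qed.

Local Notation skew := (skew_cat (per_action S)).

(** The morphism f (x) g goes to m (x) k |-> f m (x) g k, which turns the
    composition rule of the skew-group category into plain composition. *)
Definition skew_ind_map (X Y : skew) (f : hom skew X Y) :
    hom (per B) (ind_cpx X) (ind_cpx Y) :=
  \sum_g ind_map (f g).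

Lemma skew_ind_linear X Y : linear (@skew_ind_map X Y).
Proof.
move=> c f h; rewrite /skew_ind_map scaler_sumr -big_split /=.
by apply: eq_bigr => g _; apply: ind_map_linear.
Qed.

Lemma skew_ind_tens (X Y : skew) g (a : hom (per A) (twist S g X) Y) :
  skew_ind_map (@tens K gT (per A) (per_action S) X Y g a : hom skew X Y)
    = ind_map a.
Proof.
rewrite /skew_ind_map (bigD1 g) //= tens_same big1 ?addr0 // => h hg.
by rewrite tens_other 1?eq_sym // ind_map0.
Qed.

Lemma skew_ind_id (X : skew) :
  skew_ind_map (idm X) = idm (ind_cpx X : per B).
Proof.
rewrite [LHS]skew_ind_tens.
have [f -> fE] := eq_hom_twist1 (twist_ob1 S X).
rewrite ind_mapE; congr per_class; apply: chain_eq => i x; apply/ffunP => k.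
by rewrite ind_chainE fE invg1 mul1g id_lfunE.
Qed.

Lemma skew_ind_comp (X Y Z : skew) (b : hom skew Y Z) (a : hom skew X Y) :
  skew_ind_map (b \oc a) = skew_ind_map b \oc skew_ind_map a.
Proof.
have sumE I (r : seq I) (F : I -> hom skew X Z) :
    skew_ind_map (\sum_(i <- r) F i) = \sum_(i <- r) skew_ind_map (F i).
  elim/big_rec2: _ => [|i u v _ <-].
    have := @skew_ind_linear X Z (-1) 0 0.
    by rewrite scaler0 addr0 scaleN1r addNr.
  by have := @skew_ind_linear X Z 1 (F i) v; rewrite !scale1r.
rewrite [in RHS]/skew_ind_map comp_suml [LHS]sumE; apply: eq_bigr => h _.
rewrite [LHS]sumE comp_sumr; apply: eq_bigr => g _.
rewrite [LHS]skew_ind_tens.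
have [a' ->] : exists a' : chain (twist_cpx S g X) Y, a g = per_class a'.
  exact: per_classP.
have [b' ->] : exists b' : chain (twist_cpx S h Y) Z, b h = per_class b'.
  exact: per_classP.
have [e -> eE] := eq_hom_twistM (twist_obM S h g X).
rewrite [fmap _ _]twistE (ind_mapE a') (ind_mapE b').
rewrite (per_compM b' (twist_chain S h a')) per_compM per_compM ind_mapE.
congr per_class.
apply: chain_eq => i x; apply/ffunP => k.
rewrite chain_compE !ind_chainE !chain_compE eE.
by rewrite invMg mulgA.
Qed.

Definition skew_ind : linfunctor skew (per B) :=
  LinFunctor (C := skew) (D := per B) skew_ind_linear skew_ind_id skew_ind_comp.

Lemma skew_ind_classE (X Y : skew) (f : forall g, chain (twist_cpx S g X) Y) :
  skew_ind_map ((fun g => per_class (f g)) : hom skew X Y)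
    = per_class (\sum_g ind_chain (f g)).
Proof.
by rewrite per_class_sum; apply: eq_bigr => g _; apply: ind_mapE.
Qed.

(** If the sum over g of the images of f_g is null-homotopic by s, the
    component at g of s is a homotopy for f_g. *)
Lemma skew_ind_eq0 (X Y : skew) (f : hom skew X Y) :
  skew_ind_map f = 0 -> f = 0.
Proof.
pose f' g := lrepr (f g).
have -> : f = (fun g => per_class (f' g)).
  by apply: functional_extensionality_dep => g; rewrite /f' /per_class lreprK.
rewrite skew_ind_classE => /per_class_homotopy0[s [sP sE]].
apply: functional_extensionality_dep => g.
apply: (@per_class_eq0 K A (twist_cpx S g X) Y _
  (fun i => @ind_comp K gT A S (X (i + 1)) (Y i) g (s i))).
  by move=> i; apply: ind_comp_rhom; apply: sP.
move=> i m.
have <- : chain_map (\sum_h ind_chain (f' h)) (i + 1) (ind_unit S (X (i + 1)) m) g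
    = chain_map (f' g) (i + 1) m.
  rewrite chain_map_sum sum_ffunE (bigD1 g) //= big1 => [|h hg].
    by rewrite addr0 ind_homE ind_unitE mulVg eqxx.
  rewrite ind_homE ind_unitE -eq_mulVg1 (negbTE hg).
  exact: linear0.
rewrite sE ffunE cdiff_indE ind_diff_unit.
by congr (cdiff Y i _ + _); rewrite ind_compE.
Qed.

Lemma skew_ind_faithful : faithful skew_ind.
Proof.
move=> X Y f h e; apply/eqP; rewrite -subr_eq0; apply/eqP/skew_ind_eq0.
have := @skew_ind_linear X Y (-1) h f.
rewrite !scaleN1r ![- _ + _]addrC => ->.
by move/eqP: e; rewrite -subr_eq0 => /eqP.
Qed.

Lemma skew_ind_full : full skew_ind.
Proof.
move=> X Y u; have [u' ->] := per_classP u.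
have compP g : @is_chain K A (twist_cpx S g X) Y
    (fun i => @ind_comp K gT A S (X i) (Y i) g (chain_map u' i)).
  apply: is_chainP => [i|i m]; first by apply: ind_comp_rhom; apply: (chain_rhom u' i).
  rewrite [in RHS]ind_compE ind_compE -(ind_diff_unit (X := X)).
  by rewrite -(chain_commE u') cdiff_indE.
exists (fun g => per_class (mk_chain (compP g))).
apply: etrans (skew_ind_classE _) _; congr per_class.
apply: chain_eq => i x; rewrite chain_map_sum.
by rewrite [RHS]ind_comp_sum //; apply: (chain_rhom u' i).
Qed.

End SkewComplexes.

(** * Every complex is a direct summand of an induced one *)

Section SkewEquivalence.
Variables (K : fieldType) (gT : finGroupType) (A : falgType K).
Variable S : alg_action gT A.

Local Notation B := (skew_alg S).
Local Notation ind := (ind_mod S).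
Local Notation res := (@res_mod K gT A S).
Local Notation iota := (skew_inj S).
Local Notation sigma := (skew_grp S).
Local Notation "[ f ]" := (per_class f : hom (per B) _ _).

Section Restrict.
Variable Y : cpx B.

Definition res_cpx : cpx A :=
  @Cpx K A (fun i => res (Y i)) (cdiff Y) (fun i => res_rhom (cdiff_rhom Y i))
    (cdiff2 Y) (fun i => res_projective (cproj Y i)) (cbound Y).

Definition counit_map i : 'Hom(ind (res (Y i)), Y i) :=
  @ind_transpose K gT A S (res (Y i)) (Y i) \1%VF.

(** The averaging map v |-> 1/|G| times the sum of the v g^-1 (x) g, as in the
    proof of Maschke's theorem. *)
Definition section_map i : 'Hom(Y i, ind (res (Y i))) :=
  ((#|gT|%:R^-1 : K) *: @coind_transpose K gT A S (res (Y i)) (Y i) \1)%VF.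

Lemma counit_mapE i x : counit_map i x = \sum_g rmod_act (Y i) (x g) (sigma g).
Proof.
rewrite /counit_map ind_transposeE; apply: eq_bigr => g _.
by rewrite id_lfunE.
Qed.

Lemma section_mapE i v k :
  section_map i v k = #|gT|%:R^-1 *: rmod_act (Y i) v (sigma k^-1%g).
Proof. by rewrite scale_lfunE ffunE coind_transposeE id_lfunE. Qed.

Lemma counit_subproof : @is_chain K B (ind_cpx S res_cpx) Y counit_map.
Proof.
apply: is_chainP => [i|i x]; first by apply: ind_transpose_rhom; apply: rhom_id.
rewrite !counit_mapE linear_sum; apply: eq_bigr => g _.
rewrite /= (cdiff_rhom Y i); congr (rmod_act _ _ _); apply: esym.
exact: (@ind_diffE K gT A S res_cpx).
Qed.

Lemma section_subproof : @is_chain K B Y (ind_cpx S res_cpx) section_map.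
Proof.
apply: is_chainP => [i|i v].
  by apply: rhomZ; apply: coind_transpose_rhom; apply: rhom_id.
apply/ffunP => k; rewrite cdiff_indE !section_mapE linearZ /=.
by rewrite (cdiff_rhom Y i).
Qed.

Lemma section_mapK i v : (#|gT|%:R : K) != 0 -> counit_map i (section_map i v) = v.
Proof.
move=> G0; rewrite counit_mapE.
under eq_bigr => g _ do
  rewrite section_mapE ractZl -ractM -skew_grpM mulVg skew_grp1 ract1.
by rewrite -scaler_sumr sumr_const -scaler_nat scalerA mulVf // scale1r.
Qed.

End Restrict.

Lemma skew_ind_retract : (#|gT|%:R : K) != 0 -> retract_of_image (skew_ind S).
Proof.
move=> G0 Y; exists (res_cpx Y), (per_class (mk_chain (section_subproof Y))),
  (per_class (mk_chain (counit_subproof Y))).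
rewrite per_compM; congr per_class; apply: chain_eq => i v.
by rewrite chain_compE id_lfunE; apply: section_mapK.
Qed.

(** * Induction is exact *)

(** Induction from per A, viewed through the skew-group category. *)
Definition ind_functor : linfunctor (per A) (per B) :=
  comp_functor (skew_ind S) (to_skew (per_action S)).

Section InduceChain.
Variables (X Y : cpx A) (f : chain X Y).

Lemma twist1_chain_subproof : @is_chain K A (twist_cpx S 1%g X) Y (chain_map f).
Proof.
by split=> i; [apply: twist1_rhom (chain_rhom f i) | apply: (chain_comm f i)].
Qed.

Definition induce : chain (ind_cpx S X) (ind_cpx S Y) :=
  ind_chain (mk_chain twist1_chain_subproof).

Lemma induceE i (x : ind (X i)) k : chain_map induce i x k = chain_map f i (x k).
Proof. by rewrite ind_chainE invg1 mul1g. Qed.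

Lemma ind_functorE : fmap ind_functor (per_class f) = [induce].
Proof.
apply: etrans (skew_ind_tens _) _.
have [e -> eE] := eq_hom_twist1 (twist_ob1 S X).
rewrite (per_compM f e) ind_mapE; congr per_class; apply: chain_eq => i x.
apply/ffunP => k; rewrite induceE ind_chainE chain_compE eE.
by rewrite invg1 mul1g.
Qed.

End InduceChain.

Section InduceShift.
Variable X : cpx A.

Lemma ind_shift_subproof :
  @is_chain K B (ind_cpx S (shift_cpx X)) (shift_cpx (ind_cpx S X))
    (fun i => \1%VF : 'Hom(ind (X (i + 1)), ind (X (i + 1)))).
Proof.
apply: is_chainP => [i|i x]; first exact: rhom_id.
rewrite !id_lfunE cdiff_shiftE; apply/ffunP => k.
by rewrite [LHS]ffunE [in LHS]cdiff_indE [RHS]cdiff_indE [RHS]cdiff_shiftE.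
Qed.

(** Induction commutes with the shift on the nose in every degree, but the two
    differentials are equal only as functions. *)
Definition ind_shift : chain (ind_cpx S (shift_cpx X)) (shift_cpx (ind_cpx S X)) :=
  mk_chain ind_shift_subproof.

Lemma ind_shiftE i x : chain_map ind_shift i x = x.
Proof. exact: id_lfunE. Qed.

Lemma ind_shift_iso : is_iso [ind_shift].
Proof.
apply: (@chain_iso K B (ind_cpx S (shift_cpx X)) (shift_cpx (ind_cpx S X)) _
  (fun i => \1%VF : 'Hom(ind (X (i + 1)), ind (X (i + 1))))) => i x;
  by rewrite ind_shiftE id_lfunE.
Qed.

End InduceShift.

Section InduceCone.
Variables (X Y : cpx A) (u : chain X Y).

Definition ind_cone_map i : 'Hom(ind (cone u i), cone (induce u) i) :=
  dsum_pair (@ind_hom K gT A S (cone u i) (X (i + 1)) 1%g (dsum_fst _ _))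
    (@ind_hom K gT A S (cone u i) (Y i) 1%g (dsum_snd _ _)).

Lemma ind_cone_mapE i (x : ind (cone u i)) :
  ind_cone_map i x = ([ffun k => (x k).1], [ffun k => (x k).2]).
Proof.
rewrite /ind_cone_map dsum_pairE; congr (_, _); apply/ffunP => k;
  by rewrite ind_homE invg1 mul1g ffunE ?dsum_fstE ?dsum_sndE.
Qed.

Lemma ind_cone_subproof :
  @is_chain K B (ind_cpx S (cone u)) (cone (induce u)) ind_cone_map.
Proof.
apply: is_chainP => [i|i x].
  apply: dsum_pair_rhom; apply: ind_hom_rhom; apply: twist1_rhom.
    exact: dsum_fst_rhom.
  exact: dsum_snd_rhom.
rewrite ind_cone_mapE [RHS]ind_cone_mapE [LHS]cdiff_coneE /=.
congr (_, _); apply/ffunP => k; 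
  rewrite !ffunE !ind_diffE (@ind_diffE K gT A S (cone u) i x k) cdiff_coneE !ffunE //=.
by rewrite ind_homE invg1 mul1g ffunE.
Qed.

(** A function with values in a direct sum is a pair of functions. *)
Definition ind_cone : chain (ind_cpx S (cone u)) (cone (induce u)) :=
  mk_chain ind_cone_subproof.

Definition ind_cone_inv i : 'Hom(cone (induce u) i, ind (cone u i)) :=
  ((@ind_hom K gT A S (X (i + 1)) (cone u i) 1%g (dsum_inl _ _) \o dsum_fst _ _)
  + (@ind_hom K gT A S (Y i) (cone u i) 1%g (dsum_inr _ _) \o dsum_snd _ _))%VF.

Lemma ind_cone_invE i (x : cone (induce u) i) k :
  ind_cone_inv i x k = (x.1 k, x.2 k).
Proof.
rewrite add_lfunE !comp_lfunE ffunE !ind_homE dsum_fstE dsum_sndE.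
rewrite dsum_inlE dsum_inrE invg1 mul1g.
by congr (_, _); rewrite /= ?addr0 ?add0r.
Qed.

Lemma ind_cone_iso : is_iso [ind_cone].
Proof.
apply: (@chain_iso K B (ind_cpx S (cone u)) (cone (induce u)) _ ind_cone_inv) => i x.
  apply/ffunP => k; rewrite ind_cone_invE [chain_map _ _ _]ind_cone_mapE /= !ffunE.
  by rewrite -surjective_pairing.
rewrite [LHS]ind_cone_mapE; apply: injective_projections; apply/ffunP => k /=.
  by rewrite ffunE ind_cone_invE.
by rewrite ffunE ind_cone_invE.
Qed.

End InduceCone.

Lemma ind_shift_natural (X Y : per A) (f : hom (per A) X Y) :
  [ind_shift Y] \oc fmap ind_functor (fmap (per_shift A) f)
    = fmap (per_shift B) (fmap ind_functor f) \oc [ind_shift X].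
Proof.
have [f' ->] := per_classP f.
rewrite [fmap (per_shift A) _]per_shiftE !ind_functorE (per_shiftE (induce f')).
rewrite !per_compM; congr per_class; apply: chain_eq => i x.
rewrite !chain_compE !ind_shiftE; apply/ffunP => k.
by rewrite shift_chainE !induceE.
Qed.

Lemma ind_cone_out (X Y : cpx A) (u : chain X Y) :
  [cone_out (induce u)] \oc [ind_cone u]
    = [ind_shift X] \oc fmap ind_functor (per_class (cone_out u)).
Proof.
rewrite ind_functorE !per_compM; congr per_class; apply: chain_eq => i x.
rewrite !chain_compE ind_shiftE cone_outE [chain_map _ _ _]ind_cone_mapE.
apply/ffunP => k; rewrite ffunE [RHS](induceE (cone_out u)).
by rewrite cone_outE.
Qed.

Lemma ind_exact : exact_functor (per_tri A) (per_tri B) ind_functor.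
Proof.
exists (fun X => [ind_shift X]); split.
- exact: ind_shift_iso.
- exact: ind_shift_natural.
move=> X Y Z f g h [X0 [Y0 [u [a [b [c [[aP bP cP] uE iE oE]]]]]]].
pose I := ind_functor.
exists (ind_cpx S X0), (ind_cpx S Y0), (induce u), (fmap I a), (fmap I b),
  ([ind_cone u] \oc fmap I c).
have IP X1 Y1 (v : hom (per A) X1 Y1) : is_iso v -> is_iso (fmap I v).
  exact: is_iso_fmap.
split.
- by split; [exact: IP|exact: IP|apply: is_iso_comp (ind_cone_iso u) (IP _ _ _ cP)].
- by rewrite -ind_functorE -!fmap_comp uE.
- have -> : [cone_in (induce u)] = [ind_cone u] \oc fmap I (per_class (cone_in u)).
    rewrite ind_functorE per_compM; congr per_class; apply: chain_eq => i x.
    rewrite chain_compE cone_inE [RHS]ind_cone_mapE.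
    by congr (_, _); apply/ffunP => k; rewrite !ffunE induceE cone_inE.
  by rewrite -!compA -!fmap_comp iE.
rewrite [LHS]compA -ind_shift_natural -compA -fmap_comp oE fmap_comp.
by rewrite !compA ind_cone_out.
Qed.

End SkewEquivalence.

(** * The equivalence *)

Theorem corollary2p25 (K : closedFieldType) (gT : finGroupType)
    (hG : forall p : nat, p \in [pchar K] -> ~~ (p %| #|gT|)%N)
    (Lambda : falgType K) (S : alg_action gT Lambda) :
  exists T : tri_data (split_closure (skew_cat (per_action S))),
    [/\ is_triangulated T,
        exact_functor (per_tri Lambda) T (canonical_functor (per_action S)) &
        exists F : linfunctor (split_closure (skew_cat (per_action S)))
                              (per (skew_alg S)),
          is_equivalence F /\ exact_functor T (per_tri (skew_alg S)) F].
Proof.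
have G0 : (#|gT|%:R : K) != 0.
  rewrite natf_neq0_pchar; apply/pnatP; first by apply/card_gt0P; exists 1%g.
  by move=> p _ pG; apply/negP => /hG; rewrite pG.
have [F [equivF [theta [thetaP thetaN]]]] := split_extension
  (@skew_ind_faithful _ _ _ S) (@skew_ind_full _ _ _ S)
  (@per_idempotents_split _ (skew_alg S)) (skew_ind_retract G0).
have [G [eps [epsP epsN equivG]]] := equivalence_inverse equivF.
have triB := per_triangulated (skew_alg S).
exists (transport_tri (per_tri (skew_alg S)) eps); split.
- exact: (transport_triangulated equivF triB epsP epsN equivG).
- apply: (transport_exact_lift equivF triB epsP epsN
    (H := canonical_functor (per_action S)) (I := ind_functor S)
    (theta := fun X => theta X)) (ind_exact S).
  + exact: thetaP.
  + by move=> X Y f; apply: thetaN.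
exists F; split=> //.
exact: transport_exact.
Qed.
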